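(* Let $(M,\varphi,\xi_\alpha,\eta^\alpha,g)$ be a Lorentzian $\mathcal{S}$-manifold with $\dim(M)=2n+s$, $n>1$, $s\geqslant1$, where $\xi_1$ denotes the timelike characteristic vector field, and let $p\in M$. The following statements are equivalent. (a) $M$ is $\varphi$-null Osserman at $p$, and for any $u\in N_\varphi((\xi_1)_p)$ the Jacobi operator $\bar R_u^\varphi$ admits exactly two distinct eigenvalues $c_1,c_2\in\mathbb{R}$, with multiplicities $1$ and $2n-2$, respectively. (b) There exist an almost Hermitian structure $J$ on $\mathrm{Im}(\varphi_p)$ and $c_1,c_2\in\mathbb{R}$ such that $$R_p(x,y)z=T_p(x,y)z-S_p(x,y)z-c_2R^0(x,y)z-\frac{c_1-c_2}{3}\,R^J(x,y)z$$ for any $x,y,z\in T_pM$.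
   Context: All manifolds are smooth and connected. Globally framed $f$-manifolds. A globally framed $f$-manifold ($g.f.f$-manifold) $(M,\varphi,\xi_\alpha,\eta^\alpha)$, $\alpha\in\{1,\dots,s\}$, $s\ge 1$, $\dim M=2n+s$, is a manifold with a non-vanishing $(1,1)$-tensor field $\varphi$ of constant rank $2n$, vector fields $\xi_1,\dots,\xi_s$ and $1$-forms $\eta^1,\dots,\eta^s$ such that $\varphi^2=-I+\sum_{\alpha}\eta^\alpha\otimes\xi_\alpha$ and $\eta^\alpha(\xi_\beta)=\delta^\alpha_\beta$ (so $\varphi^3+\varphi=0$, $\varphi\xi_\alpha=0$, $\eta^\alpha\circ\varphi=0$, and $T_pM=\mathrm{Im}(\varphi_p)\oplus\mathrm{span}((\xi_1)_p,\dots,(\xi_s)_p)$). The $\xi_\alpha$ are the characteristic vector fields. It is normal if $[\varphi,\varphi]+2\sum_\alpha d\eta^\alpha\otimes\xi_\alpha=0$, where $[\varphi,\varphi](X,Y)=\varphi^2[X,Y]+[\varphi X,\varphi Y]-\varphi[\varphi X,Y]-\varphi[X,\varphi Y]$ and $2d\eta(X,Y)=X(\eta(Y))-Y(\eta(X))-\eta([X,Y])$. An indefinite metric $g$ is compatible if $g(\varphi X,\varphi Y)=g(X,Y)-\sum_\alpha\varepsilon_\alpha\eta^\alpha(X)\eta^\alpha(Y)$, where $\varepsilon_\alpha=g(\xi_\alpha,\xi_\alpha)=\pm1$; then $(M,\varphi,\xi_\alpha,\eta^\alpha,g)$ is an indefinite metric $g.f.f$-manifold. It is an indefinite $\mathcal{S}$-manifold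 if it is normal and $d\eta^\alpha=\Phi$ for every $\alpha$, where $\Phi(X,Y)=g(X,\varphi Y)$. It is Lorentzian if $g$ is Lorentzian (exactly one minus sign); then exactly one of the $\xi_\alpha$ is timelike, and it is always labelled $\xi_1$ (so $\varepsilon_1=-1$, $\varepsilon_\alpha=1$ for $\alpha\ge2$). Curvature convention: $R(Z,W)=[\nabla_Z,\nabla_W]-\nabla_{[Z,W]}$, $\nabla$ the Levi-Civita connection. Null Jacobi operators. For a lightlike $u\in T_pM$ ($u\ne0$, $g_p(u,u)=0$), let $\bar u^\bot=u^\bot/\mathrm{span}(u)$ with projection $\pi\colon u^\bot\to\bar u^\bot$ and the positive definite inner product $\bar g(\pi(x),\pi(y))=g_p(x,y)$. The Jacobi operator $\bar R_u\colon\bar u^\bot\to\bar u^\bot$ is $\bar R_u(\pi(x))=\pi(R_p(x,u)u)$; it is self-adjoint. $\varphi$-celestial sphere: $S_\varphi((\xi_1)_p)=\{x\in\mathrm{Im}(\varphi_p): g_p(x,x)=1\}$. $\varphi$-null congruence set: $N_\varphi((\xi_1)_p)=\{(\xi_1)_p+x : x\in S_\varphi((\xi_1)_p)\}$. $M$ is $\varphi$-null Osserman at $p$ (i.e. with respect to $(\xi_1)_p$) if the eigenvalues of $\bar R_u$ and their multiplicities are independent of $u\in N_\varphi((\xi_1)_p)$. The operator $\bar R_u^\varphi$. For $u=(\xi_1)_p+x\in N_\varphi((\xi_1)_p)$ put $V=x^\bot\cap\mathrm{Im}(\varphi_p)$. The subspace $W=V\oplus\mathrm{span}((\xi_2)_p,\dots,(\xi_s)_p)$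 ($W=V$ if $s=1$) satisfies $u^\bot=\mathrm{span}(u)\oplus W$, and $\pi|_W$ is an isometry $W\cong\bar u^\bot$, by which $\bar u^\bot$ is identified with $W$. Under this identification $\bar R_u$ leaves $V$ invariant, and $\bar R_u^\varphi$ denotes the restriction of $\bar R_u$ to $V$, regarded as an endomorphism of $V$ (of dimension $2n-1$). Tensors. With $\tilde\xi=\sum_{\alpha=1}^s\xi_\alpha$ and $\tilde\eta=\sum_{\alpha=1}^s\varepsilon_\alpha\eta^\alpha$, $$T(X,Y)Z=g(\varphi Y,\varphi Z)\tilde\eta(X)\tilde\xi-g(\varphi X,\varphi Z)\tilde\eta(Y)\tilde\xi-\tilde\eta(Y)\tilde\eta(Z)\varphi^2X+\tilde\eta(X)\tilde\eta(Z)\varphi^2Y,$$ $$S(X,Y)Z=g(\varphi X,\varphi Z)\varphi^2Y-g(\varphi Y,\varphi Z)\varphi^2X.$$ An almost Hermitian structure on $\mathrm{Im}(\varphi_p)$ is a linear $J\colon\mathrm{Im}(\varphi_p)\to\mathrm{Im}(\varphi_p)$ with $J^2=-I$ and $g_p(Jx,Jy)=g_p(x,y)$. At $p$, for $x,y,z\in T_pM$, $$R^0(x,y)z=g(\varphi^2y,\varphi^2z)\varphi^2x-g(\varphi^2x,\varphi^2z)\varphi^2y,$$ $$R^J(x,y)z=g(J\varphi^2y,\varphi^2z)J\varphi^2x-g(J\varphi^2x,\varphi^2z)J\varphi^2y+2g(\varphi^2x,J\varphi^2y)J\varphi^2z.$$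
   Formalization: In (b) the constants c_1, c_2 are required to be distinct; without this (b) does not imply (a), e.g. for s=2 over flat C^n the formula holds with c_1=c_2=1 and any J, while each Jacobi operator on V is the identity. *)

(* Defs.v *)
From HB Require Import structures.
From mathcomp Require Import all_boot all_order all_algebra.
From mathcomp Require Import all_classical all_reals all_analysis.

Set Implicit Arguments.
Unset Strict Implicit.
Unset Printing Implicit Defensive.

Import Order.TTheory GRing.Theory Num.Theory.
Import numFieldNormedType.Exports.

Local Open Scope classical_set_scope.
Local Open Scope ring_scope.

(* Quotients of subspaces. For B <= A, the space A / B is realised on a
   complement of B in A: quotv_pi is onto with kernel B on A, which
   characterises the quotient up to a unique isomorphism. *)
Notation quotv A B := (subvs_of (A :\: B)).

Section Quotient.
Context {K : fieldType} {vT : vectType K} (A B : {vspace vT}).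

Definition quotv_pi : 'Hom(vT, quotv A B) :=
  linfun (vsproj (A :\: B) \o addv_pi1 A B).

(* The endomorphism of A / B induced by f when f preserves A and B; see
   quotv_end_pi. *)
Definition quotv_end (f : 'End(vT)) : 'End(quotv A B) :=
  linfun (quotv_pi \o f \o vsval).

Lemma quotv_piE x : vsval (quotv_pi x) = addv_pi1 A B x.
Proof. by rewrite /quotv_pi lfunE /= vsprojK // memv_pi. Qed.

Lemma quotv_pi_surj (y : quotv A B) : exists2 x, x \in A & quotv_pi x = y.
Proof.
have yAB : vsval y \in (A :\: B)%VS by apply: subvsP.
exists (vsval y); first by apply: subvP yAB; apply: diffvSl.
by apply: val_inj; rewrite /= quotv_piE /addv_pi1 daddv_pi_id ?capv_diff.
Qed.

Lemma quotv_pi_eq0 x : x \in A -> (quotv_pi x == 0) = (x \in B).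
Proof.
move=> xA.
have xAB : x \in (A + B)%VS by apply: subvP xA; apply: addvSl.
have xE := addv_pi1_pi2 xAB.
rewrite -(inj_eq val_inj) /= quotv_piE; apply/eqP/idP => [x0|xB].
  by rewrite -xE x0 add0r memv_pi.
have : addv_pi1 A B x \in ((A :\: B) :&: B)%VS.
  rewrite memv_cap memv_pi /=.
  have -> : addv_pi1 A B x = x - addv_pi2 A B x by rewrite -[X in X - _]xE addrK.
  by rewrite rpredB // memv_pi.
by rewrite capv_diff memv0 => /eqP.
Qed.

Lemma quotv_end_pi (f : 'End(vT)) x : (B <= A)%VS -> (f @: A <= A)%VS ->
  (f @: B <= B)%VS -> x \in A -> quotv_end f (quotv_pi x) = quotv_pi (f x).
Proof.
move=> BA fA fB xA; rewrite /quotv_end lfunE /= quotv_piE.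
have xAB : x \in (A + B)%VS by apply: subvP xA; apply: addvSl.
have xE := addv_pi1_pi2 xAB.
apply/eqP; rewrite -subr_eq0 -!linearB /=.
have dB : addv_pi1 A B x - x \in B.
  by rewrite -[X in _ - X]xE opprD addrA subrr add0r rpredN memv_pi.
have fdB : f (addv_pi1 A B x - x) \in B by apply: (subvP fB); apply: memv_img.
by rewrite quotv_pi_eq0 // (subvP BA).
Qed.

End Quotient.

Section SmoothMaps.
Context {R : realType} {V W : normedModType R}.

Fixpoint times_differentiable (k : nat) (U : set V) (f : V -> W) : Prop :=
  match k with
  | 0 => forall x, U x -> {for x, continuous f}
  | k'.+1 => (forall x, U x -> differentiable f x) /\
             forall v, times_differentiable k' U ('D_v f)
  end.

Definition smooth_on (U : set V) (f : V -> W) : Prop :=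
  forall k, times_differentiable k U f.

End SmoothMaps.

(* chart_inv is only meaningful on the image of chart_dom. *)
Record chart (R : realType) (m : nat) (M : topologicalType) := Chart {
  chart_dom : set M;
  chart_fun :> M -> 'rV[R]_m;
  chart_inv : 'rV[R]_m -> M;
  chart_dom_open : open chart_dom;
  chart_img_open : open (chart_fun @` chart_dom);
  chart_funK : forall q, chart_dom q -> chart_inv (chart_fun q) = q;
  chart_fun_continuous :
    forall q, chart_dom q -> {for q, continuous chart_fun};
  chart_inv_continuous :
    forall y, (chart_fun @` chart_dom) y -> {for y, continuous chart_inv}
}.

Record manifold (R : realType) (m : nat) := Manifold {
  mspace :> topologicalType;
  mspace_hausdorff : hausdorff_space mspace;
  mspace_second_countable : @second_countable mspace;
  mspace_connected : connected [set: mspace];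
  atlas : set (chart R m mspace);
  atlas_cover : forall q, exists c, atlas c /\ chart_dom c q;
  atlas_smooth : forall c c', atlas c -> atlas c' ->
    smooth_on (c @` (chart_dom c `&` chart_dom c')) (c' \o chart_inv c)
}.

Section Calculus.
Context {R : realType} {m : nat} {M : manifold R m}.

(* Tangent spaces. A chart around q is fixed for every point q, and T_q M is
   identified with R^m = 'rV[R]_m through that chart. The component of a tangent
   vector in any other chart is given by the derivative of the transition map,
   so vectors at distinct points must only be compared through [vder]. *)
Definition chart_at (q : M) : chart R m M := projT1 (cid (atlas_cover q)).

Local Notation T := 'rV[R]_m.

(* The derivative of F at q in the direction of v in T_q M; when F is a chart
   this gives the components of v in that chart. *)
Definition vder {W : normedModType R} (q : M) (v : T) (F : M -> W) : W :=
  'D_v (F \o chart_inv (chart_at q)) (chart_at q q).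

Definition smooth_fun {W : normedModType R} (U : set M) (F : M -> W) : Prop :=
  forall c, atlas c -> smooth_on (c @` (U `&` chart_dom c)) (F \o chart_inv c).

Definition smooth_field (U : set M) (X : M -> T) : Prop :=
  forall c, atlas c ->
    smooth_on (c @` (U `&` chart_dom c))
      ((fun q => vder q (X q) c) \o chart_inv c).

(* In coordinates (x^i) at p, [X, Y]^i = X(Y x^i) - Y(X x^i). *)
Definition lie (X Y : M -> T) (p : M) : T :=
  vder p (X p) (fun q => vder q (Y q) (chart_at p)) -
  vder p (Y p) (fun q => vder q (X q) (chart_at p)).

(* Near p, the vector field with constant components v in the chart at p. *)
Definition extend (p : M) (v : T) (q : M) : T :=
  'D_v (chart_at q \o chart_inv (chart_at p)) (chart_at p q).

(* Normalised by 2 d eta (X, Y) = X (eta Y) - Y (eta X) - eta [X, Y]. *)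
Definition dform (eta : M -> 'Hom(T, R^o)) (X Y : M -> T) (p : M) : R :=
  2^-1 * (vder p (X p) (fun q => eta q (Y q)) -
          vder p (Y p) (fun q => eta q (X q)) - eta p (lie X Y p)).

Definition metric_tensor := M -> 'Hom(T, 'Hom(T, R^o)).

(* A connection is given by (nabla_v Y)_p = D p v Y for v in T_p M. *)
Definition connection := forall p : M, T -> (M -> T) -> T.

Definition cov (D : connection) (X Y : M -> T) : M -> T :=
  fun q => D q (X q) Y.

(* All conditions are imposed on vector fields (and functions) that are smooth
   on an arbitrary open subset U, at the points of U; values elsewhere are
   irrelevant. *)
Record levi_civita (g : metric_tensor) (D : connection) : Prop := LeviCivita {
  lc_smooth : forall (U : set M) X Y, open U ->
    smooth_field U X -> smooth_field U Y -> smooth_field U (cov D X Y);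
  lc_linear : forall (U : set M) Y p a v w, open U -> smooth_field U Y -> U p ->
    D p (a *: v + w) Y = a *: D p v Y + D p w Y;
  lc_additive : forall (U : set M) Y Z p v, open U ->
    smooth_field U Y -> smooth_field U Z -> U p ->
    D p v (fun q => Y q + Z q) = D p v Y + D p v Z;
  lc_leibniz : forall (U : set M) (f : M -> R^o) Y p v, open U ->
    smooth_fun U f -> smooth_field U Y -> U p ->
    D p v (fun q => f q *: Y q) = vder p v f *: Y p + f p *: D p v Y;
  lc_torsion_free : forall (U : set M) X Y p, open U ->
    smooth_field U X -> smooth_field U Y -> U p ->
    cov D X Y p - cov D Y X p = lie X Y p;
  lc_metric : forall (U : set M) X Y Z p, open U ->
    smooth_field U X -> smooth_field U Y -> smooth_field U Z -> U p ->
    vder p (X p) (fun q => g q (Y q) (Z q)) =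
    g p (cov D X Y p) (Z p) + g p (Y p) (cov D X Z p)
}.

Definition curvature (D : connection) (X Y Z : M -> T) : M -> T :=
  fun q => cov D X (cov D Y Z) q - cov D Y (cov D X Z) q - cov D (lie X Y) Z q.

(* R_p(x, y) z; by tensoriality any other extension of x, y, z to vector fields
   near p gives the same value. *)
Definition curvature_at (D : connection) (p : M) (x y z : T) : T :=
  curvature D (extend p x) (extend p y) (extend p z) p.

(* A symmetric form of signature (1, m - 1). *)
Definition lorentzian_form (b : 'Hom(T, 'Hom(T, R^o))) : Prop :=
  (forall x y, b x y = b y x) /\
  exists (e : 'I_m -> T) (i0 : 'I_m), forall i j,
    b (e i) (e j) = if i == j then (if i == i0 then -1 else 1) else 0.

Definition lorentzian_metric (g : metric_tensor) : Prop :=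
  (forall p, lorentzian_form (g p)) /\
  forall (U : set M) X Y, open U -> smooth_field U X -> smooth_field U Y ->
    smooth_fun U (fun q => g q (X q) (Y q) : R^o).

End Calculus.

Arguments metric_tensor {R m} M.
Arguments connection {R m} M.

(* The structure tensors (phi, xi_a, eta^a, g), before any condition. *)
Record gff_data (R : realType) (m : nat) (M : manifold R m) (s : nat) :=
  GffData {
    phi : M -> 'End('rV[R]_m);
    xi : 'I_s -> M -> 'rV[R]_m;
    eta : 'I_s -> M -> 'Hom('rV[R]_m, R^o);
    met : metric_tensor M
  }.

Section GloballyFramed.
Context {R : realType} {m s : nat} {M : manifold R m} (F : gff_data M s).
Local Notation T := 'rV[R]_m.
Local Notation phi := (phi F).
Local Notation xi := (xi F).
Local Notation eta := (eta F).
Local Notation g := (met F).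

Record gff_manifold (n : nat) : Prop := GffManifold {
  gff_phi_smooth : forall (U : set M) X, open U -> smooth_field U X ->
    smooth_field U (fun q => phi q (X q));
  gff_xi_smooth : forall a, smooth_field [set: M] (xi a);
  gff_eta_smooth : forall a (U : set M) X, open U -> smooth_field U X ->
    smooth_fun U (fun q => eta a q (X q));
  gff_phi_neq0 : forall p, phi p != 0;
  gff_phi_rank : forall p, \dim (limg (phi p)) = (2 * n)%N;
  gff_phi2 : forall p x,
    phi p (phi p x) = - x + \sum_a (eta a p x : R) *: xi a p;
  gff_dual : forall p a b, eta a p (xi b p) = (a == b)%:R
}.

Definition eps (a : 'I_s) (p : M) : R := g p (xi a p) (xi a p).

Definition compatible_metric : Prop :=
  (forall a p, eps a p = 1 \/ eps a p = -1) /\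
  forall p x y, g p (phi p x) (phi p y) =
    g p x y - \sum_a eps a p * eta a p x * eta a p y.

Definition nijenhuis (X Y : M -> T) (p : M) : T :=
  phi p (phi p (lie X Y p)) +
  lie (fun q => phi q (X q)) (fun q => phi q (Y q)) p -
  phi p (lie (fun q => phi q (X q)) Y p) -
  phi p (lie X (fun q => phi q (Y q)) p).

Definition gff_normal : Prop :=
  forall (U : set M) X Y p, open U -> smooth_field U X -> smooth_field U Y ->
    U p ->
    nijenhuis X Y p + 2 *: (\sum_a dform (eta a) X Y p *: xi a p) = 0.

Definition deta_eq_Phi : Prop :=
  forall a (U : set M) X Y p, open U -> smooth_field U X -> smooth_field U Y ->
    U p -> dform (eta a) X Y p = g p (X p) (phi p (Y p)).

(* xi_a1 is the timelike characteristic vector field. *)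
Record lorentzian_S_manifold (n : nat) (a1 : 'I_s) : Prop :=
  LorentzianSManifold {
    lS_gff : gff_manifold n;
    lS_lorentzian : lorentzian_metric g;
    lS_compatible : compatible_metric;
    lS_normal : gff_normal;
    lS_deta : deta_eq_Phi;
    lS_timelike : forall p, eps a1 p = -1
  }.

Section AtPoint.
Variables (D : connection M) (a1 : 'I_s) (p : M).

Definition perp (u : T) : {vspace T} := lker (g p u).

Definition im_phi : {vspace T} := limg (phi p).

Definition celestial_sphere : set T :=
  [set x | x \in im_phi /\ g p x x = 1].

Definition null_congruence : set T :=
  [set xi a1 p + x | x in celestial_sphere].

(* x |-> R_p(x, u) u *)
Definition jacobi (u : T) : 'End(T) :=
  linfun (fun x => curvature_at D p x u u).

Definition jacobi_bar (u : T) : 'End(quotv (perp u) <[u]>%VS) :=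
  quotv_end (perp u) <[u]>%VS (jacobi u).

(* Since jacobi_bar u is self-adjoint for a positive definite inner product, its
   eigenvalues are real and their multiplicities are the dimensions of the
   eigenspaces. *)
Definition phi_null_osserman : Prop :=
  forall u v, null_congruence u -> null_congruence v -> forall c : R,
    \dim (passmx.leigenspace (jacobi_bar u) c) = \dim (passmx.leigenspace (jacobi_bar v) c).

(* For u = xi_a1 + x, the spaces V and W. *)
Definition spaceV (u : T) : {vspace T} :=
  (perp (u - xi a1 p) :&: im_phi)%VS.

Definition spaceW (u : T) : {vspace T} :=
  (spaceV u + \sum_(a | a != a1) <[xi a p]>)%VS.

Definition piW (u : T) :
    'Hom(subvs_of (spaceW u), quotv (perp u) <[u]>%VS) :=
  linfun (quotv_pi (perp u) <[u]>%VS \o vsval).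

(* jacobi_bar u transported to W along the isomorphism piW u. *)
Definition jacobiW (u : T) : 'End(subvs_of (spaceW u)) :=
  ((piW u)^-1 \o (jacobi_bar u \o piW u))%VF.

(* Restriction of jacobiW u to V, which it preserves. *)
Definition jacobi_phi (u : T) : 'End(subvs_of (spaceV u)) :=
  linfun (vsproj (spaceV u) \o vsval \o jacobiW u \o vsproj (spaceW u) \o
          vsval).

Definition eta_tilde (x : T) : R := \sum_a eps a p * eta a p x.
Definition xi_tilde : T := \sum_a xi a p.

Definition phi2 (x : T) : T := phi p (phi p x).

Definition tensorT (x y z : T) : T :=
  (g p (phi p y) (phi p z) * eta_tilde x) *: xi_tilde -
  (g p (phi p x) (phi p z) * eta_tilde y) *: xi_tilde -
  (eta_tilde y * eta_tilde z) *: phi2 x +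
  (eta_tilde x * eta_tilde z) *: phi2 y.

Definition tensorS (x y z : T) : T :=
  (g p (phi p x) (phi p z) : R) *: phi2 y -
  (g p (phi p y) (phi p z) : R) *: phi2 x.

Definition tensorR0 (x y z : T) : T :=
  (g p (phi2 y) (phi2 z) : R) *: phi2 x - (g p (phi2 x) (phi2 z) : R) *: phi2 y.

Definition almost_hermitian (J : 'End(subvs_of im_phi)) : Prop :=
  (forall x, J (J x) = - x) /\
  forall x y, g p (vsval (J x)) (vsval (J y)) = g p (vsval x) (vsval y).

(* x |-> J (phi^2 x), with values in T_p M. *)
Definition Jphi2 (J : 'End(subvs_of im_phi)) (x : T) : T :=
  vsval (J (vsproj im_phi (phi2 x))).

Definition tensorRJ (J : 'End(subvs_of im_phi)) (x y z : T) : T :=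
  (g p (Jphi2 J y) (phi2 z) : R) *: Jphi2 J x -
  (g p (Jphi2 J x) (phi2 z) : R) *: Jphi2 J y +
  (2 * g p (phi2 x) (Jphi2 J y)) *: Jphi2 J z.

End AtPoint.
End GloballyFramed.

(* Main.v *)
Require Import Defs.
From HB Require Import structures.
From mathcomp Require Import all_boot all_order all_algebra.
From mathcomp Require Import all_classical all_reals all_analysis.
From mathcomp Require Import ring lra.

Set Implicit Arguments.
Unset Strict Implicit.
Unset Printing Implicit Defensive.

Import Order.TTheory GRing.Theory Num.Theory.
Import numFieldNormedType.Exports.

Local Open Scope classical_set_scope.
Local Open Scope ring_scope.

(* The structure equations of an S-manifold determine nabla xi_a = - eps_a phi and
   nabla phi, hence R(x, y) xi_a, so that only the curvature on Im(phi_p) is free.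
   For u = xi_1 + x the Jacobi operator preserves V, where it is
   y |-> R(y, x) x + y, and span(xi_2, .., xi_s), where it does not depend on u;
   the Osserman condition thus makes c1 and c2 independent of u.
   Condition (a) then says that, up to a constant curvature tensor and a factor,
   the curvature r on Im(phi_p) satisfies r(y, x, x, z) = <y, e_x> <z, e_x> for
   all unit x, with e_x a unit vector determined up to sign. The symmetry of
   r(y, x, x, y) in x and y forces <y, e_x> = +- <x, e_y>; the signs can be chosen
   so that x |-> e_x is linear, and this is J. Finally a curvature tensor is
   determined by its values r(y, x, x, y). *)

(** * Smooth calculus *)

Section SmoothCalculus.
Context {R : realType}.
Implicit Types V W : normedModType R.

(** The identity in y |-> R(y, x) x + y is the contribution of xi_1, since R(y, xi_1) xi_1 = y on V;
    this is why the constant-curvature part of r carries the factor c2 - 1. On span(xi_2, .., xi_s)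
    the dependence on u disappears because R(xi_a, u) u = u + xi_2 + .. + xi_s, taken modulo u. The
    denominator 3 compensates R^J, whose value at (y, x, x, y) is -3 <y, Jx>^2. The choice of signs
    is the real obstacle, as e_x is not known to depend continuously on x. Two quadratic forms in x
    with equal squares are compared, and quadratic forms have no zero divisors, so a single sign
    works for all x. A connection is constrained only on fields that are smooth on open sets.
    Pointwise tensors are therefore computed with the coordinate fields [extend p v], which commute
    on the whole chart domain, and [cov_eq] supplies the locality that this requires. *)

Lemma near_eq_differentiable V W (f g : V -> W) x :
  (\near x, f x = g x) -> differentiable f x -> differentiable g x.
Proof.
move=> fg df; have gfx : g x = f x by rewrite (nbhs_singleton fg).
have fg0 : \forall h \near (0 : V), f (h + x) = g (h + x).
  by move: fg; rewrite (near_shift 0 x) subr0.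
have dg : g \o shift x = cst (g x) + 'd f x +o_ 0 id.
  apply/eqaddoP => e e0.
  have /eqaddoP/(_ e e0) := diff_locally df; apply: filterS2 fg0 => h.
  by rewrite !fctE /= gfx => ->.
have dgE := diff_unique (@diff_continuous _ _ _ _ _ df) dg.
apply/diff_locallyP; rewrite dgE; split => //.
exact: diff_continuous.
Qed.

(** Presenting scaling as a bilinear map makes the product rule for a scalar function times a
    vector-valued one an instance of differentiating a bilinear map. *)
Lemma scale_is_bilinear V :
  bilinear_for (GRing.Scale.Law.clone _ _ *:%R _)
    (GRing.Scale.Law.clone _ _ *:%R _) (@GRing.scale R V : R^o -> V -> V).
Proof.
split=> [u'|u] a x y /=; first by rewrite scalerDl scalerA.
by rewrite scalerDr !scalerA mulrC.
Qed.

Lemma differentiable_scale V W (f : V -> R^o) (g : V -> W) x :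
  differentiable f x -> differentiable g x ->
  differentiable (fun y => f y *: g y) x.
Proof.
move=> df dg.
pose b := bilinear_isBilinear.Build R R^o W W _ _ _ (scale_is_bilinear W).
pose s : {bilinear R^o -> W -> W} := HB.pack (@GRing.scale R W : R^o -> W -> W) b.
have -> : (fun y => f y *: g y) = (fun p => s p.1 p.2) \o (fun y => (f y, g y)).
  by [].
apply: differentiable_comp; first exact: differentiable_pair.
by apply: differentiable_bilin => p; apply: scale_continuous.
Qed.

Lemma derive_scale V W (f : V -> R^o) (g : V -> W) x v :
  differentiable f x -> differentiable g x ->
  'D_v (fun y => f y *: g y) x = 'D_v f x *: g x + f x *: 'D_v g x.
Proof.
move=> df dg; rewrite !deriveE//; last exact: differentiable_scale.
pose b := bilinear_isBilinear.Build R R^o W W _ _ _ (scale_is_bilinear W).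
pose s : {bilinear R^o -> W -> W} := HB.pack (@GRing.scale R W : R^o -> W -> W) b.
have sc : continuous (fun p => s p.1 p.2) by move=> p; apply: scale_continuous.
have -> : (fun y => f y *: g y) = (fun p => s p.1 p.2) \o (fun y => (f y, g y)).
  by [].
have sd p : differentiable (fun p => s p.1 p.2) p by exact: differentiable_bilin.
have sE := diff_bilin (f x, g x) sc.
rewrite diff_comp //; last exact: differentiable_pair.
by rewrite [LHS]/= [X in X _ = _]sE diff_pair//= addrC.
Qed.

Lemma derive_comp_row V W k (h : V -> 'rV[R]_k) (f : 'rV[R]_k -> W) x v :
  differentiable h x -> differentiable f (h x) ->
  'D_v (f \o h) x = 'D_('D_v h x) f (h x).
Proof.
move=> dh df; rewrite !deriveE//; last exact: differentiable_comp.
by rewrite diff_comp.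
Qed.

Lemma derive_linear V W (f : V -> W) x a v w :
  differentiable f x -> 'D_(a *: v + w) f x = a *: 'D_v f x + 'D_w f x.
Proof. by move=> df; rewrite !deriveE// linearP. Qed.

Lemma derive_row_sum W k (f : 'rV[R]_k -> W) y w : differentiable f y ->
  'D_w f y = \sum_i w 0 i *: 'D_(delta_mx 0 i) f y.
Proof.
move=> df; rewrite deriveE// {1}[w]row_sum_delta linear_sum.
by apply: eq_bigr => i _; rewrite linearZ deriveE.
Qed.

Lemma smooth_at V W (U : set V) (f : V -> W) x :
  smooth_on U f -> U x -> differentiable f x.
Proof. by move=> /(_ 1) [df _]; apply: df. Qed.

Lemma smooth_derive V W (U : set V) (f : V -> W) v :
  smooth_on U f -> smooth_on U ('D_v f).
Proof. by move=> fs k; have [_] := fs k.+1; apply. Qed.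

Lemma times_differentiable_eq k V W (U : set V) (f g : V -> W) : open U ->
  (forall x, U x -> f x = g x) ->
  times_differentiable k U f -> times_differentiable k U g.
Proof.
move=> Uo; elim: k f g => [|k IH] f g fg /=.
  move=> fc x Ux; rewrite /prop_for /continuous_at -fg//.
  apply: cvg_trans (fc x Ux); apply: near_eq_cvg.
  by apply: filterS (open_nbhs_nbhs (conj Uo Ux)) => y; apply: fg.
move=> [df Df]; have fgn x : U x -> \near x, f x = g x.
  by move=> Ux; apply: filterS (open_nbhs_nbhs (conj Uo Ux)) => y; apply: fg.
split=> [x Ux|v]; first exact: near_eq_differentiable (fgn _ Ux) (df x Ux).
by apply: IH (Df v) => x Ux; apply: near_eq_derive (fgn x Ux).
Qed.

Lemma smooth_on_eq V W (U : set V) (f g : V -> W) : open U ->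
  (forall x, U x -> f x = g x) -> smooth_on U f -> smooth_on U g.
Proof. by move=> Uo fg fs k; apply: times_differentiable_eq fg (fs k). Qed.

Lemma smooth_on_subset V W (U U' : set V) (f : V -> W) : U' `<=` U ->
  smooth_on U f -> smooth_on U' f.
Proof.
move=> UU fs k; move: (fs k) => {fs}; elim: k f => [|k IH] f /=.
  by move=> fc x /UU; apply: fc.
by move=> [df Df]; split=> [x /UU|v]; [apply: df|apply: IH].
Qed.

Lemma times_differentiableW k V W (U : set V) (f : V -> W) :
  times_differentiable k.+1 U f -> times_differentiable k U f.
Proof.
elim: k f => [|k IH] f [df Df]; last by split=> // v; apply: IH.
by move=> x Ux; apply: differentiable_continuous; apply: df.
Qed.

Lemma times_differentiableD k V W (U : set V) (f g : V -> W) : open U ->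
  times_differentiable k U f -> times_differentiable k U g ->
  times_differentiable k U (fun x => f x + g x).
Proof.
move=> Uo; elim: k f g => [|k IH] f g /=.
  by move=> fc gc x Ux; apply: continuousD; [apply: fc|apply: gc].
move=> [df Df] [dg Dg]; split=> [x Ux|v].
  by apply: differentiableD; [apply: df|apply: dg].
apply: times_differentiable_eq (IH _ _ (Df v) (Dg v)) => // x Ux.
by rewrite [RHS]deriveD//; apply: diff_derivable; [apply: df|apply: dg].
Qed.

Lemma times_differentiable_cst k V W (U : set V) (a : W) :
  times_differentiable k U (fun=> a).
Proof.
elim: k a => [|k IH] a /=; first by move=> x _; apply: cvg_cst.
split=> [x _|v]; first exact: differentiable_cst.
rewrite (_ : 'D_v _ = fun=> 0) //.
by apply/funext => x; apply: derive_cst.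
Qed.

Lemma times_differentiable_sum k V W (U : set V) I (r : seq I) (f : I -> V -> W) :
  open U -> (forall i, times_differentiable k U (f i)) ->
  times_differentiable k U (fun x => \sum_(i <- r) f i x).
Proof.
move=> Uo fs; elim: r => [|i r IH].
  apply: times_differentiable_eq Uo _ (times_differentiable_cst k U 0).
  by move=> x _; rewrite big_nil.
apply: times_differentiable_eq Uo _ (times_differentiableD Uo (fs i) IH).
by move=> x _; rewrite big_cons.
Qed.

Lemma times_differentiableZ k V W (U : set V) (f : V -> R^o) (g : V -> W) :
  open U -> times_differentiable k U f -> times_differentiable k U g ->
  times_differentiable k U (fun x => f x *: g x).
Proof.
move=> Uo; elim: k f g => [|k IH] f g.
  by move=> fc gc x Ux; apply: continuousZ; [apply: fc|apply: gc].
move=> fk gk; have [df Df] := fk; have [dg Dg] := gk; split=> [x Ux|v].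
  by apply: differentiable_scale; [apply: df|apply: dg].
have := times_differentiableD Uo (IH _ _ (Df v) (times_differentiableW gk))
  (IH _ _ (times_differentiableW fk) (Dg v)).
apply: times_differentiable_eq => // x Ux.
by rewrite derive_scale//; [apply: df|apply: dg].
Qed.

Lemma smooth_onZ V W (U : set V) (f : V -> R^o) (g : V -> W) : open U ->
  smooth_on U f -> smooth_on U g -> smooth_on U (fun x => f x *: g x).
Proof. by move=> Uo fs gs k; apply: times_differentiableZ. Qed.

Lemma smooth_onD V W (U : set V) (f g : V -> W) : open U ->
  smooth_on U f -> smooth_on U g -> smooth_on U (fun x => f x + g x).
Proof. by move=> Uo fs gs k; apply: times_differentiableD. Qed.

Lemma derive_coord V k (f : V -> 'rV[R]_k) x v i : differentiable f x ->
  'D_v (fun y => f y 0 i : R^o) x = 'D_v f x 0 i.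
Proof. by move=> df; rewrite derive_mx ?mxE//; apply: diff_derivable. Qed.

Lemma times_differentiable_coord k V m (U : set V) (f : V -> 'rV[R]_m) i :
  open U -> times_differentiable k U f ->
  times_differentiable k U (fun x => f x 0 i : R^o).
Proof.
move=> Uo; elim: k f => [|k IH] f.
  move=> fc x Ux; apply: (@continuous_comp _ _ _ f (fun M => M 0 i : R^o)).
    exact: fc.
  exact: coord_continuous.
move=> [df Df]; split=> [x Ux|v].
  apply: (@differentiable_comp _ _ _ _ f (fun M => M 0 i : R^o)).
    exact: df.
  exact: differentiable_coord.
apply: times_differentiable_eq (IH _ (Df v)) => // x Ux.
by rewrite derive_coord//; apply: df.
Qed.

Lemma smooth_on_coord V m (U : set V) (f : V -> 'rV[R]_m) i : open U ->
  smooth_on U f -> smooth_on U (fun x => f x 0 i : R^o).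
Proof. by move=> Uo fs k; apply: times_differentiable_coord. Qed.

(** Smoothness is defined through derivatives in constant directions, while the chain rule gives a
    derivative of f in the varying direction ['D_v h x]. Expanding that direction in the standard
    basis of the source of f yields a sum of products, to which the induction hypothesis applies. *)
Lemma times_differentiable_comp k V W m (U : set V) (U' : set 'rV[R]_m)
    (h : V -> 'rV[R]_m) (f : 'rV[R]_m -> W) : open U ->
  (forall x, U x -> U' (h x)) ->
  times_differentiable k U h -> times_differentiable k U' f ->
  times_differentiable k U (f \o h).
Proof.
move=> Uo hU; elim: k f => [|k IH] f.
  by move=> hc fc x Ux; apply: continuous_comp; [apply: hc|apply/fc/hU].
move=> hk fk; have [dh Dh] := hk; have [df Df] := fk; split=> [x Ux|v].
  by apply: differentiable_comp; [apply: dh|apply/df/hU].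
have Dfh i : times_differentiable k U
    (fun x => ('D_v h x 0 i : R^o) *: 'D_(delta_mx 0 i) f (h x)).
  apply: times_differentiableZ => //; first by apply: times_differentiable_coord (Dh v).
  by apply: (IH ('D_(delta_mx 0 i) f)); [exact: times_differentiableW|exact: Df].
apply: times_differentiable_eq (times_differentiable_sum _ Uo Dfh) => // x Ux.
rewrite derive_comp_row; [|exact: dh|exact/df/hU].
by rewrite derive_row_sum//; apply/df/hU.
Qed.

Lemma smooth_on_comp V W m (U : set V) (U' : set 'rV[R]_m)
    (h : V -> 'rV[R]_m) (f : 'rV[R]_m -> W) : open U ->
  (forall x, U x -> U' (h x)) ->
  smooth_on U h -> smooth_on U' f -> smooth_on U (f \o h).
Proof. by move=> Uo hU hs fs k; apply: times_differentiable_comp hU _ _. Qed.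

Lemma is_derive_line V W (f : V -> W) x v (t : R) :
  differentiable f (x + t *: v) ->
  is_derive t 1 (fun s : R => f (x + s *: v)) ('D_v f (x + t *: v)).
Proof.
move=> df; have E : (fun h : R => h^-1 *: (f (x + (h *: 1 + t) *: v) -
    f (x + t *: v))) = fun h => h^-1 *: ((f \o shift (x + t *: v)) (h *: v) -
    f (x + t *: v)).
  apply/funext => h /=; congr (_ *: (f _ - _)).
  by rewrite -[h *: 1]/(h * 1) mulr1 scalerDl addrCA.
split; first by rewrite /derivable /= E; apply: diff_derivable.
by rewrite /derive /= E.
Qed.

Lemma mean_value_line V (f : V -> R^o) x v (h : R) : 0 < h ->
  (forall t, 0 <= t <= h -> differentiable f (x + t *: v)) ->
  exists2 t, 0 <= t <= h & f (x + h *: v) - f x = h * 'D_v f (x + t *: v).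
Proof.
move=> h0 df.
have [||t tI] := @MVT _ (fun t : R => f (x + t *: v) : R^o)
    (fun t => 'D_v f (x + t *: v)) 0 h h0.
- move=> t; rewrite in_itv /= => /andP[t0 th].
  by apply: is_derive_line; apply: df; rewrite !ltW.
- apply: derivable_within_continuous => t; rewrite in_itv /= => th.
  by have [] := is_derive_line (df t th).
rewrite scale0r addr0 subr0 mulrC => ->; exists t => //.
by move: tI; rewrite in_itv /= => /andP[t0 th]; rewrite !ltW.
Qed.

Lemma derive_translate V W (f : V -> W) x v w :
  'D_v (fun y => f (y + w)) x = 'D_v f (x + w).
Proof.
rewrite /derive; set F := fun h : R => _; set G := fun h : R => _.
suff -> : F = G by [].
by apply/funext => h; rewrite /F /G /= addrA.
Qed.

Lemma differentiable_translate V W (f : V -> W) x w :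
  differentiable f (x + w) -> differentiable (fun y => f (y + w)) x.
Proof.
move=> df; apply: (@differentiable_comp _ _ _ _ (fun y => y + w) f).
  by apply: differentiableD => //; exact: differentiable_cst.
exact: df.
Qed.

(** The mean value theorem is applied to [f (y + h *: u) - f y] along v, then to ['D_v f] along u.
    The second difference is symmetric in u and v, which is what the exchange of derivatives
    uses. *)
Lemma second_difference V (f : V -> R^o) (U : set V) x u v (h : R) : 0 < h ->
  smooth_on U f ->
  (forall s t, 0 <= s <= h -> 0 <= t <= h -> U (x + s *: u + t *: v)) ->
  exists s t, [/\ 0 <= s <= h, 0 <= t <= h &
    f (x + h *: u + h *: v) - f (x + h *: u) - f (x + h *: v) + f x =
      h * (h * 'D_u ('D_v f) (x + s *: u + t *: v))].
Proof.
move=> h0 fs xU; have hh : 0 <= h <= h by rewrite lexx ltW.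
have h00 : 0 <= (0 : R) <= h by rewrite lexx ltW.
have dU s t (sh : 0 <= s <= h) (th : 0 <= t <= h) :
  differentiable f (x + t *: v + s *: u).
  by rewrite addrAC; apply: smooth_at fs _; apply: xU.
have dU0 t (th : 0 <= t <= h) : differentiable f (x + t *: v).
  by have := dU _ _ h00 th; rewrite scale0r addr0.
have [t th E] := @mean_value_line _ (fun y => f (y + h *: u) - f y : R^o) x v h h0
  (fun t th => differentiableB (differentiable_translate (dU _ _ hh th)) (dU0 t th)).
have [s sh E'] := @mean_value_line _ ('D_v f) (x + t *: v) u h h0
  (fun s sh => smooth_at (smooth_derive v fs) (eq_ind _ _ (xU s t sh th) _
     (addrAC _ _ _))).
exists s, t; split => //.
rewrite (addrAC x (s *: u)) -E' -derive_translate.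
rewrite -(@deriveB _ _ _ (fun y => f (y + h *: u)) f); first last.
- exact/diff_derivable/dU0.
- exact/diff_derivable/differentiable_translate/dU.
rewrite -[RHS]E /= opprB addrA (addrAC x (h *: v)).
by rewrite [RHS]addrAC; congr (_ + _); exact: addrAC.
Qed.

(** Schwarz's theorem: the two mixed derivatives, at possibly different points of a small
    parallelogram, equal the same second difference divided by h^2; continuity at x closes the
    gap. *)
Lemma derive_swap_real V (f : V -> R^o) (U : set V) x u v : open U -> U x ->
  smooth_on U f -> 'D_u ('D_v f) x = 'D_v ('D_u f) x.
Proof.
move=> Uo Ux fs; apply/eqP; rewrite -subr_eq0 -normr_le0.
apply/ler_addgt0Pr => e e0; rewrite add0r.
have cont a b : \forall y \near x, `|'D_a ('D_b f) x - 'D_a ('D_b f) y| < e / 2.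
  have /= c := smooth_derive a (smooth_derive b fs) 0 x Ux.
  by move: (c); move/cvgrPdist_lt; apply; rewrite divr_gt0.
have /nbhs_normP [d /= d0 xd] : \forall y \near x, [/\ U y,
    `|'D_u ('D_v f) x - 'D_u ('D_v f) y| < e / 2 &
    `|'D_v ('D_u f) x - 'D_v ('D_u f) y| < e / 2].
  by apply: filterS3 (open_nbhs_nbhs (conj Uo Ux)) (cont u v) (cont v u).
(* This divisor keeps the whole parallelogram within distance d of x; the summand 1 makes it
   positive and the bound strict. *)
have c0 : 0 < `|u| + `|v| + 1 by rewrite ltr_wpDl// addr_ge0.
pose h := d / (`|u| + `|v| + 1); have h0 : 0 < h by rewrite divr_gt0.
have box s t : 0 <= s <= h -> 0 <= t <= h -> ball_ Num.norm x d (x + s *: u + t *: v).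
  move=> /andP[s0 sh] /andP[t0 th]; rewrite /ball_ /= -addrA opprD addrA subrr.
  rewrite add0r normrN (le_lt_trans (ler_normD _ _))// !normrZ !ger0_norm//.
  apply: (@le_lt_trans _ _ (h * (`|u| + `|v|))).
    by rewrite mulrDr lerD// ler_wpM2r.
  by rewrite -[d](divfK (lt0r_neq0 c0)) -/h ltr_pM2l// ltrDl.
have boxU s t (sh : 0 <= s <= h) (th : 0 <= t <= h) : U (x + s *: u + t *: v).
  by have [] := xd _ (box _ _ sh th).
have [s [t [sh th E]]] := second_difference h0 fs boxU.
have box' s' t' (sh' : 0 <= s' <= h) (th' : 0 <= t' <= h) :
    ball_ Num.norm x d (x + s' *: v + t' *: u) by rewrite addrAC; exact: box.
have boxU' s' t' (sh' : 0 <= s' <= h) (th' : 0 <= t' <= h) :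
    U (x + s' *: v + t' *: u) by have [] := xd _ (box' _ _ sh' th').
have [s' [t' [sh' th' E']]] := second_difference h0 fs boxU'.
have EE : 'D_u ('D_v f) (x + s *: u + t *: v) = 'D_v ('D_u f) (x + s' *: v + t' *: u).
  do 2 apply: (mulfI (lt0r_neq0 h0)).
  apply: (etrans (esym E)); apply: (etrans _ E').
  by rewrite (addrAC x (h *: u) (h *: v)); congr (_ + _); exact: addrAC.
have [_ lt1 _] := xd _ (box _ _ sh th); have [_ _ lt2] := xd _ (box' _ _ sh' th').
have key (a b c : R) : `|a - c| < e / 2 -> `|b - c| < e / 2 -> `|a - b| <= e.
  move=> ac bc; apply: (le_trans (ler_distD c a b)); rewrite (distrC c b).
  have := ltrD ac bc.
  rewrite -splitr.
  exact: ltW.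
apply: (key _ _ _ lt1).
rewrite EE.
exact: lt2.
Qed.

Lemma derive_swap V k (f : V -> 'rV[R]_k) (U : set V) x u v : open U -> U x ->
  smooth_on U f -> 'D_u ('D_v f) x = 'D_v ('D_u f) x.
Proof.
move=> Uo Ux fs; apply/rowP => i.
have fsi := smooth_on_coord i Uo fs.
have Dc w : {in U, 'D_w (fun y => f y 0 i : R^o) =1 fun y => 'D_w f y 0 i}.
  by move=> y /set_mem Uy; apply: derive_coord; apply: smooth_at fs Uy.
have DDc w z : 'D_w ('D_z f) x 0 i = 'D_w ('D_z (fun y => f y 0 i : R^o)) x.
  rewrite -derive_coord; last exact: smooth_at (smooth_derive z fs) Ux.
  apply: near_eq_derive; apply: filterS (open_nbhs_nbhs (conj Uo Ux)) => y Uy.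
  by rewrite Dc ?inE.
exact: (etrans (DDc u v) (etrans (derive_swap_real u v Uo Ux fsi) (esym (DDc v u)))).
Qed.

End SmoothCalculus.

(** * Charts and vector fields *)

Section ManifoldCalculus.
Context {R : realType} {m : nat} {M : manifold R m}.
Local Notation T := 'rV[R]_m.
Implicit Types (p q : M) (c : chart R m M) (U : set M) (W : normedModType R).

Lemma chart_at_atlas p : atlas (chart_at p).
Proof. by rewrite /chart_at; case: cid => c []. Qed.

Lemma chart_at_dom p : chart_dom (chart_at p) p.
Proof. by rewrite /chart_at; case: cid => c []. Qed.

Lemma near_chart c q U : open U -> U q -> chart_dom c q ->
  \forall y \near c q, [/\ U (chart_inv c y), chart_dom c (chart_inv c y) &
    c (chart_inv c y) = y].
Proof.
move=> Uo Uq cq.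
have img : (c @` chart_dom c) (c q) by exists q.
have n1 := open_nbhs_nbhs (conj (@chart_img_open _ _ _ c) img).
have o2 : open (U `&` chart_dom c) by apply: openI => //; apply: chart_dom_open.
have n2 : nbhs (chart_inv c (c q)) (U `&` chart_dom c).
  by rewrite chart_funK//; apply: open_nbhs_nbhs.
have n3 := chart_inv_continuous img n2.
apply: filterS2 n1 n3 => y [r cr <-] /= [].
by rewrite chart_funK.
Qed.

Lemma chart_image_open c U : open U -> open (c @` (U `&` chart_dom c)).
Proof.
move=> Uo; rewrite openE => y [q [Uq cq] <-].
apply: filterS (near_chart Uo Uq cq) => z [Uz cz <-].
by exists (chart_inv c z).
Qed.

Lemma differentiable_transition c c' q : atlas c -> atlas c' ->
  chart_dom c q -> chart_dom c' q -> differentiable (c' \o chart_inv c) (c q).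
Proof.
move=> ac ac' cq c'q; apply: (smooth_at (atlas_smooth ac ac')).
by exists q.
Qed.

Lemma smooth_fun_differentiable W U (F : M -> W) c q : smooth_fun U F ->
  atlas c -> U q -> chart_dom c q -> differentiable (F \o chart_inv c) (c q).
Proof. by move=> sF ac Uq cq; apply: (smooth_at (sF _ ac)); exists q. Qed.

Lemma derive_transition W c c' q v (F : M -> W) : atlas c -> atlas c' ->
  chart_dom c q -> chart_dom c' q ->
  differentiable (F \o chart_inv c) (c q) ->
  'D_v (F \o chart_inv c') (c' q) =
  'D_('D_v (c \o chart_inv c') (c' q)) (F \o chart_inv c) (c q).
Proof.
move=> ac ac' cq c'q dF.
have E : c q = (c \o chart_inv c') (c' q) by rewrite /= chart_funK.
rewrite {1}E -derive_comp_row; last first.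
- by rewrite -E.
- exact: differentiable_transition.
apply: near_eq_derive; apply: filterS (near_chart (@chart_dom_open _ _ _ c) cq c'q).
by move=> y [cy _ _] /=; rewrite chart_funK.
Qed.

Lemma vder_chart W c q v (F : M -> W) : atlas c -> chart_dom c q ->
  differentiable (F \o chart_inv c) (c q) ->
  vder q v F = 'D_(vder q v c) (F \o chart_inv c) (c q).
Proof.
by move=> ac cq dF; rewrite /vder (@derive_transition _ c) //;
  [exact: chart_at_atlas|exact: chart_at_dom].
Qed.

(** The row [extend p v q] is written in the chart at q, but as a tangent vector it is the
    coordinate field of the chart at p, so differentiating along it is a directional derivative in
    that one chart. *)
Lemma vder_extend W p q v (F : M -> W) : chart_dom (chart_at p) q ->
  differentiable (F \o chart_inv (chart_at q)) (chart_at q q) ->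
  vder q (extend p v q) F = 'D_v (F \o chart_inv (chart_at p)) (chart_at p q).
Proof.
move=> pq dF; rewrite [RHS](@derive_transition _ (chart_at q)) //;
  by [exact: chart_at_atlas|exact: chart_at_dom].
Qed.

Lemma derive_chart_id c q v : chart_dom c q ->
  'D_v (c \o chart_inv c) (c q) = v.
Proof.
move=> cq; rewrite -[RHS](@derive_id _ _ (c q)); apply: near_eq_derive.
by apply: filterS (near_chart (@chart_dom_open _ _ _ c) cq cq) => y [].
Qed.

Lemma vder_chart_at p v : vder p v (chart_at p) = v.
Proof. by rewrite /vder derive_chart_id//; exact: chart_at_dom. Qed.

Lemma extend_vder p q w : chart_dom (chart_at p) q ->
  extend p (vder q w (chart_at p)) q = w.
Proof.
move=> pq; rewrite /extend -vder_chart //; last 1 first.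
- apply: differentiable_transition => //; do ?[exact: chart_at_atlas|exact: chart_at_dom].
- exact: vder_chart_at.
- exact: chart_at_atlas.
Qed.

Lemma extend_id p v : extend p v p = v.
Proof. by rewrite -{1}[v](vder_chart_at p) extend_vder//; exact: chart_at_dom. Qed.

Lemma extend_linear p q a v w : chart_dom (chart_at p) q ->
  extend p (a *: v + w) q = a *: extend p v q + extend p w q.
Proof.
move=> pq; apply: derive_linear.
by apply: differentiable_transition => //; do ?[exact: chart_at_atlas|exact: chart_at_dom].
Qed.

Lemma vder_linear W q a v w (F : M -> W) :
  differentiable (F \o chart_inv (chart_at q)) (chart_at q q) ->
  vder q (a *: v + w) F = a *: vder q v F + vder q w F.
Proof. exact: derive_linear. Qed.

Lemma vder_near W q v (F G : M -> W) U : open U -> U q ->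
  (forall r, U r -> F r = G r) -> vder q v F = vder q v G.
Proof.
move=> Uo Uq FG; apply: near_eq_derive.
by apply: filterS (near_chart Uo Uq (chart_at_dom q)) => y [Uy _ _]; apply: FG.
Qed.

Lemma vder_cst W q v (a : W) : vder q v (fun=> a) = 0.
Proof. exact: derive_cst. Qed.

(** Any other chart is reached by composing with a smooth transition map. *)
Lemma smooth_fun_in_chart W U c (F : M -> W) : atlas c -> open U ->
  U `<=` chart_dom c -> smooth_on (c @` U) (F \o chart_inv c) -> smooth_fun U F.
Proof.
move=> ac Uo Uc sF c' ac'.
have tr := smooth_on_subset _ (atlas_smooth ac' ac).
suff : smooth_on (c' @` (U `&` chart_dom c'))
    ((F \o chart_inv c) \o (c \o chart_inv c')).
  apply: smooth_on_eq; first exact: chart_image_open.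
  by move=> _ [q [Uq c'q] <-] /=; rewrite chart_funK// chart_funK//; apply: Uc.
apply: smooth_on_comp sF.
- exact: chart_image_open.
- by move=> _ [q [Uq c'q] <-] /=; rewrite chart_funK//; exists q.
- by apply: tr => _ [q [Uq c'q] <-]; exists q => //; split=> //; apply: Uc.
Qed.

Lemma smooth_fun_eq W U (F G : M -> W) : open U -> (forall q, U q -> F q = G q) ->
  smooth_fun U F -> smooth_fun U G.
Proof.
move=> Uo FG sF c ac; apply: smooth_on_eq (sF c ac); first exact: chart_image_open.
by move=> _ [q [Uq cq] <-]; rewrite /comp (chart_funK cq) (FG q Uq).
Qed.

Lemma smooth_field_eq U (X Y : M -> T) : open U -> (forall q, U q -> X q = Y q) ->
  smooth_field U X -> smooth_field U Y.
Proof.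
move=> Uo XY sX c ac; apply: smooth_on_eq (sX c ac); first exact: chart_image_open.
by move=> _ [q [Uq cq] <-]; rewrite /comp (chart_funK cq) (XY q Uq).
Qed.

Lemma smooth_field_subset U U' (X : M -> T) : U' `<=` U -> smooth_field U X ->
  smooth_field U' X.
Proof.
move=> UU sX c ac; apply: smooth_on_subset (sX c ac).
by move=> _ [q [Uq cq] <-]; exists q => //; split=> //; apply: UU.
Qed.

Lemma smooth_fun_cst W U (a : W) : smooth_fun U (fun=> a).
Proof. by move=> c ac k; apply: times_differentiable_cst. Qed.

Lemma differentiable_chart_at c q : atlas c -> chart_dom c q ->
  differentiable (c \o chart_inv (chart_at q)) (chart_at q q).
Proof.
by move=> ac cq; apply: differentiable_transition => //;
  [exact: chart_at_atlas|exact: chart_at_dom].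
Qed.

Lemma smooth_fieldD U (X Y : M -> T) : open U -> smooth_field U X ->
  smooth_field U Y -> smooth_field U (fun q => X q + Y q).
Proof.
move=> Uo sX sY c ac.
apply: smooth_on_eq (smooth_onD _ (sX c ac) (sY c ac)); do 1?exact: chart_image_open.
move=> _ [q [Uq cq] <-] /=; rewrite chart_funK//.
by rewrite -{1}[vder q (X q) c]scale1r -vder_linear ?scale1r//; exact: differentiable_chart_at.
Qed.

Lemma smooth_fieldZ U (f : M -> R^o) (X : M -> T) : open U -> smooth_fun U f ->
  smooth_field U X -> smooth_field U (fun q => f q *: X q).
Proof.
move=> Uo sf sX c ac.
apply: smooth_on_eq (smooth_onZ _ (sf c ac) (sX c ac)); do 1?exact: chart_image_open.
move=> _ [q [Uq cq] <-] /=; rewrite chart_funK//.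
by rewrite -[in RHS](addr0 (_ *: _)) vder_linear ?[vder q 0 c]derive0 ?addr0//;
  exact: differentiable_chart_at.
Qed.

Lemma smooth_extend p v : smooth_field (chart_dom (chart_at p)) (extend p v).
Proof.
move=> c ac; set cp := chart_at p.
have acp : atlas cp by exact: chart_at_atlas.
have o : open (chart_dom cp `&` chart_dom c).
  by apply: openI; exact: chart_dom_open.
have : smooth_fun (chart_dom cp `&` chart_dom c) (fun q => vder q (extend p v q) c).
  apply: (smooth_fun_in_chart acp o); first by move=> q [].
  have := smooth_derive v (atlas_smooth acp ac).
  have oi : open (cp @` (chart_dom cp `&` chart_dom c)).
    rewrite setIC; apply: chart_image_open; exact: chart_dom_open.
  apply: (smooth_on_eq oi) => _ [q [pq cq] <-]; rewrite /comp (chart_funK pq).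
  by rewrite vder_extend //; exact: differentiable_chart_at.
by move=> /(_ c ac); rewrite -setIA setIid.
Qed.

Lemma smooth_field0 U : smooth_field U (fun=> 0).
Proof.
move=> c ac k; rewrite (_ : _ \o _ = fun=> 0); last first.
  by apply/funext => y /=; rewrite /vder derive0.
exact: times_differentiable_cst.
Qed.

(** Components with respect to the coordinate frame at p. The raw entries [X q 0 i] refer to a chart
    that varies with q and need not be smooth in q. *)
Definition frame_coord p i (X : M -> T) q : R^o := vder q (X q) (chart_at p) 0 i.

Lemma smooth_frame_coord p i (X : M -> T) :
  smooth_field (chart_dom (chart_at p)) X ->
  smooth_fun (chart_dom (chart_at p)) (frame_coord p i X).
Proof.
move=> sX; have acp := chart_at_atlas p.
have o : open (chart_at p @` chart_dom (chart_at p)) by exact: chart_img_open.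
apply: (smooth_fun_in_chart acp); [exact: chart_dom_open|by []|].
by have := sX _ acp; rewrite setIid => /(smooth_on_coord i o).
Qed.

Lemma frame_expansion p q (X : M -> T) : chart_dom (chart_at p) q ->
  X q = \sum_i frame_coord p i X q *: extend p (delta_mx 0 i) q.
Proof.
move=> pq; rewrite -{1}[X q](extend_vder _ pq) /extend.
apply: derive_row_sum.
by apply: differentiable_transition => //; do ?[exact: chart_at_atlas|exact: chart_at_dom].
Qed.

Lemma vder_swap p x y U (f : M -> R^o) : open U -> U p -> smooth_fun U f ->
  vder p x (fun q => vder q (extend p y q) f) =
  vder p y (fun q => vder q (extend p x q) f).
Proof.
move=> Uo Up sf; set cp := chart_at p.
have cpp : chart_dom cp p by exact: chart_at_dom.
have E v w : vder p v (fun q => vder q (extend p w q) f) =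
    'D_v ('D_w (f \o chart_inv cp)) (cp p).
  apply: near_eq_derive; apply: filterS (near_chart Uo Up cpp) => z [Uz cz cK] /=.
  rewrite vder_extend ?cK//.
  by apply: smooth_fun_differentiable sf _ Uz _; [exact: chart_at_atlas|exact: chart_at_dom].
rewrite !E; apply: (derive_swap_real (U := cp @` (U `&` chart_dom cp))).
- exact: chart_image_open.
- by exists p.
- by apply: sf; exact: chart_at_atlas.
Qed.

(** Both terms of the bracket are second derivatives, in the chart at p, of the transition map to
    the chart at q. Validity on the whole chart domain, not just at p, allows use under a further
    derivative. *)
Lemma lie_extend p q x y : chart_dom (chart_at p) q ->
  lie (extend p x) (extend p y) q = 0.
Proof.
set cp := chart_at p => pq; rewrite /lie; set cq := chart_at q.
have qq : chart_dom cq q by exact: chart_at_dom.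
have acp : atlas cp by exact: chart_at_atlas.
have acq : atlas cq by exact: chart_at_atlas.
have oI : open (chart_dom cp `&` chart_dom cq) by apply: openI; exact: chart_dom_open.
have E v w : vder q (extend p v q) (fun r => vder r (extend p w r) cq) =
    'D_v ('D_w (cq \o chart_inv cp)) (cp q).
  have sE := @smooth_extend p w cq acq.
  rewrite (vder_extend v pq); last by apply: (smooth_at sE); exists q.
  apply: near_eq_derive.
  apply: filterS (near_chart oI (conj pq qq) pq) => z [[_ Uz] cz cK] /=.
  by rewrite vder_extend ?cK//; exact: differentiable_chart_at.
apply/eqP; rewrite subr_eq0 !E; apply/eqP.
apply: (derive_swap (U := cp @` (chart_dom cp `&` chart_dom cq))).
- by rewrite setIC; apply: chart_image_open; exact: chart_dom_open.
- by exists q.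
- exact: atlas_smooth.
Qed.

End ManifoldCalculus.

(** * Symmetric forms and the structure equations at a point *)

Section SymmetricForm.
Context {R : realFieldType} {V : lmodType R} (b : V -> V -> R).
Hypothesis bl : forall a x y z, b (a *: x + y) z = a * b x z + b y z.
Hypothesis bC : forall x y, b x y = b y x.

Lemma sformDl x y z : b (x + y) z = b x z + b y z.
Proof. by rewrite -[x]scale1r bl mul1r scale1r. Qed.

Lemma sform0l z : b 0 z = 0.
Proof. by apply: (addrI (b 0 z)); rewrite -sformDl !addr0. Qed.

Lemma sformZl a x z : b (a *: x) z = a * b x z.
Proof. by rewrite -[a *: x]addr0 bl sform0l addr0. Qed.

Lemma sformNl x z : b (- x) z = - b x z.
Proof. by rewrite -scaleN1r sformZl mulN1r. Qed.

Lemma sform_suml I (r : seq I) (P : pred I) (F : I -> V) z :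
  b (\sum_(i <- r | P i) F i) z = \sum_(i <- r | P i) b (F i) z.
Proof.
by apply: (big_morph (b^~ z)) => [x y|]; [exact: sformDl|exact: sform0l].
Qed.

Lemma sformDr x y z : b z (x + y) = b z x + b z y.
Proof. by rewrite !(bC z) sformDl. Qed.

Lemma sform0r z : b z 0 = 0.
Proof. by rewrite bC sform0l. Qed.

Lemma sformZr a x z : b z (a *: x) = a * b z x.
Proof. by rewrite !(bC z) sformZl. Qed.

Lemma sformNr x z : b z (- x) = - b z x.
Proof. by rewrite !(bC z) sformNl. Qed.

Lemma sform_sumr I (r : seq I) (P : pred I) (F : I -> V) z :
  b z (\sum_(i <- r | P i) F i) = \sum_(i <- r | P i) b z (F i).
Proof. by rewrite bC sform_suml; apply: eq_bigr => i _; rewrite bC. Qed.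

End SymmetricForm.

(* The relations between phi, A = nabla phi and B_a = nabla xi_a at a point of
   an S-manifold, with eta^a = e_a b(xi_a, .). *)
Section CovariantDerivatives.
Context {R : realFieldType} {V : lmodType R} {s : nat}.
Variables (b : V -> V -> R) (f : {linear V -> V}) (xi : 'I_s -> V) (e : 'I_s -> R).
Hypothesis bl : forall a x y z, b (a *: x + y) z = a * b x z + b y z.
Hypothesis bC : forall x y, b x y = b y x.
Hypothesis bnd : forall x, (forall y, b x y = 0) -> x = 0.
Hypothesis f_skew : forall x y, b (f x) y = - b x (f y).
Hypothesis f_xi : forall i, f (xi i) = 0.
Hypothesis e_sqr : forall i, e i * e i = 1.
Hypothesis xi_orth : forall i j, b (xi i) (xi j) = if i == j then e i else 0.
Hypothesis f2 : forall x, f (f x) = - x + \sum_i (e i * b x (xi i)) *: xi i.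

Variables (B : 'I_s -> V -> V) (A : V -> V -> V).
Hypothesis A0 : forall y, A 0 y = 0.
Hypothesis B_skew : forall i x y,
  e i * b (B i x) y - e i * b (B i y) x = 2 * b x (f y).
Hypothesis B_xi : forall i j x, b (B i x) (xi j) + b (xi i) (B j x) = 0.
Hypothesis A_xi : forall x j, A x (xi j) = - f (B j x).
Hypothesis A_skew : forall x y z, b (A x y) z = - b y (A x z).
Hypothesis A_closed : forall x y z, b y (A x z) + b z (A y x) + b x (A z y) = 0.
Hypothesis A_normal : forall x y,
  A (f x) y - A (f y) x + f (A y x) - f (A x y) = - (2 * b x (f y)) *: \sum_i xi i.
Hypothesis A_f : forall x y, A x (f y) + f (A x y) =
  \sum_i ((e i * b y (B i x)) *: xi i + (e i * b y (xi i)) *: B i x).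

Let bE := (sformDl bl, sformZl bl, sformNl bl, sform0l bl, sformDr bl bC, sformZr bl bC,
  sformNr bl bC, sform0r bl bC).

Lemma sform_inj x y : (forall z, b x z = b y z) -> x = y.
Proof.
move=> xy; apply/eqP; rewrite -subr_eq0; apply/eqP/bnd => z.
by rewrite !bE xy subrr.
Qed.

Let e_neq0 i : e i != 0.
Proof. by apply/eqP => e0; have := e_sqr i; rewrite e0 mul0r => /eqP; rewrite eq_sym oner_eq0. Qed.

Let f_orth x i : b (f x) (xi i) = 0.
Proof. by rewrite f_skew f_xi bE oppr0. Qed.

Let f3 x : f (f (f x)) = - f x.
Proof. by rewrite f2 big1 ?addr0// => i _; rewrite f_orth mulr0 scale0r. Qed.

Let f2_orth x : (forall i, b x (xi i) = 0) -> f (f x) = - x.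
Proof. by move=> xo; rewrite f2 big1 ?addr0// => i _; rewrite xo mulr0 scale0r. Qed.

Let f_eq0 x : f x = 0 -> (forall i, b x (xi i) = 0) -> x = 0.
Proof.
move=> fx0 xo; apply/eqP; rewrite -oppr_eq0 -f2_orth// fx0 linear0 //.
Qed.

Lemma nabla_xi_sym i j x : b (B i (xi j)) x = b (B i x) (xi j).
Proof.
have := B_skew i x (xi j); rewrite f_xi bE mulr0 -mulrBr => /eqP.
by rewrite mulf_eq0 (negPf (e_neq0 i)) /= subr_eq0 => /eqP.
Qed.

(** By antisymmetry in i and j, normality at the pair xi_i, xi_j reduces to f (f (B i (xi j))) = 0,
    and f^2 = -1 on vectors orthogonal to all xi, among them B i (xi j). *)
Lemma nabla_xi_xi i j : B i (xi j) = 0.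
Proof.
have sk k l : B k (xi l) = - B l (xi k).
  apply: sform_inj => x; rewrite !bE !nabla_xi_sym; have := B_xi k l x.
  by rewrite (bC (xi k)); lra.
have t_sym k l h : b (B k (xi l)) (xi h) = b (B k (xi h)) (xi l).
  by rewrite nabla_xi_sym.
(* An expression in three indices that is skew in the first two and symmetric in the last two
   vanishes. *)
have t0 k l h : b (B k (xi l)) (xi h) = 0.
  have E1 := t_sym k l h; have E2 := t_sym l k h; have E3 := t_sym h k l.
  move: E1 E2 E3; rewrite (sk l k) (sk h l) (sk h k) !bE; lra.
have ff0 : f (f (B i (xi j))) = 0.
  have := A_normal (xi i) (xi j); rewrite !f_xi !A0 !A_xi !bE. rewrite mulr0 !oppr0 scale0r.
  rewrite addr0 add0r !linearN /= opprK (sk j i) !linearN /= => /eqP.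
  by rewrite -opprD oppr_eq0 -mulr2n -scaler_nat scaler_eq0 pnatr_eq0 => /eqP.
by apply/eqP; rewrite -oppr_eq0 -(f2_orth (t0 i j)) ff0.
Qed.

Lemma nabla_xi_orth i j x : b (B i x) (xi j) = 0.
Proof. by rewrite -nabla_xi_sym nabla_xi_xi bE. Qed.

(** [B_skew] controls only the skew part of B i. Normality together with closedness of the
    fundamental form makes B i skew on Im f ([sk]), as for a Killing field; the skew part then gives
    the formula. *)
Lemma nabla_xi_formula i x : B i x = - e i *: f x.
Proof.
have ff w : f (f (B i w)) = - B i w by apply: f2_orth => j; exact: nabla_xi_orth.
have Axi y z : b y (A (xi i) z) = b z (f (B i y)) - b (f (B i z)) y.
  have := A_closed (xi i) y z; rewrite A_xi.
  have := A_skew z (xi i) y; rewrite A_xi !bE; lra.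
have N1 z : f (A (xi i) z) = f (B i (f z)) + B i z.
  have := A_normal z (xi i); rewrite f_xi A0 !A_xi !bE mulr0 !oppr0 scale0r addr0.
  rewrite linearN /= ff opprK => /eqP; rewrite subr_eq0 addrC subr_eq => /eqP ->.
  by rewrite addrC.
have sk z y : b (B i (f y)) (f z) = - b (B i (f z)) (f y).
  have := congr1 (b^~ y) (N1 z); rewrite bE.
  have E1 : b (f (A (xi i) z)) y = - b z (f (B i (f y))) + b (f (B i z)) (f y).
    by rewrite f_skew (bC (A _ _)) Axi; lra.
  rewrite E1 (bC z) !f_skew.
  have -> : b (B i z) (f (f y)) = - b (B i z) y.
    have := f_skew (f (B i z)) y; rewrite ff !bE (f_skew (B i z)); lra.
  lra.
have Bff y z : b (B i (f y)) (f z) = e i * b (f y) (f (f z)).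
  have := B_skew i (f y) (f z); rewrite (sk y z).
  move=> E; have : e i * (e i * b (B i (f y)) (f z)) = e i * b (f y) (f (f z)) * 1.
    have -> : b (f y) (f (f z)) = e i * b (B i (f y)) (f z) by lra.
    ring.
  by rewrite mulrA e_sqr mul1r mulr1.
(* [B i] is a bare function here, so this is read off [B_skew], whose other terms are linear in the
   argument f (f y). *)
have Blin y : B i (f (f y)) = - B i y.
  apply: sform_inj => z.
  have := B_skew i (f (f y)) z; have := B_skew i y z.
  have -> : b (B i z) (f (f y)) = - b (B i z) y.
    rewrite f2 !bE sform_sumr// big1 ?addr0// => k _.
    by rewrite sformZr// nabla_xi_orth mulr0.
  have -> : b (f (f y)) (f z) = - b y (f z).
    by have := f_skew (f (f y)) z; rewrite f3 bE f_skew; lra.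
  move=> E1 E2; apply: (mulfI (e_neq0 i)); rewrite bE; lra.
apply: sform_inj => z; rewrite !bE.
have -> : b (B i x) z = b (B i (f (f x))) (f (f z)).
  rewrite Blin f2 !bE sform_sumr// big1 ?addr0 ?opprK// => k _.
  by rewrite sformZr// nabla_xi_orth mulr0.
rewrite Bff f3 bE; have := f_skew (f (f x)) z; rewrite f3 bE => E.
have -> : b (f (f x)) (f z) = b (f x) z by lra.
ring.
Qed.

(** The difference E of the two sides satisfies homogeneous versions of the hypotheses: it is skew,
    cyclic, zero on the xi, anticommutes with f, and has no normality defect. These force E = 0,
    just as integrability and a closed fundamental form force the complex structure of a Kaehler
    manifold to be parallel. *)
Lemma nabla_phi_formula x y :
  A x y = b (f x) (f y) *: (\sum_i xi i) + b y (\sum_i xi i) *: f (f x).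
Proof.
set t := \sum_i xi i.
have ft : f t = 0 by rewrite linear_sum big1.
have t_f z : b t (f z) = 0 by rewrite bC f_skew ft bE oppr0.
have f_t z : b (f z) t = 0 by rewrite bC t_f.
have xi_t i : b (xi i) t = e i.
  rewrite sform_sumr// (bigD1 i)//= xi_orth eqxx big1 ?addr0// => j ij.
  by rewrite xi_orth eq_sym (negPf ij).
have ffr z w : b (f z) (f (f w)) = - b (f z) w.
  by have := f_skew (f z) (f w); have := f_skew (f (f z)) w; rewrite f3 bE; lra.
pose E z w := A z w - (b (f z) (f w) *: t + b w t *: f (f z)).
have EE z w : E z w = A z w - (b (f z) (f w) *: t + b w t *: f (f z)) by [].
clearbody E.
have E_skew z w h : b (E z w) h = - b w (E z h).
  rewrite !EE !bE A_skew (f_skew (f z)) (bC w (f (f z))) (f_skew (f z)) (bC t).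
  rewrite !(bC w t); ring.
have E_closed z w h : b w (E z h) + b h (E w z) + b z (E h w) = 0.
  have := A_closed z w h; rewrite !EE !bE.
  rewrite !(bC _ (f (f _))) !(f_skew (f _)) !(bC _ t) (bC (f h) (f z)).
  rewrite (bC (f w) (f z)) (bC (f h) (f w)); lra.
have E_xi z i : E z (xi i) = 0.
  by rewrite EE A_xi nabla_xi_formula f_xi bE scale0r add0r xi_t linearZ /= scaleNr opprK subrr.
have E_f z w : E z (f w) + f (E z w) = 0.
  rewrite !EE f_t scale0r addr0 raddfB raddfD /= !linearZ /= ft scaler0 add0r f3.
  rewrite addrACA A_f big_split /=.
  have -> : \sum_i (e i * b w (B i z)) *: xi i = - b w (f z) *: t.
    rewrite scaler_sumr; apply: eq_bigr => i _; congr (_ *: _).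
    by rewrite nabla_xi_formula !bE mulrA mulrN e_sqr mulN1r.
  have -> : \sum_i (e i * b w (xi i)) *: B i z = - b w t *: f z.
    rewrite sform_sumr// -sumrN scaler_suml; apply: eq_bigr => i _.
    rewrite nabla_xi_formula scalerA; congr (_ *: _).
    by rewrite mulrAC mulrN e_sqr mulN1r.
  rewrite ffr scalerN -scaleNr (bC w).
  by rewrite !scaleNr !scalerN !opprK addrACA !addNr addr0.
have E_normal z w : E (f z) w - E (f w) z + f (E w z) - f (E z w) = 0.
  apply: sform_inj => h; have := congr1 (b^~ h) (A_normal z w).
  have ffl u v : b (f (f u)) (f v) = - b u (f v) by rewrite f_skew ffr opprK f_skew.
  rewrite !bE !(f_skew _ h) !EE !bE !t_f !(f_skew _ h).
  rewrite !ffl (bC w (f z)) (f_skew z w) -/t; lra.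
(* Once f is moved across E by [sw], the cyclic identity at (f h, w, z) and (f w, h, z), skewness,
   and normality paired with z form a linear system with only the zero solution for this value. *)
have Ef_eq0 z w h : b (E z w) (f h) = 0.
  have sw x1 x2 x3 : b (E x1 (f x2)) x3 = b (E x1 x2) (f x3).
    have /(congr1 (b^~ x3)) := E_f x1 x2; rewrite !bE f_skew; lra.
  have := congr1 (b^~ z) (E_normal h w); rewrite !bE !(f_skew _ z).
  have := E_closed (f h) w z; have := E_closed (f w) h z.
  rewrite !(bC _ (E _ _)) !sw.
  have := E_skew (f h) w z; have := E_skew (f w) h z.
  have := E_skew z (f h) w; rewrite sw !(bC _ (E _ _)); lra.
apply/eqP; rewrite -subr_eq0 -EE; apply/eqP.
apply: f_eq0 => [|i]; last by rewrite E_skew E_xi bE oppr0.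
by apply: sform_inj => h; rewrite f_skew Ef_eq0 bE oppr0.
Qed.

End CovariantDerivatives.

(** * Curvature tensors *)

Section CurvatureTensor.
Context {R : realFieldType} {V : lmodType R}.

(** Linearity in the second and fourth slots follows from the skew symmetries, and the pair symmetry
    from the Bianchi identity ([cl_pair]). *)
Record curvature_like (r : V -> V -> V -> V -> R) : Prop := CurvatureLike {
  cl_linear1 : forall a x x' y z w, r (a *: x + x') y z w = a * r x y z w + r x' y z w;
  cl_linear3 : forall a x y z z' w, r x y (a *: z + z') w = a * r x y z w + r x y z' w;
  cl_skew12 : forall x y z w, r x y z w = - r y x z w;
  cl_skew34 : forall x y z w, r x y z w = - r x y w z;
  cl_bianchi : forall x y z w, r x y z w + r y z x w + r z x y w = 0
}.

Lemma curvature_like_sub r q : curvature_like r -> curvature_like q ->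
  curvature_like (fun x y z w => r x y z w - q x y z w).
Proof.
move=> hr hq; split=> [a x x' y z w|a x y z z' w|x y z w|x y z w|x y z w].
- by rewrite (cl_linear1 hr) (cl_linear1 hq); ring.
- by rewrite (cl_linear3 hr) (cl_linear3 hq); ring.
- by rewrite (cl_skew12 hr) (cl_skew12 hq); ring.
- by rewrite (cl_skew34 hr) (cl_skew34 hq); ring.
- by have := cl_bianchi hr x y z w; have := cl_bianchi hq x y z w; lra.
Qed.

Lemma curvature_like_scale r k : curvature_like r ->
  curvature_like (fun x y z w => k * r x y z w).
Proof.
move=> hr; split=> [a x x' y z w|a x y z z' w|x y z w|x y z w|x y z w].
- by rewrite (cl_linear1 hr); ring.
- by rewrite (cl_linear3 hr); ring.
- by rewrite (cl_skew12 hr); ring.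
- by rewrite (cl_skew34 hr); ring.
- by rewrite -!mulrDr (cl_bianchi hr) mulr0.
Qed.

(** This is the curvature tensor of constant sectional curvature 1 for b. *)
Lemma curvature_like_form (b : V -> V -> R) :
  (forall a x y z, b (a *: x + y) z = a * b x z + b y z) ->
  (forall x y, b x y = b y x) ->
  curvature_like (fun x y z w => b y z * b x w - b x z * b y w).
Proof.
move=> bl bC; have br a x y z : b z (a *: x + y) = a * b z x + b z y.
  by rewrite !(bC z) bl.
split=> [a x x' y z w|a x y z z' w|x y z w|x y z w|x y z w].
- by rewrite !bl; ring.
- by rewrite !br; ring.
- ring.
- ring.
- by rewrite (bC z x) (bC z y) (bC y x); ring.
Qed.

Variable r : V -> V -> V -> V -> R.
Hypothesis hr : curvature_like r.

Lemma cl_linear2 a x y y' z w : r x (a *: y + y') z w = a * r x y z w + r x y' z w.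
Proof. by rewrite !(cl_skew12 hr x) (cl_linear1 hr) opprD mulrN. Qed.

Lemma cl_linear4 a x y z w w' : r x y z (a *: w + w') = a * r x y z w + r x y z w'.
Proof. by rewrite !(cl_skew34 hr x y z) (cl_linear3 hr) opprD mulrN. Qed.

(** The four cyclic identities on x, y, z, w are combined; all terms except the two in question
    cancel by the skew symmetries. *)
Lemma cl_pair x y z w : r x y z w = r z w x y.
Proof.
have b1 := cl_bianchi hr x y z w; have b2 := cl_bianchi hr y z w x.
have b3 := cl_bianchi hr z w x y; have b4 := cl_bianchi hr w x y z.
have s12 := cl_skew12 hr; have s34 := cl_skew34 hr.
have e1 := s34 y z w x; have e2 := s34 z w y x.
have e3 : r w y z x = r y w x z by rewrite s12 s34 opprK.
have e4 := s34 w x z y; have e5 : r x z w y = r z x y w by rewrite s12 s34 opprK.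
have e6 := s34 x y w z; lra.
Qed.

(** Polarising in y gives r(y, x, x, z) = 0, and polarising in x then makes r skew in its middle
    slots. So r is totally skew, and the Bianchi identity reads 3 r = 0. *)
Lemma sectional_zero : (forall x y, r y x x y = 0) -> forall x y z w, r x y z w = 0.
Proof.
move=> r0.
have D1 x x' y z w : r (x + x') y z w = r x y z w + r x' y z w.
  by rewrite -[x]scale1r (cl_linear1 hr) mul1r scale1r.
have D2 x y y' z w : r x (y + y') z w = r x y z w + r x y' z w.
  by rewrite -[y]scale1r cl_linear2 mul1r scale1r.
have D3 x y z z' w : r x y (z + z') w = r x y z w + r x y z' w.
  by rewrite -[z]scale1r (cl_linear3 hr) mul1r scale1r.
have D4 x y z w w' : r x y z (w + w') = r x y z w + r x y z w'.
  by rewrite -[w]scale1r cl_linear4 mul1r scale1r.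
have r1 x y z : r y x x z = 0.
  have := r0 x (y + z); rewrite D1 !D4 !r0.
  rewrite (cl_pair z) (cl_skew12 hr x y) (cl_skew34 hr y x z x); lra.
have r2 x y z w : r y x w z = - r y w x z.
  by have := r1 (x + w) y z; rewrite D2 !D3 !r1; lra.
move=> x y z w; have := cl_bianchi hr x y z w.
have := r2 z y w x; have := r2 x z w y.
have := cl_skew12 hr x y z w; have := cl_skew12 hr y z x w; lra.
Qed.

End CurvatureTensor.

(** * Rank-one Jacobi operators and the almost Hermitian structure *)

Section QuadraticProduct.
Context {R : realFieldType} {V : lmodType R}.

(** Encoded by restrictions to lines, with c in the role of the polar form, because the zero-divisor
    argument takes place on a single line. *)
Definition quadratic (q : V -> R) := exists c : V -> V -> R,
  forall x y t, q (x + t *: y) = q x + t * c x y + t * t * q y.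

(** If q1 x and q2 y were nonzero, then q2 x = q1 y = 0, and along x + t y the product is a c t + (a
    d + b c) t^2 + b d t^3. Vanishing at t = 1, -1, 2 kills the coefficients, so c = 0 and then a d
    = 0, a contradiction. *)
Lemma quadratic_mul_eq0 (q1 q2 : V -> R) : quadratic q1 -> quadratic q2 ->
  (forall x, q1 x * q2 x = 0) -> (forall x, q1 x = 0) \/ (forall x, q2 x = 0).
Proof.
move=> [c1 q1E] [c2 q2E] q12; apply: contrapT => /not_orP [/existsNP [x q1x] /existsNP [y q2y]].
have q2x : q2 x = 0 by have /eqP := q12 x; rewrite mulf_eq0 => /orP [] /eqP.
have q1y : q1 y = 0 by have /eqP := q12 y; rewrite mulf_eq0 => /orP [] /eqP.
have E t : (q1 x + t * c1 x y) * (t * c2 x y + t * t * q2 y) = 0.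
  by have := q12 (x + t *: y); rewrite q1E q2E q2x q1y mulr0 addr0 add0r.
have E1 := E 1; have E2 := E (-1); have E3 := E 2.
set a := q1 x in q1x E1 E2 E3; set d := q2 y in q2y E1 E2 E3.
set b := c1 x y in E1 E2 E3; set c := c2 x y in E1 E2 E3.
have ac : a * c = 0 by lra.
have bd : b * d = 0 by lra.
have ad : a * d + b * c = 0 by lra.
have /eqP := ac; rewrite mulf_eq0 => /orP [/eqP //|/eqP c0].
have /eqP : a * d = 0 by rewrite -ad c0 mulr0 addr0.
by rewrite mulf_eq0 => /orP [] /eqP.
Qed.

End QuadraticProduct.

(* Let a be the vector attached to the unit vector e0. For every z the quadratic
   form x |-> r(e0, x, x, z) has the same square as b(x, a) b(x, e_z), hence is
   equal to it up to a sign independent of x. Absorbing the sign into J z = e_z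
   makes J linear, since r(e0, x, x, z) is linear in z. *)
Section RankOneJacobi.
Context {R : rcfType} {V : lmodType R} (b : V -> V -> R) (r : V -> V -> V -> V -> R).
Hypothesis bl : forall a x y z, b (a *: x + y) z = a * b x z + b y z.
Hypothesis bC : forall x y, b x y = b y x.
Hypothesis b_ge0 : forall x, 0 <= b x x.
Hypothesis b_eq0 : forall x, b x x = 0 -> x = 0.
Hypothesis hr : curvature_like r.
Hypothesis r_unit : forall x, b x x = 1 ->
  exists2 e, b e e = 1 & forall y z, r y x x z = b y e * b z e.
Variable e0 : V.
Hypothesis e0_unit : b e0 e0 = 1.

Let bE := (sformDl bl, sformZl bl, sformNl bl, sform0l bl, sformDr bl bC, sformZr bl bC,
  sformNr bl bC, sform0r bl bC).

Let rZ2 a x y z w : r x (a *: y) z w = a * r x y z w.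
Proof.
rewrite -[a *: y]addr0 (cl_linear2 hr); have := cl_linear2 hr 1 x 0 0 z w.
by rewrite scale1r addr0; lra.
Qed.

Let rZ3 a x y z w : r x y (a *: z) w = a * r x y z w.
Proof.
rewrite -[a *: z]addr0 (cl_linear3 hr); have := cl_linear3 hr 1 x y 0 0 w.
by rewrite scale1r addr0; lra.
Qed.

(** Since r(y, x, x, z) is quadratic in x, the vector of the normalised x is multiplied by the
    length of x. *)
Lemma rank_one_jacobi x : exists2 e, b e e = b x x &
  forall y z, r y x x z = b y e * b z e.
Proof.
have [->|x0] := eqVneq x 0.
  exists 0 => // y z; rewrite !bE mulr0.
  by have := rZ2 0 y 0 0 z; rewrite scale0r mul0r.
have bx : 0 < b x x.
  by rewrite lt_def b_ge0 andbT; apply/eqP => /b_eq0 /eqP; rewrite (negPf x0).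
pose t := Num.sqrt (b x x).
have t0 : t != 0 by rewrite gt_eqF// sqrtr_gt0.
have tt : t * t = b x x by rewrite -expr2 sqr_sqrtr// ltW.
have [|e e1 er] := r_unit (x := t^-1 *: x).
  by rewrite !bE -tt; field.
exists (t *: e); first by rewrite !bE e1 mulr1.
move=> y z; have {1 2}-> : x = t *: (t^-1 *: x) by rewrite scalerA divff// scale1r.
by rewrite rZ2 rZ3 er !bE; ring.
Qed.

Lemma form_mul_eq0 a w : b a a = 1 -> (forall x, b x a * b x w = 0) -> w = 0.
Proof.
move=> a1 aw; apply: b_eq0.
have := aw a; rewrite a1 mul1r => baw.
have := aw (a + w); rewrite !bE a1 baw (bC w a) baw; lra.
Qed.

Lemma rank_one_form z a : b a a = 1 -> (forall y w, r y e0 e0 w = b y a * b w a) ->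
  exists Jz, [/\ b Jz Jz = b z z, forall y w, r y z z w = b y Jz * b w Jz &
    forall x, r e0 x x z = b x a * b x Jz].
Proof.
move=> a1 ar; have [e ee er] := rank_one_jacobi z.
have rsym u v : r u v v u = r v u u v by rewrite (cl_skew12 hr) (cl_skew34 hr) opprK.
(* By rank one at x, the square of r(e0, x, x, z) is r(e0, x, x, e0) r(z, x, x, z). Exchanging x
   with e0 and with z turns the factors into the squares of b(x, a) and b(x, e). *)
have sq x : r e0 x x z * r e0 x x z = (b x a * b x e) * (b x a * b x e).
  have [k _ kr] := rank_one_jacobi x.
  have E1 := kr e0 e0; rewrite rsym ar in E1.
  have E2 := kr z z; rewrite rsym er in E2.
  rewrite kr; transitivity ((b e0 k * b e0 k) * (b z k * b z k)); first by ring.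
  by rewrite -E1 -E2; ring.
pose q (t : R) x := r e0 x x z - t * (b x a * b x e).
have qq t : quadratic (q t).
  exists (fun x y => r e0 x y z + r e0 y x z - t * (b x a * b y e + b y a * b x e)).
  move=> x y s; rewrite /q ![x + s *: y]addrC (cl_linear2 hr) !(cl_linear3 hr) !bE; ring.
(* The product of [q 1] and [q (-1)] is the difference of the two squares in [sq]; whichever factor
   vanishes fixes the sign of Jz. *)
have [|q0|q0] := quadratic_mul_eq0 (qq 1) (qq (-1)).
- by move=> x; rewrite /q; have := sq x; lra.
- by exists e; split => // x; have := q0 x; rewrite /q; lra.
- exists (- e); split => [|y w|x]; rewrite !bE ?er; [by rewrite opprK|by rewrite mulrNN|].
  by have := q0 x; rewrite /q; lra.
Qed.

(** Linearity: r(e0, w, w, z) = b(w, a) b(w, J z) is linear in z, and the nonzero form b(., a) can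
    be cancelled. From r(x, x, x, x) = 0 comes b(x, J x) = 0, so J is skew; it preserves norms,
    hence b, and a skew isometry squares to -1. *)
Lemma hermitian_of_rank_one : exists J : V -> V,
  [/\ forall a x y, J (a *: x + y) = a *: J x + J y,
      forall x, J (J x) = - x,
      forall x y, b (J x) (J y) = b x y &
      forall x y z, r y x x z = b y (J x) * b z (J x)].
Proof.
have [a a1 ar] := rank_one_jacobi e0; rewrite e0_unit in a1.
have [J JP] := choice (fun z => rank_one_form z a1 ar).
have Jn z : b (J z) (J z) = b z z by have [] := JP z.
have Jr z y w : r y z z w = b y (J z) * b w (J z) by have [_ ->] := JP z.
have Ja z x : r e0 x x z = b x a * b x (J z) by have [_ _ ->] := JP z.
have Jl c x y : J (c *: x + y) = c *: J x + J y.
  apply/eqP; rewrite -subr_eq0; apply/eqP; apply: (form_mul_eq0 a1) => w.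
  have := Ja (c *: x + y) w; rewrite (cl_linear4 hr) !Ja !bE; lra.
have JD x y : J (x + y) = J x + J y by rewrite -[x]scale1r Jl !scale1r.
have Jsk0 x : b x (J x) = 0.
  have := Jr x x x; have := cl_skew12 hr x x x x => E1 E2.
  by have /eqP : b x (J x) * b x (J x) = 0 by [lra]; rewrite mulf_eq0 orbb => /eqP.
have Jsk x y : b x (J y) = - b (J x) y.
  have := Jsk0 (x + y); rewrite JD !bE !Jsk0 (bC y); lra.
have Jiso x y : b (J x) (J y) = b x y.
  by have := Jn (x + y); rewrite JD !bE !Jn (bC (J y)) (bC y); lra.
exists J; split => // x; apply/eqP; rewrite -subr_eq0; apply/eqP/b_eq0.
set u := J (J x) - - x; rewrite {1}/u !bE opprK.
by rewrite (bC (J (J x)) x) (Jsk x (J x)) !Jiso; lra.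
Qed.

End RankOneJacobi.

(** * Eigenspaces *)

Lemma memv_ker_sub (K : fieldType) (aT rT : vectType K) (f h : 'Hom(aT, rT)) v :
  (v \in lker (f - h)) = (f v == h v).
Proof. by rewrite memv_ker add_lfunE opp_lfunE subr_eq0. Qed.

Section Eigenspaces.
Context {K : fieldType} {T : vectType K}.
Local Notation eigen := (@passmx.leigenspace K T).

Lemma mem_leigenspace (f : 'End(T)) c v : (v \in eigen f c) = (f v == c *: v).
Proof.
by rewrite memv_ker add_lfunE opp_lfunE scale_lfunE id_lfunE subr_eq0.
Qed.

(** f is c2 plus a rank-one operator: its c1-eigenspace is the line of e, its c2-eigenspace the
    kernel of l, and together they exhaust the space. *)
Lemma dim_leigenspace_rank_one (f : 'End(T)) (l : T -> K) (e : T) c1 c2 c :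
  linear_for *%R l -> l e = 1 -> c1 != c2 ->
  (forall y, f y = c2 *: y + ((c1 - c2) * l y) *: e) ->
  \dim (eigen f c) =
    if c == c1 then 1%N else if c == c2 then (\dim {:T}).-1 else 0%N.
Proof.
move=> ll le c12 fE.
pose lM := GRing.isLinear.Build K T K^o *%R l ll.
pose lL : {linear T -> K^o} := HB.pack l lM.
have lLE y : linfun lL y = l y by rewrite lfunE.
have e0 : e != 0.
  apply/eqP => e0; move: le; rewrite e0 -lLE linear0 => /eqP.
  by rewrite eq_sym oner_eq0.
have c120 : c1 - c2 != 0 by rewrite subr_eq0.
have [->|cc1] := eqVneq c c1.
  have -> : eigen f c1 = <[e]>%VS; last by rewrite dim_vline e0.
  apply/vspaceP => y; rewrite mem_leigenspace fE; apply/eqP/vlineP => [E|[k ->]].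
    exists (l y); apply: (scalerI c120).
    by rewrite scalerA scalerBl -E addrC addKr.
  have -> : l (k *: e) = k by rewrite -lLE linearZ /= lLE le [_ *: _]mulr1.
  by rewrite -[X in _ + X]scalerA -scalerDl addrC subrK.
have [->|cc2] := eqVneq c c2.
  have -> : eigen f c2 = lker (linfun lL).
    apply/vspaceP => y; rewrite mem_leigenspace fE memv_ker lLE -subr_eq0 addrC addKr.
    by rewrite scaler_eq0 (negPf e0) orbF mulf_eq0 (negPf c120).
  have := limg_ker_dim (linfun lL) fullv; rewrite capfv.
  have -> : (linfun lL @: fullv)%VS = fullv.
    apply/vspaceP => t; rewrite memvf; apply/memv_imgP.
    by exists (t *: e); rewrite ?memvf// linearZ /= lLE le [_ *: _]mulr1.
  by rewrite [X in (_ + X)%N]dimvf /dim /= addn1 => <-.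
have -> : eigen f c = 0%VS; last by rewrite dimv0.
apply/vspaceP => y; rewrite memv0 mem_leigenspace fE; apply/eqP/eqP => [E|->]; last first.
  have -> : l 0 = 0 by rewrite -lLE linear0.
  by rewrite !scaler0 mulr0 scale0r addr0.
have cE : (c - c2) *: y = ((c1 - c2) * l y) *: e by rewrite scalerBl -E addrC addKr.
have ly : l y = 0.
  have := congr1 (linfun lL) cE; rewrite !linearZ /= !lLE le [RHS]mulr1.
  move=> /eqP; rewrite [_ *: _]/(_ * _) -subr_eq0 -mulrBl opprB addrA subrK.
  by rewrite mulf_eq0 subr_eq0 (negPf cc1) => /eqP.
move: cE; rewrite ly mulr0 scale0r => /eqP; rewrite scaler_eq0 subr_eq0 (negPf cc2).
by move=> /eqP.
Qed.

Lemma dim_leigenspace_sub (V : {vspace T}) (h : 'End(T)) (f : 'End(subvs_of V)) c :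
  (forall y, vsval (f y) = h (vsval y)) ->
  \dim (passmx.leigenspace f c) = \dim (V :&: eigen h c).
Proof.
move=> fh; pose i : 'Hom(subvs_of V, T) := linfun vsval.
have iE y : i y = vsval y by rewrite lfunE.
have <- : (i @: passmx.leigenspace f c = V :&: eigen h c)%VS.
  apply/vspaceP => v; rewrite memv_cap; apply/memv_imgP/andP => [[y yf ->]|[vV vh]].
    rewrite iE subvsP mem_leigenspace -fh; split=> //.
    by move: yf; rewrite memv_ker add_lfunE opp_lfunE scale_lfunE id_lfunE subr_eq0 =>
      /eqP ->; rewrite linearZ.
  exists (vsproj V v); last by rewrite iE vsprojK.
  rewrite memv_ker add_lfunE opp_lfunE scale_lfunE id_lfunE subr_eq0.
  rewrite mem_leigenspace in vh.
  by apply/eqP/val_inj; rewrite /= fh !vsprojK//; apply/eqP.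
rewrite limg_dim_eq//; apply/eqP; rewrite -subv0; apply/subvP => y.
rewrite memv_cap memv_ker iE memv0 => /andP [_ /eqP y0].
by apply/eqP/val_inj; rewrite /= y0.
Qed.

Lemma dim_leigenspace_add (V X : {vspace T}) (h : 'End(T)) c :
  (V :&: X = 0)%VS -> (h @: V <= V)%VS -> (h @: X <= X)%VS ->
  \dim ((V + X) :&: eigen h c) = (\dim (V :&: eigen h c) + \dim (X :&: eigen h c))%N.
Proof.
move=> VX hV hX; rewrite -dimv_disjoint_sum; last first.
  apply/eqP; rewrite -subv0 -VX; apply: capvS; exact: capvSl.
congr (\dim _); apply/vspaceP => w; apply/idP/idP; last first.
  move=> /memv_addP [v + [x + ->]]; rewrite !memv_cap => /andP [vV vh] /andP [xX xh].
  by rewrite memv_add//= rpredD.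
rewrite memv_cap => /andP [/memv_addP [v vV [x xX ->]]].
rewrite mem_leigenspace linearD scalerDr -subr_eq0 opprD addrACA addr_eq0 => /eqP E.
have hvV : h v - c *: v \in V by rewrite rpredB ?rpredZ// (subvP hV)// memv_img.
have hxX : h x - c *: x \in X by rewrite rpredB ?rpredZ// (subvP hX)// memv_img.
have : h v - c *: v \in (V :&: X)%VS by rewrite memv_cap hvV E rpredN.
rewrite VX memv0 => hv0; move: (hv0); rewrite E oppr_eq0 => hx0.
by rewrite memv_add// memv_cap mem_leigenspace -subr_eq0 ?vV ?xX.
Qed.

(** A complement W of B in A is a model of A / B. The operator h on W need only agree with j modulo
    B, which leaves room to choose an h that preserves W. *)
Lemma dim_leigenspace_quotient (A B W : {vspace T}) (j h : 'End(T)) c :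
  (B <= A)%VS -> (W <= A)%VS -> (A <= W + B)%VS -> (W :&: B = 0)%VS ->
  (j @: A <= A)%VS -> (j @: B <= B)%VS ->
  (forall w, w \in W -> h w \in W /\ j w - h w \in B) ->
  \dim (passmx.leigenspace (quotv_end A B j) c) = \dim (W :&: eigen h c).
Proof.
move=> BA WA AWB WB jA jB hW.
have pi_eq v w : v \in A -> w \in A -> v - w \in B -> quotv_pi A B v = quotv_pi A B w.
  move=> vA wA vwB; apply/eqP; rewrite -subr_eq0 -linearB quotv_pi_eq0 //.
  exact: rpredB.
have jw w : w \in W -> quotv_end A B j (quotv_pi A B w) = quotv_pi A B (h w).
  move=> wW; have wA := subvP WA w wW; have [hwW jhw] := hW w wW.
  rewrite quotv_end_pi//; apply: pi_eq => //; last exact: (subvP WA).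
  by apply: (subvP jA); exact: memv_img.
rewrite -[RHS](limg_dim_eq (f := quotv_pi A B)); last first.
  apply/eqP; rewrite -subv0; apply/subvP => w; rewrite !memv_cap memv_ker.
  move=> /andP [/andP [wW _]]; rewrite quotv_pi_eq0 ?(subvP WA)// => wB.
  by rewrite -WB memv_cap wW.
congr (\dim _); apply/vspaceP => q.
rewrite memv_ker add_lfunE opp_lfunE scale_lfunE id_lfunE subr_eq0.
apply/eqP/memv_imgP => [|[w]]; last first.
  rewrite memv_cap mem_leigenspace => /andP [wW /eqP hw] ->.
  by rewrite jw// hw linearZ.
have [a aA <-] := quotv_pi_surj q.
have /memv_addP [w wW [v vB aE]] := subvP AWB a aA.
have -> : quotv_pi A B a = quotv_pi A B w.
  by apply: pi_eq => //; [exact: (subvP WA)|rewrite aE addrC addKr].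
rewrite jw// => /eqP; rewrite -linearZ -subr_eq0 -linearB.
have [hwW _] := hW w wW.
rewrite quotv_pi_eq0 => [hB|]; last by rewrite rpredB ?rpredZ// (subvP WA).
exists w => //; rewrite memv_cap wW mem_leigenspace -subr_eq0 -memv0 -WB memv_cap.
by rewrite hB andbT rpredB ?rpredZ.
Qed.

End Eigenspaces.

Section TwoEigenvalues.
Context {R : rcfType} {T : vectType R} (b : T -> T -> R) (f : 'End(T)) (c1 c2 : R).
Hypothesis bl : forall a x y z, b (a *: x + y) z = a * b x z + b y z.
Hypothesis bC : forall x y, b x y = b y x.
Hypothesis b_ge0 : forall x, 0 <= b x x.
Hypothesis b_eq0 : forall x, b x x = 0 -> x = 0.
Hypothesis f_adj : forall x y, b (f x) y = b x (f y).

Let bE := (sformDl bl, sformZl bl, sformNl bl, sform0l bl, sformDr bl bC, sformZr bl bC,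
  sformNr bl bC, sform0r bl bC).

(** The dimensions make the two eigenspaces span T, and self-adjointness makes them orthogonal, so
    the projection onto the c1-line is y |-> b(y, e) e. *)
Lemma two_eigenvalues : c1 != c2 -> \dim (passmx.leigenspace f c1) = 1%N ->
  \dim (passmx.leigenspace f c2) = (\dim {:T}).-1 -> (0 < \dim {:T})%N ->
  exists2 e, b e e = 1 & forall y, f y = c2 *: y + ((c1 - c2) * b y e) *: e.
Proof.
move=> c12 d1 d2 dT; set E1 := passmx.leigenspace f c1; set E2 := passmx.leigenspace f c2.
have cap0 : (E1 :&: E2 = 0)%VS.
  apply/eqP; rewrite -subv0; apply/subvP => y; rewrite memv_cap !mem_leigenspace memv0.
  move=> /andP [/eqP -> /eqP /eqP]; rewrite -subr_eq0 -scalerBl scaler_eq0 subr_eq0.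
  by rewrite (negPf c12).
have sumf : (E1 + E2 = fullv)%VS.
  apply/eqP; rewrite -(dimv_leqif_eq (subvf _)) dimv_disjoint_sum// d1 d2 add1n prednK//.
have := vpick0 E1; have [E10|_] := eqVneq E1 0%VS; first by move: d1; rewrite -/E1 E10 dimv0.
set e0 := vpick E1 => e00; have e0E : e0 \in E1 by exact: memv_pick.
have be0 : 0 < b e0 e0.
  by rewrite lt_def b_ge0 andbT; apply/eqP => /b_eq0 /eqP; rewrite e00.
pose t := Num.sqrt (b e0 e0).
have t0 : t != 0 by rewrite gt_eqF// sqrtr_gt0.
have tt : t * t = b e0 e0 by rewrite -expr2 sqr_sqrtr// ltW.
pose e := t^-1 *: e0; have e1 : b e e = 1 by rewrite !bE -tt; field.
have eE : e \in E1 by exact: rpredZ.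
have E1e : E1 = <[e]>%VS.
  apply/eqP; rewrite eq_sym eqEdim -memvE eE d1 dim_vline.
  by rewrite scaler_eq0 invr_eq0 (negPf t0) e00.
clearbody e; exists e => // y.
have : y \in (E1 + E2)%VS by rewrite sumf memvf.
move=> /memv_addP [v vE1 [w wE2 ->]].
move: vE1; rewrite E1e => /vlineP [k ->].
have /eqP fe : f e == c1 *: e by rewrite -mem_leigenspace.
have /eqP fw : f w == c2 *: w by rewrite -mem_leigenspace.
have we : b w e = 0.
  have := f_adj w e; rewrite fw fe !bE => /eqP; rewrite -subr_eq0 -mulrBl mulf_eq0.
  by rewrite subr_eq0 eq_sym (negPf c12) => /eqP.
rewrite !bE e1 we mulr1 addr0 linearD linearZ /= fe fw scalerDr.
rewrite [RHS]addrAC !scalerA -[in RHS]scalerDl; congr (_ *: _ + _); ring.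
Qed.

End TwoEigenvalues.

(** * The Levi-Civita connection *)

Section Derivations.
Context {R : realType} {m : nat} {M : manifold R m}.
Implicit Types (p q : M) (U : set M).

Lemma smooth_fun_at U (f : M -> R^o) p : smooth_fun U f -> U p ->
  differentiable (f \o chart_inv (chart_at p)) (chart_at p p).
Proof.
move=> sf Up; apply: (smooth_fun_differentiable sf) => //.
  exact: chart_at_atlas.
exact: chart_at_dom.
Qed.

Lemma vderD U p v (f h : M -> R^o) : smooth_fun U f -> smooth_fun U h -> U p ->
  vder p v (fun q => f q + h q) = vder p v f + vder p v h.
Proof.
move=> sf sh Up; apply: deriveD; apply: diff_derivable.
  exact: smooth_fun_at sf Up.
exact: smooth_fun_at sh Up.
Qed.

Lemma vderZ U p v a (f : M -> R^o) : smooth_fun U f -> U p ->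
  vder p v (fun q => a * f q : R^o) = a * vder p v f.
Proof.
move=> sf Up; apply: deriveZ; apply: diff_derivable.
exact: smooth_fun_at sf Up.
Qed.

Lemma smooth_vder p x (f : M -> R^o) : smooth_fun (chart_dom (chart_at p)) f ->
  smooth_fun (chart_dom (chart_at p)) (fun q => vder q (extend p x q) f).
Proof.
move=> sf; have acp := chart_at_atlas p.
have o : open (chart_at p @` chart_dom (chart_at p)) by exact: chart_img_open.
apply: (smooth_fun_in_chart acp); [exact: chart_dom_open|by []|].
have := sf _ acp; rewrite setIid => /(smooth_derive x).
apply: (smooth_on_eq o) => _ [q pq <-]; rewrite /comp (chart_funK pq).
by rewrite (vder_extend x pq)//; apply: smooth_fun_at sf pq.
Qed.

Lemma smooth_funZ U a (f : M -> R^o) : open U -> smooth_fun U f ->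
  smooth_fun U (fun q => a * f q : R^o).
Proof.
move=> Uo sf c ac; apply: smooth_onZ (smooth_fun_cst U (a : R^o) ac) (sf c ac).
exact: chart_image_open.
Qed.

End Derivations.

Section LeviCivita.
Context {R : realType} {m : nat} {M : manifold R m}.
Variables (g : metric_tensor M) (D : connection M).
Hypothesis hD : levi_civita g D.
Implicit Types (p q : M) (U : set M) (X Y Z W : M -> 'rV[R]_m).
Local Notation dom p := (chart_dom (chart_at p)).

Definition metf p x y : R := g p x y.

Lemma metf_linear p a x y z : metf p (a *: x + y) z = a * metf p x z + metf p y z.
Proof. by rewrite /metf linearP add_lfunE scale_lfunE. Qed.

(* D is local: if Z vanishes on U then Z = f Z, where f is the indicator of the
   complement of U, and the Leibniz rule at a point of U gives D Z = 0. *)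
Lemma cov_eq U Y Y' p v : open U -> U p -> smooth_field U Y ->
  (forall q, U q -> Y q = Y' q) -> D p v Y = D p v Y'.
Proof.
move=> Uo Up sY YY'; pose Z q := Y' q - Y q; pose f (q : M) : R^o := (~~ `[< U q >])%:R.
have Z0 q : U q -> Z q = 0 by move=> Uq; rewrite /Z YY'// subrr.
have f0 q : U q -> f q = 0 by move=> Uq; rewrite /f; case: asboolP.
have sZ : smooth_field U Z.
  by apply: smooth_field_eq (smooth_field0 U) => // q Uq; rewrite Z0.
have sf : smooth_fun U f.
  by apply: smooth_fun_eq (smooth_fun_cst U (0 : R^o)) => // q Uq; rewrite f0.
have -> : Y' = fun q => Y q + Z q by apply/funext => q; rewrite addrC subrK.
rewrite (lc_additive hD v Uo sY sZ Up).
suff -> : D p v Z = 0 by rewrite addr0.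
have -> : Z = fun q => f q *: Z q.
  apply/funext => q; rewrite /f; case: asboolP => Uq /=; last by rewrite scale1r.
  by rewrite scale0r Z0.
rewrite (lc_leibniz hD v Uo sf sZ Up) Z0// f0// scaler0 scale0r addr0 //.
Qed.

Lemma cov_vec0 U Y p : open U -> smooth_field U Y -> U p -> D p 0 Y = 0.
Proof.
move=> Uo sY Up; have := lc_linear hD 1 0 0 Uo sY Up.
rewrite !scale1r addr0 => /eqP; rewrite -subr_eq0 opprD addrA subrr sub0r oppr_eq0.
by move=> /eqP.
Qed.

Lemma covZ U Y p v a : open U -> smooth_field U Y -> U p ->
  D p v (fun q => a *: Y q) = a *: D p v Y.
Proof.
move=> Uo sY Up.
have := lc_leibniz hD v Uo (smooth_fun_cst U (a : R^o)) sY Up.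
by move=> ->; rewrite vder_cst scale0r add0r.
Qed.

Lemma smooth_fieldZc U (X : M -> 'rV[R]_m) a : open U -> smooth_field U X ->
  smooth_field U (fun q => a *: X q).
Proof. by move=> Uo sX; apply: (smooth_fieldZ Uo (smooth_fun_cst U (a : R^o)) sX). Qed.

Lemma cov_zero p v : D p v (fun=> 0) = 0.
Proof.
have := @covZ setT (fun=> 0) p v 0 openT (smooth_field0 setT) I.
by rewrite !scale0r.
Qed.

Lemma smooth_field_sum U I (r : seq I) (X : I -> M -> 'rV[R]_m) : open U ->
  (forall i, smooth_field U (X i)) -> smooth_field U (fun q => \sum_(i <- r) X i q).
Proof.
move=> Uo sX; elim: r => [|i r IH].
  apply: smooth_field_eq Uo _ (smooth_field0 U) => q _; by rewrite big_nil.
apply: smooth_field_eq Uo _ (smooth_fieldD Uo (sX i) IH) => q _; by rewrite big_cons.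
Qed.

Lemma cov_sum U p v I (r : seq I) (X : I -> M -> 'rV[R]_m) : open U -> U p ->
  (forall i, smooth_field U (X i)) ->
  D p v (fun q => \sum_(i <- r) X i q) = \sum_(i <- r) D p v (X i).
Proof.
move=> Uo Up sX; elim: r => [|i r IH].
  rewrite big_nil -[RHS](cov_zero p v); congr (D p v _).
  by apply/funext => q; rewrite big_nil.
rewrite big_cons -IH -(lc_additive hD v Uo (sX i) (smooth_field_sum r Uo sX) Up).
by congr (D p v _); apply/funext => q; rewrite big_cons.
Qed.

Lemma open_dom p : open (dom p).
Proof. exact: chart_dom_open. Qed.

Let od := open_dom.
Let pd := @chart_at_dom R m M.

Lemma smooth_cov_extend p x Y : smooth_field (dom p) Y ->
  smooth_field (dom p) (cov D (extend p x) Y).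
Proof. by move=> sY; apply: (lc_smooth hD); [exact: od|exact: smooth_extend|]. Qed.

Lemma cov_extendC p x y q : dom p q ->
  cov D (extend p x) (extend p y) q = cov D (extend p y) (extend p x) q.
Proof.
move=> pq; apply/eqP; rewrite -subr_eq0; apply/eqP.
have sx := @smooth_extend _ _ _ p x; have sy := @smooth_extend _ _ _ p y.
by rewrite (lc_torsion_free hD (od p) sx sy pq) lie_extend.
Qed.

Lemma cov_extendC_at p x y : D p x (extend p y) = D p y (extend p x).
Proof. by have := cov_extendC x y (pd p); rewrite /cov !extend_id. Qed.

(* Locked, since unification is otherwise tempted to unfold covariant derivatives. *)
Definition second_cov p x y Z := locked (D p x (cov D (extend p y) Z)).

Lemma second_covE p x y Z : second_cov p x y Z = D p x (cov D (extend p y) Z).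
Proof. by rewrite /second_cov -lock. Qed.

Lemma curvature_atE p x y z : curvature_at D p x y z =
  second_cov p x y (extend p z) - second_cov p y x (extend p z).
Proof.
rewrite !second_covE /curvature_at /curvature /cov !extend_id (lie_extend _ _ (pd p)).
by rewrite (cov_vec0 (od p) (@smooth_extend _ _ _ p z) (pd p)) subr0.
Qed.

Lemma second_cov_linear1 p a x x' y Z : smooth_field (dom p) Z ->
  second_cov p (a *: x + x') y Z = a *: second_cov p x y Z + second_cov p x' y Z.
Proof.
move=> sZ; rewrite !second_covE.
exact: (lc_linear hD _ _ _ (od p) (smooth_cov_extend y sZ) (pd p)).
Qed.

Lemma second_cov_linear2 p a x y y' Z : smooth_field (dom p) Z ->
  second_cov p x (a *: y + y') Z = a *: second_cov p x y Z + second_cov p x y' Z.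
Proof.
move=> sZ; have s1 := smooth_cov_extend y sZ; have s2 := smooth_cov_extend y' sZ.
have s3 := smooth_fieldZc a (od p) s1.
rewrite !second_covE -(covZ _ _ (od p) s1 (pd p)).
rewrite -(lc_additive hD x (od p) s3 s2 (pd p)).
apply: (cov_eq x (od p) (pd p) (smooth_cov_extend _ sZ)) => q pq.
by rewrite /cov extend_linear// (lc_linear hD _ _ _ (od p) sZ pq).
Qed.

Lemma second_cov_linear3 p a x y z z' :
  second_cov p x y (extend p (a *: z + z')) =
  a *: second_cov p x y (extend p z) + second_cov p x y (extend p z').
Proof.
have s0 := @smooth_extend _ _ _ p z; have s0' := @smooth_extend _ _ _ p z'.
have s1 := smooth_cov_extend y s0; have s2 := smooth_cov_extend y s0'.
have s3 := smooth_fieldZc a (od p) s1.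
rewrite !second_covE -(covZ _ _ (od p) s1 (pd p)).
rewrite -(lc_additive hD x (od p) s3 s2 (pd p)).
have s4 := @smooth_extend _ _ _ p (a *: z + z').
apply: (cov_eq x (od p) (pd p) (smooth_cov_extend _ s4)) => q pq.
have sa := smooth_fieldZc a (od p) s0.
have E r : dom p r -> extend p (a *: z + z') r = a *: extend p z r + extend p z' r.
  exact: extend_linear.
have E2 : D q (extend p y q) (extend p (a *: z + z')) =
    D q (extend p y q) (fun q => a *: extend p z q + extend p z' q).
  exact: cov_eq (od p) pq s4 E.
rewrite /cov E2.
by rewrite (lc_additive hD _ (od p) sa s0' pq) (covZ _ _ (od p) s0 pq).
Qed.

Let combine a (u v u' v' : 'rV[R]_m) :
  a *: u + u' - (a *: v + v') = a *: (u - v) + (u' - v').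
Proof. by rewrite scalerBr opprD addrACA. Qed.

Lemma curvature_at_linear1 p a x x' y z : curvature_at D p (a *: x + x') y z =
  a *: curvature_at D p x y z + curvature_at D p x' y z.
Proof.
have sz := @smooth_extend _ _ _ p z.
rewrite curvature_atE (second_cov_linear1 _ _ _ _ sz) (second_cov_linear2 _ _ _ _ sz).
by rewrite combine -!curvature_atE.
Qed.

Lemma curvature_at_skew1 p x y z : curvature_at D p x y z = - curvature_at D p y x z.
Proof. by rewrite !curvature_atE opprB. Qed.

Lemma curvature_at_linear3 p a x y z z' : curvature_at D p x y (a *: z + z') =
  a *: curvature_at D p x y z + curvature_at D p x y z'.
Proof.
rewrite (curvature_atE p x y z) (curvature_atE p x y z') curvature_atE.
by rewrite (second_cov_linear3 p a x y) (second_cov_linear3 p a y x) combine.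
Qed.

(** For commuting coordinate fields and a torsion-free connection, the second derivative is
    symmetric in its last two arguments, so the six terms cancel in pairs. *)
Lemma curvature_at_bianchi p x y z :
  curvature_at D p x y z + curvature_at D p y z x + curvature_at D p z x y = 0.
Proof.
have E a b c : second_cov p a b (extend p c) = second_cov p a c (extend p b).
  have s := smooth_cov_extend b (@smooth_extend _ _ _ p c).
  rewrite !second_covE.
  by apply: (cov_eq a (od p) (pd p) s) => q pq; exact: cov_extendC.
rewrite !curvature_atE (E x z y) (E y x z) (E z y x).
set u := second_cov _ _ _ _; set v := second_cov _ _ _ _; set w := second_cov _ _ _ _.
by rewrite !subrKA subrr.
Qed.

Hypothesis g_smooth : forall U X Y, open U -> smooth_field U X -> smooth_field U Y ->
  smooth_fun U (fun q => g q (X q) (Y q) : R^o).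

Lemma vder_metric p x Y Z : smooth_field (dom p) Y -> smooth_field (dom p) Z ->
  vder p x (fun q => metf q (Y q) (Z q) : R^o) =
  metf p (D p x Y) (Z p) + metf p (Y p) (D p x Z).
Proof.
move=> sY sZ; have := lc_metric hD (od p) (@smooth_extend _ _ _ p x) sY sZ (pd p).
by rewrite /cov extend_id.
Qed.

(** The function g(Z, W) is differentiated twice along coordinate fields; exchanging the order
    cancels the products of first derivatives. Arbitrary fields Z and W are allowed so that Z can
    later be a characteristic field. *)
Lemma second_cov_skew p x y Z W : smooth_field (dom p) Z -> smooth_field (dom p) W ->
  metf p (second_cov p x y Z - second_cov p y x Z) (W p) =
  - metf p (Z p) (second_cov p x y W - second_cov p y x W).
Proof.
move=> sZ sW.
have gs X Y : smooth_field (dom p) X -> smooth_field (dom p) Y ->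
    smooth_fun (dom p) (fun q => metf q (X q) (Y q) : R^o).
  by move=> sX sY; apply: g_smooth.
have E a b : vder p a (fun q => vder q (extend p b q) (fun r => metf r (Z r) (W r) : R^o)) =
  metf p (second_cov p a b Z) (W p) + metf p (D p b Z) (D p a W) +
  (metf p (D p a Z) (D p b W) + metf p (Z p) (second_cov p a b W)).
  have sbZ := smooth_cov_extend b sZ; have sbW := smooth_cov_extend b sW.
  rewrite (@vder_near _ _ _ _ _ _ _ (fun q =>
    (metf q (cov D (extend p b) Z q) (W q) : R^o) +
    (metf q (Z q) (cov D (extend p b) W q) : R^o)) _ (od p) (pd p)); last first.
    by move=> q pq; rewrite (lc_metric hD (od p) (@smooth_extend _ _ _ p b) sZ sW pq).
  rewrite (vderD _ (gs _ _ sbZ sW) (gs _ _ sZ sbW) (pd p)) !vder_metric//.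
  by rewrite !second_covE /cov !extend_id.
have := vder_swap x y (od p) (pd p) (gs _ _ sZ sW); rewrite (E x y) (E y x).
have eB a b c : metf p (a - b) c = metf p a c - metf p b c.
  by rewrite -[- b]scaleN1r addrC metf_linear mulN1r addrC.
have eBr a b c : metf p c (a - b) = metf p c a - metf p c b.
  by rewrite /metf linearB.
have key (a b c d a' d' : R) : a + b + (c + d) = a' + c + (b + d') -> a - a' = - (d - d').
  lra.
by rewrite eB eBr; exact: key.
Qed.

Lemma curvature_at_skew2 p x y z w : metf p (curvature_at D p x y z) w =
  - metf p z (curvature_at D p x y w).
Proof.
have := second_cov_skew x y (@smooth_extend _ _ _ p z) (@smooth_extend _ _ _ p w).
by rewrite (curvature_atE p x y z) (curvature_atE p x y w) !extend_id.
Qed.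

End LeviCivita.

(** * Lorentzian forms *)

Section LorentzianForm.
Context {R : realType} {m : nat} (b : 'Hom('rV[R]_m, 'Hom('rV[R]_m, R^o))).
Hypothesis hb : lorentzian_form b.
Local Notation T := 'rV[R]_m.

Definition homf (x y : T) : R := b x y.

Lemma homf_linear a x y z : homf (a *: x + y) z = a * homf x z + homf y z.
Proof. by rewrite /homf linearP add_lfunE scale_lfunE. Qed.

Lemma homfC x y : homf x y = homf y x.
Proof. by rewrite /homf; case: hb => ->. Qed.

Let bE := (sformDl homf_linear, sformZl homf_linear, sformNl homf_linear, sform0l homf_linear,
  sformDr homf_linear homfC, sformZr homf_linear homfC,
  sformNr homf_linear homfC, sform0r homf_linear homfC).

(** Pairing with e_j recovers the j-th coefficient of a combination of the e_i up to sign, so the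
    e_i form a basis; C is the inverse of the matrix of this basis. *)
Lemma lorentzian_coordinates : exists (C : 'M[R]_m) (i0 : 'I_m),
  (forall x : T, x *m C = 0 -> x = 0) /\
  forall x y, homf x y =
    \sum_i (if i == i0 then -1 else 1) * ((x *m C) 0 i * (y *m C) 0 i).
Proof.
have [_ [e [i0 ee]]] := hb; pose E : 'M[R]_m := \matrix_i e i.
have rE (c : T) : c *m E = \sum_i c 0 i *: e i.
  by rewrite mulmx_sum_row; apply: eq_bigr => i _; rewrite rowK.
have eej i (j : 'I_m) : homf (e i) (e j) = if i == j then (if i == i0 then -1 else 1) else 0.
  exact: ee.
have bce (c : T) j : homf (c *m E) (e j) = (if j == i0 then -1 else 1) * c 0 j.
  rewrite rE (sform_suml homf_linear) (bigD1 j)//= bE eej eqxx big1 ?addr0 1?mulrC// => i ij.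
  by rewrite bE eej (negPf ij) mulr0.
have Eu : E \in unitmx.
  rewrite -row_free_unit; apply: inj_row_free => c cE; apply/rowP => j.
  have := bce c j; rewrite cE bE mxE; case: ifP => _ /eqP; rewrite eq_sym.
    by rewrite mulN1r oppr_eq0 => /eqP.
  by rewrite mul1r => /eqP.
exists (invmx E), i0; split=> [x xC|x y].
  by rewrite -[x]mulmx1 -(mulVmx Eu) mulmxA xC mul0mx.
have {1}-> : y = (y *m invmx E) *m E by rewrite mulmxKV.
rewrite rE (sform_sumr homf_linear homfC); apply: eq_bigr => i _.
have xe := bce (x *m invmx E) i; rewrite mulmxKV// in xe.
by rewrite bE xe mulrCA [X in _ * X]mulrC.
Qed.

Lemma lorentzian_nondegenerate x : (forall y, homf x y = 0) -> x = 0.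
Proof.
have [C [i0 [Cinj bC]]] := lorentzian_coordinates => x0.
have Cu : C \in unitmx by rewrite -row_free_unit; exact: inj_row_free.
apply: (Cinj x).
apply/rowP => j; have := x0 (delta_mx 0 j *m invmx C).
rewrite bC mulmxKV// (bigD1 j)//= big1 ?addr0 => [|i ij]; last first.
  by rewrite [delta_mx 0 j 0 i]mxE (negPf ij) andbF !mulr0.
rewrite [delta_mx 0 j 0 j]mxE !eqxx mulr1 => xj; rewrite [RHS]mxE.
move: xj; case: ifP => _ /eqP.
  by rewrite mulN1r oppr_eq0 => /eqP.
by rewrite mul1r => /eqP.
Qed.

(* With x_0, t_0 the timelike coordinates, z = t_0 x - x_0 t has no timelike
   coordinate, so 0 <= b(z, z) = t_0^2 b(x, x) - x_0^2. *)
Lemma lorentzian_orth_timelike t x : homf t t = -1 -> homf t x = 0 ->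
  0 <= homf x x /\ (homf x x = 0 -> x = 0).
Proof.
have [C [i0 [Cinj bC]]] := lorentzian_coordinates => tt tx.
have sq0 i (a : R) : i != i0 -> 0 <= (if i == i0 then -1 else 1) * (a * a).
  by move=> /negPf ->; rewrite mul1r -expr2 sqr_ge0.
have pos z : (z *m C) 0 i0 = 0 -> 0 <= homf z z /\ (homf z z = 0 -> z = 0).
  move=> z0; rewrite bC (bigD1 i0)//= z0 !mulr0 add0r; split.
    by apply: sumr_ge0 => i; exact: sq0.
  move=> /eqP; rewrite psumr_eq0 => [/allP zz|i]; last exact: sq0.
  apply: (Cinj z); apply/rowP => i; rewrite [RHS]mxE; have [->//|ii0] := eqVneq i i0.
  have := zz i (mem_index_enum i); rewrite ii0 (negPf ii0) mul1r mulf_eq0 orbb.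
  by move/eqP.
pose t0 : R := (t *m C) 0 i0; pose x0 : R := (x *m C) 0 i0.
have t00 : t0 != 0.
  by apply/eqP => t00; have [+ _] := pos t t00; rewrite tt oppr_ge0 ler10.
have z0 : ((t0 *: x - x0 *: t) *m C) 0 i0 = 0.
  rewrite mulmxBl -!scalemxAl /t0 /x0; move: (t *m C) (x *m C) => u w.
  by rewrite !mxE mulrC subrr.
have [zge0 _] := pos _ z0.
have zE : homf (t0 *: x - x0 *: t) (t0 *: x - x0 *: t) = t0 ^+ 2 * homf x x - x0 ^+ 2.
  by rewrite !bE (homfC x t) tx tt; ring.
have t0p : 0 < t0 ^+ 2 by rewrite exprn_even_gt0.
rewrite zE in zge0.
have x0s : 0 <= x0 ^+ 2 by rewrite sqr_ge0.
split; first by rewrite -(pmulr_rge0 _ t0p) (le_trans x0s)// -subr_ge0.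
move=> xx; apply: (pos x _).2 => //; rewrite -/x0.
by apply/eqP; rewrite -sqrf_eq0; apply/eqP; move: zge0; rewrite xx mulr0; lra.
Qed.

End LorentzianForm.

(** * Structure tensors of a Lorentzian S-manifold *)

Section StructureTensors.
Context {R : realType} {m s : nat} {M : manifold R m} (F : gff_data M s).
Context (n : nat) (a1 : 'I_s).
Hypothesis hF : lorentzian_S_manifold F n a1.
Hypothesis hm : m = (2 * n + s)%N.
Local Notation T := 'rV[R]_m.
Local Notation g := (metf (met F)).
Local Notation phi := (Defs.phi F).
Local Notation xi := (Defs.xi F).
Local Notation eta := (Defs.eta F).
Implicit Types (p : M) (x y z : T) (a : 'I_s).

Definition esign a : R := if a == a1 then -1 else 1.

Lemma esign_sqr a : esign a * esign a = 1.
Proof. by rewrite /esign; case: ifP => _; rewrite ?mulrNN mulr1. Qed.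

Lemma met_linear p c x y z : g p (c *: x + y) z = c * g p x z + g p y z.
Proof. exact: metf_linear. Qed.

Lemma met_lorentzian p : lorentzian_form (met F p).
Proof. by have [] := lS_lorentzian hF. Qed.

Lemma metC p x y : g p x y = g p y x.
Proof. by apply: homfC; exact: met_lorentzian. Qed.

Definition metE p := (sformDl (met_linear p), sformZl (met_linear p),
  sformNl (met_linear p), sform0l (met_linear p), sformDr (met_linear p) (metC p),
  sformZr (met_linear p) (metC p), sformNr (met_linear p) (metC p),
  sform0r (met_linear p) (metC p)).

Lemma met_nondegenerate p x : (forall y, g p x y = 0) -> x = 0.
Proof. exact: (lorentzian_nondegenerate (met_lorentzian p) (x := x)). Qed.

Lemma eta_xi p a c : eta a p (xi c p) = (a == c)%:R :> R.
Proof. exact: (gff_dual (lS_gff hF)). Qed.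

Lemma phi2E p x : phi p (phi p x) = - x + \sum_a (eta a p x : R) *: xi a p.
Proof. exact: (gff_phi2 (lS_gff hF)). Qed.

(** The formula for phi^2 puts the kernel of phi inside the span of the xi. The rank 2n gives this
    kernel dimension s, so it is the whole span. *)
Lemma phi_xi p a : phi p (xi a p) = 0.
Proof.
pose X := [tuple xi c p | c < s].
have kX : (lker (phi p) <= <<X>>)%VS.
  apply/subvP => x; rewrite memv_ker => /eqP px; have := phi2E p x.
  rewrite px linear0 => /eqP; rewrite eq_sym addrC subr_eq0 => /eqP <-.
  apply: memv_suml => c _; apply: memvZ; apply: memv_span.
  by apply/mapP; exists c => //; rewrite mem_enum.
have dk : \dim (lker (phi p)) = s.
  have := limg_ker_dim (phi p) fullv; rewrite capfv dimvf /= (gff_phi_rank (lS_gff hF)).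
  by rewrite /dim /= mul1n [m in RHS]hm addnC => /addnI.
have : lker (phi p) == <<X>>%VS.
  rewrite eqEdim kX /= dk; apply: leq_trans (dim_span X) _.
  by rewrite size_tuple.
move=> /eqP E; apply/eqP; rewrite -memv_ker E; apply: memv_span.
by apply/mapP; exists a => //; rewrite mem_enum.
Qed.

(** Computing phi^3 as phi (phi^2 x) and as phi^2 (phi x) gives two expressions that differ by the
    sum of the eta^c(phi x) xi_c; applying eta^a to it isolates one coefficient. *)
Lemma eta_phi p a x : eta a p (phi p x) = 0 :> R.
Proof.
have : phi p (phi p (phi p x)) = - phi p x.
  rewrite (congr1 (phi p) (phi2E p x)) linearD linearN /= linear_sum big1 ?addr0// => c _.
  by rewrite linearZ /= phi_xi scaler0.
rewrite phi2E => /eqP; rewrite -subr_eq0 opprK addrAC addNr add0r => /eqP E.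
have := congr1 (eta a p) E; rewrite linear0 linear_sum /=.
rewrite (bigD1 a)//= big1 => [|c ca]; last first.
  by rewrite linearZ /= eta_xi eq_sym (negPf ca) /= scaler0.
by rewrite addr0 linearZ /= eta_xi eqxx [_ *: _]mulr1.
Qed.

Lemma compat p x y : g p (phi p x) (phi p y) =
  g p x y - \sum_a eps F a p * eta a p x * eta a p y.
Proof. by have [_] := lS_compatible hF; apply. Qed.

Lemma met_xi p x a : g p x (xi a p) = eps F a p * eta a p x.
Proof.
have := compat p x (xi a p); rewrite phi_xi !metE (bigD1 a)//= big1 => [|c ca].
  by rewrite addr0 eta_xi eqxx mulr1 => /eqP; rewrite eq_sym subr_eq0 => /eqP.
by rewrite eta_xi (negPf ca) mulr0.
Qed.

(** A characteristic vector other than xi_1 is orthogonal to the timelike xi_1, hence cannot have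
    negative square. *)
Lemma eps_esign a p : eps F a p = esign a.
Proof.
have tt : homf (met F p) (xi a1 p) (xi a1 p) = -1 by exact: (lS_timelike hF).
rewrite /esign; case: eqVneq => [->|aa1]; first exact: (lS_timelike hF).
have [/(_ a p) [//|em1] _] := lS_compatible hF.
have := lorentzian_orth_timelike (met_lorentzian p) (x := xi a p) tt.
have -> : homf (met F p) (xi a1 p) (xi a p) = 0.
  by rewrite -[homf _ _ _]/(g p _ _) met_xi eta_xi (negPf aa1) mulr0.
rewrite -[homf _ (xi a p) _]/(eps F a p) em1 => /(_ erefl) [].
by rewrite oppr_ge0 ler10.
Qed.

Lemma eta_met p x a : eta a p x = esign a * g p x (xi a p) :> R.
Proof. by rewrite met_xi eps_esign mulrA esign_sqr mul1r. Qed.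

Lemma met_phi p x y : g p (phi p x) (phi p y) =
  g p x y - \sum_a esign a * g p x (xi a p) * g p y (xi a p).
Proof.
rewrite compat; congr (_ - _); apply: eq_bigr => a _.
rewrite eps_esign !eta_met [RHS]mulrC; have := esign_sqr a.
move: (esign a) (g p x _) (g p y _) => e u v ee.
transitivity ((e * e) * (e * (u * v))); first by ring.
by rewrite ee; ring.
Qed.

Lemma phi_orth p x a : g p (phi p x) (xi a p) = 0.
Proof. by rewrite met_xi eta_phi mulr0. Qed.

Lemma phi2_met p x : phi p (phi p x) = - x + \sum_a (esign a * g p x (xi a p)) *: xi a p.
Proof. by rewrite phi2E; congr (_ + _); apply: eq_bigr => a _; rewrite eta_met. Qed.

Lemma phi_skew p x y : g p (phi p x) y = - g p x (phi p y).
Proof.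
have := met_phi p x (phi p y); rewrite [in X in _ = X]big1 => [|a _]; last first.
  by rewrite phi_orth mulr0.
rewrite subr0 phi2_met !metE (sform_sumr (met_linear p) (metC p)) big1 => [|a _].
  by rewrite addr0 => <-; rewrite opprK.
by rewrite !metE phi_orth mulr0.
Qed.

Lemma met_xi_xi p a c : g p (xi a p) (xi c p) = if a == c then esign a else 0.
Proof.
by rewrite met_xi eta_xi eps_esign eq_sym; case: eqVneq => [->|_]; rewrite ?mulr1 ?mulr0.
Qed.

Lemma phi3 p x : phi p (phi p (phi p x)) = - phi p x.
Proof. by rewrite phi2_met big1 ?addr0// => a _; rewrite phi_orth mulr0 scale0r. Qed.

Lemma im_phiP p x : reflect (forall a, g p x (xi a p) = 0) (x \in im_phi F p).
Proof.
apply: (iffP idP) => [/memv_imgP [y _ ->] a|xo]; first exact: phi_orth.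
rewrite -[x]opprK memvN; have -> : - x = phi p (phi p x).
  by rewrite phi2_met big1 ?addr0// => a _; rewrite xo mulr0 scale0r.
exact: memv_img (memvf _).
Qed.

Lemma orth_xi_positive p x : g p x (xi a1 p) = 0 ->
  0 <= g p x x /\ (g p x x = 0 -> x = 0).
Proof.
move=> xo; apply: (lorentzian_orth_timelike (met_lorentzian p) (t := xi a1 p)).
  exact: (lS_timelike hF).
by rewrite -[homf _ _ _]/(g p _ _) metC.
Qed.

End StructureTensors.

(** * Covariant derivatives of the structure tensors *)

Section CovariantStructure.
Context {R : realType} {m s : nat} {M : manifold R m} (F : gff_data M s).
Context (n : nat) (a1 : 'I_s) (D : connection M).
Hypothesis hF : lorentzian_S_manifold F n a1.
Hypothesis hm : m = (2 * n + s)%N.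
Hypothesis hD : levi_civita (met F) D.
Local Notation T := 'rV[R]_m.
Local Notation g := (metf (met F)).
Local Notation phi := (Defs.phi F).
Local Notation xi := (Defs.xi F).
Local Notation eta := (Defs.eta F).
Local Notation esign := (@esign R s a1).
Local Notation dom p := (chart_dom (chart_at p)).
Local Notation E p x := (extend p x).
Implicit Types (p q : M) (x y z : T) (a : 'I_s) (X Y Z : M -> T).

Let od := @open_dom R m M.
Let pd := @chart_at_dom R m M.
Let sE p x : smooth_field (dom p) (E p x) := @smooth_extend R m M p x.
Let gE p := metE hF p.
Let gC p := metC hF p.

Lemma smooth_phi p Y : smooth_field (dom p) Y ->
  smooth_field (dom p) (fun q => phi q (Y q)).
Proof. exact: (gff_phi_smooth (lS_gff hF)). Qed.

Lemma smooth_xi p a : smooth_field (dom p) (xi a).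
Proof. by apply: smooth_field_subset (gff_xi_smooth (lS_gff hF) a). Qed.

Lemma smooth_met p X Y : smooth_field (dom p) X -> smooth_field (dom p) Y ->
  smooth_fun (dom p) (fun q => g q (X q) (Y q) : R^o).
Proof. by move=> sX sY; have [_] := lS_lorentzian hF; apply. Qed.

Lemma vder_met p x Y Z : smooth_field (dom p) Y -> smooth_field (dom p) Z ->
  vder p x (fun q => g q (Y q) (Z q) : R^o) =
  g p (D p x Y) (Z p) + g p (Y p) (D p x Z).
Proof. exact: vder_metric. Qed.

Definition cov_phi p x Y := D p x (fun q => phi q (Y q)) - phi p (D p x Y).

Definition nabla_phi p x y := locked (cov_phi p x (E p y)).

(** Tensoriality of nabla phi: in the coordinate frame, the derivatives of the coefficients of Y
    cancel between the two terms of [cov_phi]. *)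
Lemma cov_phi_expansion p x Y : smooth_field (dom p) Y ->
  cov_phi p x Y = \sum_i Y p 0 i *: cov_phi p x (E p (delta_mx 0 i)).
Proof.
move=> sY; pose f i := frame_coord p i Y; pose e i := E p (delta_mx 0 i).
have sf i : smooth_fun (dom p) (f i) by exact: smooth_frame_coord.
have sfe i : smooth_field (dom p) (fun q => f i q *: e i q).
  exact: smooth_fieldZ (od p) (sf i) (sE p _).
have sp i : smooth_field (dom p) (fun q => phi q (e i q)).
  exact: smooth_phi (sE p _).
have sfp i : smooth_field (dom p) (fun q => f i q *: phi q (e i q)).
  exact: smooth_fieldZ (od p) (sf i) (sp i).
have fp i : f i p = Y p 0 i by rewrite /f /frame_coord vder_chart_at.
have YE q : dom p q -> Y q = \sum_i f i q *: e i q by exact: frame_expansion.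
have pYE q : dom p q -> phi q (Y q) = \sum_i f i q *: phi q (e i q).
  by move=> pq; rewrite YE// linear_sum; apply: eq_bigr => i _; rewrite linearZ.
rewrite {1}/cov_phi (cov_eq hD x (od p) (pd p) (smooth_phi sY) pYE).
rewrite (cov_eq hD x (od p) (pd p) sY YE).
rewrite (cov_sum hD x _ (od p) (pd p) sfp) (cov_sum hD x _ (od p) (pd p) sfe).
rewrite linear_sum -sumrB; apply: eq_bigr => i _ /=.
rewrite (lc_leibniz hD x (od p) (sf i) (sp i) (pd p)).
rewrite (lc_leibniz hD x (od p) (sf i) (sE p _) (pd p)).
by rewrite linearD !linearZ /= fp /cov_phi scalerBr opprD addrACA subrr add0r.
Qed.

Lemma cov_phiE p x Y : smooth_field (dom p) Y ->
  D p x (fun q => phi q (Y q)) = phi p (D p x Y) + nabla_phi p x (Y p).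
Proof.
move=> sY; rewrite /nabla_phi -lock (cov_phi_expansion x (sE p _)) extend_id.
by rewrite -cov_phi_expansion// /cov_phi addrC subrK.
Qed.

Lemma nabla_phi_sub0 p y : nabla_phi p 0 y = 0.
Proof.
rewrite /nabla_phi -lock /cov_phi (cov_vec0 hD (od p) (smooth_phi (sE p y)) (pd p)).
by rewrite (cov_vec0 hD (od p) (sE p y) (pd p)) linear0 subrr.
Qed.

Lemma vder_eta p x a Y : smooth_field (dom p) Y ->
  vder p x (fun q => eta a q (Y q)) =
  esign a * (g p (D p x Y) (xi a p) + g p (Y p) (D p x (xi a))) :> R^o.
Proof.
move=> sY; have -> : (fun q => eta a q (Y q)) =
    (fun q => esign a * g q (Y q) (xi a q) : R^o).
  by apply/funext => q; rewrite (eta_met hF hm).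
rewrite (vderZ x (esign a) (smooth_met sY (smooth_xi p a)) (pd p)).
by rewrite (vder_met _ sY (smooth_xi p a)).
Qed.

Lemma dform_extend p q a y z : dom p q ->
  g q (E p y q) (phi q (E p z q)) =
  2^-1 * (vder q (E p y q) (fun r => eta a r (E p z r)) -
          vder q (E p z q) (fun r => eta a r (E p y r))) :> R^o.
Proof.
move=> pq; apply: etrans (esym (lS_deta hF a (od p) (sE p y) (sE p z) pq)) _.
by rewrite /dform (lie_extend _ _ pq) linear0 subr0.
Qed.

Lemma nabla_xi_skew p a x y : esign a * g p (D p x (xi a)) y -
  esign a * g p (D p y (xi a)) x = 2 * g p x (phi p y).
Proof.
have := dform_extend a x y (pd p); rewrite !extend_id.
rewrite !vder_eta ?extend_id; do ?exact: sE.
rewrite (cov_extendC_at hD) !(gC _ (D _ _ (xi a))) => ->.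
have key (e u v w : R) : e * v - e * w = 2 * (2^-1 * (e * (u + v) - e * (u + w))).
  by field.
exact: key.
Qed.

Lemma nabla_xi_orth_xi p a c x : g p (D p x (xi a)) (xi c p) +
  g p (xi a p) (D p x (xi c)) = 0.
Proof.
rewrite -(vder_met _ (smooth_xi p a) (smooth_xi p c)).
rewrite -[RHS](@vder_cst _ _ _ _ p x (if a == c then esign a else 0 : R^o)).
by congr (vder p x _); apply/funext => q; rewrite (met_xi_xi hF hm).
Qed.

Lemma nabla_phi_at_xi p x a : nabla_phi p x (xi a p) = - phi p (D p x (xi a)).
Proof.
have := cov_phiE x (smooth_xi p a).
have -> : (fun q => phi q (xi a q)) = fun=> 0.
  by apply/funext => q; rewrite (phi_xi hF hm).
rewrite (cov_zero hD) => /eqP; rewrite eq_sym addrC addr_eq0 => /eqP //.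
Qed.

Lemma nabla_phi_skew p x y z : g p (nabla_phi p x y) z = - g p y (nabla_phi p x z).
Proof.
have sy := sE p y; have sz := sE p z.
have := vder_met x (smooth_phi sy) sz; have := vder_met x sy (smooth_phi sz).
have -> : (fun q => g q (E p y q) (phi q (E p z q)) : R^o) =
    (fun q => (-1) * g q (phi q (E p y q)) (E p z q) : R^o).
  by apply/funext => q; rewrite (phi_skew hF hm) mulN1r opprK.
rewrite (vderZ _ _ (smooth_met (smooth_phi sy) sz) (pd p)) => E1 E2; move: E1.
rewrite E2 (cov_phiE x sy) (cov_phiE x sz) !extend_id; clear E2.
rewrite !gE !(phi_skew hF hm).
have key (u v w t k : R) : -1 * (- u + v + - w) = t + (w + k) -> t = u -> v = - k by lra.
by move=> /key; apply.
Qed.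

Lemma vder_Phi p x y z :
  vder p x (fun q => g q (E p y q) (phi q (E p z q)) : R^o) =
  g p (D p x (E p y)) (phi p z) - g p (phi p y) (D p x (E p z)) +
  g p y (nabla_phi p x z).
Proof.
have sz := smooth_phi (sE p z).
rewrite (vder_met x (sE p y) sz) (cov_phiE x (sE p z)) !extend_id !gE.
by rewrite (phi_skew hF hm) opprK addrA.
Qed.

(** This is d Phi = 0, which follows from Phi = d eta: the second derivatives [S2] of the components
    of eta are symmetric in the two directions and cancel cyclically, as do the derivatives of the
    coordinate fields. *)
Lemma nabla_phi_closed p x y z : g p y (nabla_phi p x z) +
  g p z (nabla_phi p y x) + g p x (nabla_phi p z y) = 0.
Proof.
pose h w : M -> R^o := fun q => eta a1 q (E p w q).
have sh w : smooth_fun (dom p) (h w).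
  exact: (gff_eta_smooth (lS_gff hF)) (od p) (sE p w).
pose S2 (u v w : T) : R := vder p u (fun q => vder q (E p v q) (h w)).
have SC u v w : S2 u v w = S2 v u w by exact: vder_swap (od p) (pd p) (sh w).
have PE u v w : vder p u (fun q => g q (E p v q) (phi q (E p w q)) : R^o) =
    2^-1 * S2 u v w + (- 2^-1) * S2 u w v.
  have s1 := smooth_vder v (sh w); have s2 := smooth_vder w (sh v).
  rewrite /S2 -(vderZ u _ s1 (pd p)) -(vderZ u _ s2 (pd p)).
  rewrite -(vderD u (smooth_funZ _ (od p) s1) (smooth_funZ _ (od p) s2) (pd p)).
  apply: (vder_near _ (od p) (pd p)) => q pq.
  by rewrite (dform_extend a1 _ _ pq) mulrBr mulNr.
have DC u v : D p u (E p v) = D p v (E p u) by exact: cov_extendC_at hD _ _ _.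
have := PE x y z; have := PE y z x; have := PE z x y; rewrite !vder_Phi.
rewrite (DC z x) (DC z y) (DC y x) (SC z x) (SC z y) (SC y x).
rewrite !(gC _ (phi p _)).
have key (u v w k1 k2 k3 n1 n2 n3 : R) :
  u - v + n1 = 2^-1 * k1 + - 2^-1 * k2 ->
  v - w + n2 = 2^-1 * k2 + - 2^-1 * k3 ->
  w - u + n3 = 2^-1 * k3 + - 2^-1 * k1 -> n3 + n2 + n1 = 0 by lra.
exact: key.
Qed.

(** Torsion-freeness replaces the brackets in the Nijenhuis tensor by covariant derivatives; those
    of the coordinate fields cancel and only nabla phi remains. *)
Lemma nabla_phi_normal p x y :
  nabla_phi p (phi p x) y - nabla_phi p (phi p y) x + phi p (nabla_phi p y x) -
  phi p (nabla_phi p x y) = - (2 * g p x (phi p y)) *: \sum_a xi a p.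
Proof.
have := lS_normal hF (od p) (sE p x) (sE p y) (pd p).
have spx := smooth_phi (sE p x); have spy := smooth_phi (sE p y).
rewrite /nijenhuis (lie_extend _ _ (pd p)) !linear0.
rewrite -(lc_torsion_free hD (od p) spx spy (pd p)).
rewrite -(lc_torsion_free hD (od p) spx (sE p y) (pd p)).
rewrite -(lc_torsion_free hD (od p) (sE p x) spy (pd p)).
rewrite /cov !extend_id !cov_phiE ?extend_id; do ?exact: sE.
rewrite (cov_extendC_at hD p y x).
have -> : \sum_a dform (eta a) (E p x) (E p y) p *: xi a p = g p x (phi p y) *: \sum_a xi a p.
  rewrite scaler_sumr; apply: eq_bigr => a _; congr (_ *: _).
  by rewrite (lS_deta hF a (od p) (sE p x) (sE p y) (pd p)) !extend_id.
rewrite scalerA scaleNr => /eqP; rewrite addr_eq0 => /eqP <-.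
have L1 u v w : phi p (u - (phi p v + w)) = phi p u - (phi p (phi p v) + phi p w).
  by rewrite linearB linearD.
have L2 u v w : phi p (phi p v + w - u) = phi p (phi p v) + phi p w - phi p u.
  by rewrite linearB linearD.
rewrite L1 L2.
have key (u v w k P Q H : T) :
    u - v + w - k = 0 + (P + u - (Q + v)) - (P - (H + w)) - (H + k - Q).
  by apply/rowP => i; rewrite !mxE; ring.
exact: key.
Qed.

Lemma nabla_phi_phi p x y : nabla_phi p x (phi p y) + phi p (nabla_phi p x y) =
  \sum_a ((esign a * g p y (D p x (xi a))) *: xi a p +
          (esign a * g p y (xi a p)) *: D p x (xi a)).
Proof.
have spy := smooth_phi (sE p y).
have := cov_phiE x spy; rewrite (cov_phiE x (sE p y)) extend_id.
pose f a q : R^o := esign a * g q (E p y q) (xi a q).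
have sf a : smooth_fun (dom p) (f a).
  by apply: smooth_funZ (od p) _; exact: smooth_met (sE p y) (smooth_xi p a).
have sfx a : smooth_field (dom p) (fun q => f a q *: xi a q).
  exact: smooth_fieldZ (od p) (sf a) (smooth_xi p a).
have pE : (fun q => phi q (phi q (E p y q))) =
    fun q => (-1) *: E p y q + \sum_a f a q *: xi a q.
  by apply/funext => q; rewrite (phi2_met hF hm) scaleN1r.
rewrite pE (lc_additive hD x (od p) (smooth_fieldZc _ (od p) (sE p y))
  (smooth_field_sum _ (od p) sfx) (pd p)).
rewrite (covZ hD _ _ (od p) (sE p y) (pd p)) (cov_sum hD x _ (od p) (pd p) sfx).
rewrite linearD /= (phi2_met hF hm p (D p x _)) scaleN1r -!addrA => /addrI.
rewrite [phi p _ + _]addrC => EQ.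
have -> : nabla_phi p x (phi p y) + phi p (nabla_phi p x y) =
  \sum_a D p x (fun q => f a q *: xi a q) -
  \sum_a (esign a * g p (D p x (E p y)) (xi a p)) *: xi a p.
  by rewrite EQ [X in _ = X]addrC addKr.
rewrite -sumrB; apply: eq_bigr => a _.
rewrite (lc_leibniz hD x (od p) (sf a) (smooth_xi p a) (pd p)).
rewrite /f (vderZ _ _ (smooth_met (sE p y) (smooth_xi p a)) (pd p)).
rewrite (vder_met _ (sE p y) (smooth_xi p a)) !extend_id mulrDr scalerDl.
by rewrite addrC -[X in _ + X]addrA addKr.
Qed.

Lemma nabla_xiE p a x : D p x (xi a) = - esign a *: phi p x.
Proof.
exact: (nabla_xi_formula (met_linear F p) (gC p) (met_nondegenerate hF (p := p))
  (phi_skew hF hm p) (phi_xi hF hm p) (@esign_sqr R s a1) (phi2_met hF hm p)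
  (@nabla_phi_sub0 p) (nabla_xi_skew p) (B := fun a x => D p x (xi a))
  (fun a c => nabla_xi_orth_xi p a c) (nabla_phi_at_xi p) (nabla_phi_skew p)
  (nabla_phi_closed p) (nabla_phi_normal p) a x).
Qed.

Lemma nabla_phiE p x y : nabla_phi p x y =
  g p (phi p x) (phi p y) *: xi_tilde F p + g p y (xi_tilde F p) *: phi p (phi p x).
Proof.
exact: (nabla_phi_formula (met_linear F p) (gC p) (met_nondegenerate hF (p := p))
  (phi_skew hF hm p) (phi_xi hF hm p) (@esign_sqr R s a1) (met_xi_xi hF hm p)
  (phi2_met hF hm p)
  (@nabla_phi_sub0 p) (nabla_xi_skew p) (B := fun a x => D p x (xi a))
  (fun a c => nabla_xi_orth_xi p a c) (nabla_phi_at_xi p) (nabla_phi_skew p)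
  (nabla_phi_closed p) (nabla_phi_normal p) (nabla_phi_phi p) x y).
Qed.

(** As nabla xi_a = - e_a phi holds at every point, it can be differentiated again, and R(x, y) xi_a
    is - e_a times the skew part of nabla phi. [curvature_at] extends the vector xi_a(p) with
    constant components rather than by the field xi_a; skewness against w links the two
    extensions. *)
Lemma curvature_xi p x y a :
  curvature_at D p x y (xi a p) = esign a *:
    (g p x (xi_tilde F p) *: phi p (phi p y) - g p y (xi_tilde F p) *: phi p (phi p x)).
Proof.
have K u v : second_cov D p u v (xi a) =
    - esign a *: (phi p (D p u (E p v)) + nabla_phi p u v).
  have := cov_phiE u (sE p v); rewrite extend_id => <-.
  rewrite -(covZ hD u (- esign a) (od p) (smooth_phi (sE p v)) (pd p)).
  by rewrite second_covE; congr (D p u _); apply/funext => q; exact: nabla_xiE.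
have gs := (lS_lorentzian hF).2.
apply: (sform_inj (met_linear F p) (met_nondegenerate hF (p := p))) => w.
have s1 := curvature_at_skew2 hD gs p x y (xi a p) w.
have := second_cov_skew hD gs x y (smooth_xi p a) (sE p w).
rewrite -(curvature_atE hD p x y w) extend_id -s1 => <-.
rewrite !K (cov_extendC_at hD p y x) !nabla_phiE; congr (g p _ w).
have key (e : R) (u t v k : T) :
    - e *: (u + (t + v)) - - e *: (u + (t + k)) = e *: (k - v).
  by apply/rowP => i; rewrite !mxE; ring.
by rewrite (gC p (phi p y)) key.
Qed.

End CovariantStructure.

(** * Null Jacobi operators *)

Section NullJacobi.
Context {R : realType} {m s : nat} {M : manifold R m} (F : gff_data M s).
Context (n : nat) (a1 : 'I_s) (D : connection M).
Hypothesis hF : lorentzian_S_manifold F n a1.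
Hypothesis hm : m = (2 * n + s)%N.
Hypothesis hD : levi_civita (met F) D.
Variable p : M.
Local Notation T := 'rV[R]_m.
Local Notation g := (metf (met F) p).
Local Notation phi := (Defs.phi F p).
Local Notation xi a := (Defs.xi F a p).
Local Notation esign := (@esign R s a1).
Local Notation Rm := (curvature_at D p).
Local Notation im := (im_phi F p).
Implicit Types (x y z w u : T) (a : 'I_s).

Let gE := metE hF p.
Let gC := metC hF p.

Definition curvature_form x y z w : R := g (Rm x y z) w.
Local Notation r := curvature_form.

Lemma curvature_form_like : curvature_like r.
Proof.
split => [c x x' y z w|c x y z z' w|x y z w|x y z w|x y z w]; rewrite /r.
- by rewrite (curvature_at_linear1 hD) met_linear.
- by rewrite (curvature_at_linear3 hD) met_linear.
- by rewrite (curvature_at_skew1 hD) gE.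
- have gs := (lS_lorentzian hF).2.
  exact: etrans (curvature_at_skew2 hD gs p x y z w) (congr1 -%R (gC _ _)).
- by rewrite -!gE (curvature_at_bianchi hD) gE.
Qed.

Let rl := curvature_form_like.

(** The form [eta_tilde] in metric terms; see [eta_tildeE]. *)
Definition reeb_form x : R := g x (xi_tilde F p).
Local Notation h1 := reeb_form.
(** The metric on Im(phi), extended by zero along the characteristic vectors. *)
Definition horizontal_form x y : R := g (phi x) (phi y).
Local Notation hs := horizontal_form.

Lemma horizontal_formC x y : hs x y = hs y x. Proof. exact: gC. Qed.

Lemma phi2_horizontal x y : g (phi (phi x)) y = - hs x y.
Proof. exact: phi_skew hF hm p _ _. Qed.

Lemma reeb_xi a : h1 (xi a) = esign a.
Proof.
rewrite /reeb_form /xi_tilde (sform_sumr (met_linear F p) gC) (bigD1 a)//= big1.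
  by rewrite addr0 (met_xi_xi hF hm) eqxx.
by move=> c ca; rewrite (met_xi_xi hF hm) eq_sym (negPf ca).
Qed.

Lemma horizontal_xi a y : hs (xi a) y = 0.
Proof. by rewrite /horizontal_form (phi_xi hF hm) gE. Qed.

Lemma curvature_form_xi x y a w :
  r x y (xi a) w = esign a * (h1 y * hs x w - h1 x * hs y w).
Proof.
rewrite /r (curvature_xi hF hm hD) !gE !phi2_horizontal /reeb_form; ring.
Qed.

Lemma imP x : reflect (forall a, g x (xi a) = 0) (x \in im).
Proof. exact: im_phiP hF hm p x. Qed.

Lemma im_reeb x : x \in im -> h1 x = 0.
Proof.
move=> /imP xo; rewrite /reeb_form (sform_sumr (met_linear F p) gC) big1// => a _.
Qed.

Lemma im_horizontal x y : x \in im -> hs x y = g x y.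
Proof.
move=> /imP xo; rewrite /horizontal_form (met_phi hF hm) big1 ?subr0// => a _.
by rewrite xo mulr0 mul0r.
Qed.

Lemma im_positive x : x \in im -> 0 <= g x x /\ (g x x = 0 -> x = 0).
Proof. by move=> /imP xo; apply: orth_xi_positive hF _ _ _ => //; exact: xo. Qed.

Section NullVector.
Variables (x u : T).
Hypothesis xim : x \in im.
Hypothesis x1 : g x x = 1.
Hypothesis uE : u = xi a1 + x.

Local Notation V := (spaceV F a1 p u).
Local Notation W := (spaceW F a1 p u).

Let esign1 : esign a1 = -1. Proof. by rewrite /esign eqxx. Qed.

Lemma spaceVP y : reflect (g x y = 0 /\ y \in im) (y \in V).
Proof.
rewrite /spaceV uE addrC addKr memv_cap memv_ker.
by apply: (iffP andP) => [[/eqP]|[/eqP]].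
Qed.

Let x_xi a : g x (xi a) = 0. Proof. by have /imP := xim. Qed.

Let r1D2 y z w v k : r y (z + w) v k = r y z v k + r y w v k.
Proof. by have := cl_linear2 rl 1 y z w v k; rewrite scale1r mul1r. Qed.
Let r1D3 y z w v k : r y v (z + w) k = r y v z k + r y v w k.
Proof. by have := cl_linear3 rl 1 y v z w k; rewrite scale1r mul1r. Qed.

Lemma jacobi_V y : y \in V -> Rm y u u = Rm y x x + y.
Proof.
move=> /spaceVP [xy yim]; apply: (sform_inj (met_linear F p) (met_nondegenerate hF (p := p))) => w.
rewrite -/(r y u u w) (sformDl (met_linear F p) (Rm y x x)) -/(r y x x w) uE r1D2 !r1D3.
(* Of the four terms from u = xi_1 + x, only r(y, x, x, w) and r(y, xi_1, xi_1, w) = g(y, w)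
   survive; the mixed ones carry a factor h1 x, h1 y or g(x, y). *)
rewrite !curvature_form_xi (cl_pair rl y (xi a1) x w) (cl_skew34 rl x w y) curvature_form_xi.
rewrite reeb_xi esign1 horizontal_xi (im_reeb xim) (im_reeb yim).
rewrite (im_horizontal _ xim) (im_horizontal w yim) xy; ring.
Qed.

(** The value equals u + [tail_xi], so its class modulo u is that of a vector independent of x. *)
Lemma jacobi_xi a : a != a1 -> Rm (xi a) u u = x + xi_tilde F p.
Proof.
move=> aa1; apply: (sform_inj (met_linear F p) (met_nondegenerate hF (p := p))) => w.
rewrite -/(r (xi a) u u w) (sformDl (met_linear F p) x) (cl_pair rl (xi a) u u w).
rewrite curvature_form_xi /esign (negPf aa1).
have h1u : h1 u = -1.
  by rewrite uE /reeb_form gE -/(h1 (xi a1)) -/(h1 x) reeb_xi esign1 (im_reeb xim) addr0.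
have hsu k : hs u k = g x k.
  by rewrite /horizontal_form uE linearD /= (phi_xi hF hm) add0r -/(hs x k) im_horizontal.
rewrite h1u (horizontal_formC w) !hsu uE gE x_xi x1 /h1 (gC (xi_tilde F p)); ring.
Qed.

Let jac_linear : linear (fun y => Rm y u u).
Proof. by move=> c y y'; rewrite (curvature_at_linear1 hD). Qed.

Lemma jacobiE y : jacobi D p u y = Rm y u u.
Proof.
pose jM := GRing.isLinear.Build R T T *:%R _ jac_linear.
pose jL : {linear T -> T} := HB.pack (fun y => Rm y u u) jM.
exact: (lfunE jL y).
Qed.

Local Notation X := (\sum_(a | a != a1) <[xi a]>)%VS.
Local Notation A := (perp F p u).
Local Notation B := <[u]>%VS.

Definition tail_coord w : R := \sum_(a | a != a1) g w (xi a).
Definition tail_xi : T := \sum_(a | a != a1) xi a.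

Let shift_linear : linear (fun w => tail_coord w *: u).
Proof.
move=> c w w'; rewrite scalerA -scalerDl; congr (_ *: _).
rewrite /tail_coord mulr_sumr -big_split; apply: eq_bigr => a _.
by rewrite met_linear.
Qed.

(* R(., u) u modulo u, corrected so that it preserves both V and
   span(xi_a, a <> a1). *)
Definition jacobi_shift : 'End(T) :=
  let sM := GRing.isLinear.Build R T T *:%R _ shift_linear in
  let sL : {linear T -> T} := HB.pack (fun w => tail_coord w *: u) sM in
  jacobi D p u - linfun sL.

Lemma jacobi_shiftE w : jacobi_shift w = Rm w u u - tail_coord w *: u.
Proof. by rewrite /jacobi_shift add_lfunE opp_lfunE lfunE /= jacobiE. Qed.

Lemma im_phi2 y : y \in im -> phi (phi y) = - y.
Proof.
move=> /imP yo; rewrite (phi2_met hF hm) big1 ?addr0// => a _.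
by rewrite yo mulr0 scale0r.
Qed.

Lemma jacobi_shift_V y : y \in V -> jacobi_shift y = Rm y x x + y.
Proof.
move=> yV; rewrite jacobi_shiftE jacobi_V//; have [_ /imP yo] := spaceVP _ yV.
by rewrite /tail_coord big1 ?scale0r ?subr0// => a _; exact: yo.
Qed.

Lemma jacobi_shift_stable_V y : y \in V -> jacobi_shift y \in V.
Proof.
move=> yV; rewrite jacobi_shift_V//; have [xy yim] := spaceVP _ yV; apply/spaceVP; split.
  rewrite gC (sformDl (met_linear F p) (Rm y x x)) (gC y) xy addr0 -/(r y x x x).
  have := cl_skew34 rl y x x x; lra.
rewrite rpredD//; apply/imP => a; rewrite -/(r y x x (xi a)) (cl_skew34 rl).
by rewrite curvature_form_xi (im_reeb xim) (im_reeb yim) !mul0r subrr mulr0 oppr0.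
Qed.

Lemma jacobi_shift_X w : w \in X -> jacobi_shift w = tail_coord w *: tail_xi.
Proof.
have tl : linear (fun w => tail_coord w *: tail_xi).
  move=> c w1 w2; rewrite scalerA -scalerDl; congr (_ *: _).
  rewrite /tail_coord mulr_sumr -big_split; apply: eq_bigr => a _.
  by rewrite met_linear.
pose tM := GRing.isLinear.Build R T T *:%R _ tl.
pose tL : {linear T -> T} := HB.pack (fun w => tail_coord w *: tail_xi) tM.
have : (X <= lker (jacobi_shift - linfun tL))%VS.
  apply/subv_sumP => a aa1; rewrite -memvE memv_ker_sub jacobi_shiftE lfunE /=.
  have ka : tail_coord (xi a) = 1.
    rewrite /tail_coord (bigD1 a)//= big1 => [|c /andP [_ ca]].
      by rewrite (met_xi_xi hF hm) eqxx /esign (negPf aa1) addr0.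
    by rewrite (met_xi_xi hF hm) eq_sym (negPf ca).
  rewrite jacobi_xi// ka !scale1r uE /xi_tilde (bigD1 a1)//= -/tail_xi.
  by rewrite addrA [x + _]addrC [X in X - _]addrC addrK.
move=> /subvP XK wX; have := XK w wX.
by rewrite memv_ker_sub (lfunE tL) => /eqP.
Qed.

Lemma tail_xi_X : tail_xi \in X.
Proof. by apply: memv_sumr => a aa1; exact: memv_line. Qed.

Lemma V_cap_X : (V :&: X = 0)%VS.
Proof.
apply/eqP; rewrite -subv0; apply/subvP => y; rewrite memv_cap memv0.
move=> /andP [/spaceVP [_ yim] yX].
have : (X <= lker phi)%VS.
  by apply/subv_sumP => a _; rewrite -memvE memv_ker (phi_xi hF hm).
move=> /subvP /(_ y yX); rewrite memv_ker => /eqP py.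
by have := im_phi2 yim; rewrite py linear0 => /eqP; rewrite eq_sym oppr_eq0.
Qed.

Let g_xi1_u : g (xi a1) u = -1.
Proof. by rewrite uE !gE (met_xi_xi hF hm) eqxx esign1 (gC _ x) x_xi addr0. Qed.

Lemma W_sub_perp : (W <= A)%VS.
Proof.
rewrite subv_add; apply/andP; split.
  apply/subvP => y /spaceVP [xy /imP yo]; rewrite memv_ker -[met F p u y]/(g u y).
  by rewrite uE !gE xy (gC _ y) yo addr0.
apply/subv_sumP => a aa1; rewrite -memvE memv_ker -[met F p u _]/(g u _).
by rewrite uE !gE x_xi (met_xi_xi hF hm) (eq_sym a1) (negPf aa1) addr0.
Qed.

Lemma perp_sub_W : (A <= W + B)%VS.
Proof.
apply/subvP => w; rewrite memv_ker => /eqP; rewrite -[met F p u w]/(g u w) => uw.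
(* Subtracting c u is what removes the xi_1-component: orthogonality to u gives g(xi_1, w) = -c,
   while g(xi_1, u) = -1. *)
pose c := g x w; have g1w : g (xi a1) w = - c.
  by move: uw; rewrite uE gE -/c; lra.
rewrite -[w](subrK (c *: u)) memv_add ?memvZ ?memv_line//.
set w' := w - c *: u.
have w'1 : g w' (xi a1) = 0.
  by rewrite /w' !gE (gC w) (gC u) g1w g_xi1_u; lra.
have -> : w' = - phi (phi w') + \sum_a (esign a * g w' (xi a)) *: xi a.
  by rewrite (phi2_met hF hm p w') opprD opprK addrNK.
apply: memv_add.
  apply/spaceVP; split; last by rewrite memvN; exact: memv_img (memvf _).
  rewrite !gE gC phi2_horizontal opprK horizontal_formC im_horizontal// /w' !gE -/c.
  by rewrite uE !gE x_xi x1; lra.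
rewrite (bigD1 a1)//= w'1 mulr0 scale0r add0r.
apply: memv_sumr => a aa1; exact: memvZ (memv_line _).
Qed.

Lemma W_cap_line : (W :&: B = 0)%VS.
Proof.
apply/eqP; rewrite -subv0; apply/subvP => w; rewrite memv_cap memv0.
move=> /andP [wW /vlineP [c wE]].
have : (W <= lker (met F p (xi a1)))%VS.
  rewrite subv_add; apply/andP; split.
    apply/subvP => y /spaceVP [_ /imP yo]; rewrite memv_ker -[met F p _ y]/(g _ y).
    by rewrite gC yo.
  apply/subv_sumP => a aa1; rewrite -memvE memv_ker -[met F p _ (xi a)]/(g _ _).
  by rewrite (met_xi_xi hF hm) (eq_sym a1) (negPf aa1).
move=> /subvP /(_ w wW); rewrite memv_ker -[met F p _ w]/(g (xi a1) w) wE gE g_xi1_u.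
by rewrite mulrN1 oppr_eq0 => /eqP ->; rewrite scale0r.
Qed.

Lemma jacobi_stable_perp : (jacobi D p u @: A <= A)%VS.
Proof.
apply/subvP => _ /memv_imgP [y _ ->]; rewrite memv_ker jacobiE -[met F p u _]/(g u _).
by rewrite gC -/(r y u u u); apply/eqP; have := cl_skew34 rl y u u u; lra.
Qed.

Lemma jacobi_stable_line : (jacobi D p u @: B <= B)%VS.
Proof.
apply/subvP => _ /memv_imgP [y /vlineP [c ->] ->]; rewrite linearZ /= jacobiE.
have -> : Rm u u u = 0; last by rewrite scaler0 mem0v.
apply: (sform_inj (met_linear F p) (met_nondegenerate hF (p := p))) => w.
by rewrite -/(r u u u w) (sform0l (met_linear F p)); have := cl_skew12 rl u u u w; lra.
Qed.

Lemma line_sub_perp : (B <= A)%VS.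
Proof.
rewrite -memvE memv_ker -[met F p u u]/(g u u) {1}uE gE g_xi1_u.
by rewrite uE gE x_xi x1 add0r addNr.
Qed.

Lemma V_sub_W : (V <= W)%VS. Proof. exact: addvSl. Qed.

Lemma jacobi_shift_W w : w \in W ->
  jacobi_shift w \in W /\ jacobi D p u w - jacobi_shift w \in B.
Proof.
move=> /memv_addP [y yV [z zX ->]]; split.
  have -> : jacobi_shift (y + z) = jacobi_shift y + jacobi_shift z by rewrite linearD.
  rewrite memv_add ?jacobi_shift_stable_V//.
  by rewrite jacobi_shift_X// memvZ// tail_xi_X.
by rewrite jacobiE jacobi_shiftE opprB addrC subrK memvZ// memv_line.
Qed.

Lemma dim_jacobi_bar c :
  \dim (passmx.leigenspace (jacobi_bar F D p u) c) =
    (\dim (V :&: passmx.leigenspace jacobi_shift c) +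
     \dim (X :&: passmx.leigenspace jacobi_shift c))%N.
Proof.
rewrite /jacobi_bar (dim_leigenspace_quotient c line_sub_perp W_sub_perp perp_sub_W W_cap_line
  jacobi_stable_perp jacobi_stable_line jacobi_shift_W).
apply: dim_leigenspace_add; first exact: V_cap_X.
  by apply/subvP => _ /memv_imgP [y yV ->]; exact: jacobi_shift_stable_V.
apply/subvP => _ /memv_imgP [y yX ->]; rewrite jacobi_shift_X//.
by rewrite memvZ// tail_xi_X.
Qed.

Lemma jacobi_phiE (y : subvs_of V) : vsval (jacobi_phi F D a1 p u y) = Rm (vsval y) x x + vsval y.
Proof.
have yV := subvsP y; set v := vsval y in yV *.
have vW := subvP V_sub_W v yV; have hV := jacobi_shift_stable_V yV.
have hW := subvP V_sub_W _ hV; have vA := subvP W_sub_perp v vW.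
have piE (w : subvs_of W) : piW F a1 p u w = quotv_pi A B (vsval w) 
  by rewrite /piW lfunE.
(* Injectivity of [piW] is what makes its formal inverse a genuine left inverse in [jacobiW]. *)
have ker0 : lker (piW F a1 p u) == 0%VS.
  rewrite -subv0; apply/subvP => w; rewrite memv_ker piE memv0.
  have wW := subvsP w; rewrite quotv_pi_eq0 ?(subvP W_sub_perp)// => wB.
  have : vsval w \in (W :&: B)%VS by rewrite memv_cap wW.
  by rewrite W_cap_line memv0 => /eqP w0; apply/eqP/val_inj.
have pih : quotv_pi A B (Rm v u u) = quotv_pi A B (jacobi_shift v).
  apply/eqP; rewrite -subr_eq0 -linearB.
  have [_] := jacobi_shift_W vW; rewrite jacobiE => jB.
  by rewrite quotv_pi_eq0// (subvP line_sub_perp).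
rewrite -jacobi_shift_V// /jacobi_phi lfunE /=.
rewrite -/v; set w := vsproj W v.
have wE : vsval w = v by rewrite vsprojK.
have -> : jacobiW F D a1 p u w = vsproj W (jacobi_shift v).
  rewrite /jacobiW !comp_lfunE piE wE.
  have -> : jacobi_bar F D p u (quotv_pi A B v) = piW F a1 p u (vsproj W (jacobi_shift v)).
    rewrite piE vsprojK// -pih -jacobiE /jacobi_bar quotv_end_pi//.
    - exact: line_sub_perp.
    - exact: jacobi_stable_perp.
    - exact: jacobi_stable_line.
  by rewrite lker0_lfunK.
by rewrite !vsprojK.
Qed.

Lemma dim_jacobi_phi c : \dim (passmx.leigenspace (jacobi_phi F D a1 p u) c) =
  \dim (V :&: passmx.leigenspace jacobi_shift c).
Proof.
apply: dim_leigenspace_sub => y; rewrite jacobi_phiE jacobi_shift_V//.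
exact: subvsP.
Qed.

Lemma dim_spaceV : \dim V = (2 * n).-1.
Proof.
have cap : (V :&: <[x]> = 0)%VS.
  apply/eqP; rewrite -subv0; apply/subvP => w; rewrite memv_cap memv0.
  move=> /andP [/spaceVP [xw _] /vlineP [c wE]]; move: xw; rewrite wE gE x1 mulr1 => ->.
  by rewrite scale0r.
have sum : (V + <[x]> = im)%VS.
  apply/vspaceP => w; apply/idP/idP => [/memv_addP [y /spaceVP [_ yim] [_ /vlineP [c ->] ->]]|wim].
    by rewrite rpredD ?rpredZ.
  rewrite -[w](subrK (g x w *: x)) memv_add ?memvZ ?memv_line//.
  by apply/spaceVP; rewrite !gE x1 mulr1 subrr rpredB ?rpredZ.
have := gff_phi_rank (lS_gff hF) p; rewrite -/im -sum dimv_disjoint_sum// dim_vline.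
have -> : x != 0 by apply/eqP => x0; move: x1; rewrite x0 gE => /eqP; rewrite eq_sym oner_eq0.
by rewrite addn1 => <-.
Qed.

End NullVector.
End NullJacobi.

(** * The pointwise Osserman condition *)

Section ModelTensor.
Context {R : realFieldType} {V : lmodType R}.
Variables (h : V -> R) (s j : V -> V -> R) (c k : R).
Hypothesis hl : forall a x y, h (a *: x + y) = a * h x + h y.
Hypothesis sl : forall a x y z, s (a *: x + y) z = a * s x z + s y z.
Hypothesis sC : forall x y, s x y = s y x.
Hypothesis jl : forall a x y z, j (a *: x + y) z = a * j x z + j y z.
Hypothesis jC : forall x y, j x y = - j y x.

(* The right-hand side of the formula paired with w, for h = g(., xi~),
   s = g(phi ., phi .) and j = g(J phi^2 ., .), with c = c2 and k = c1 - c2. *)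
Definition model_form x y z w : R :=
  s y z * h x * h w - s x z * h y * h w + h y * h z * s x w - h x * h z * s y w
  - (1 - c) * (s y z * s x w - s x z * s y w)
  - k / 3 * (- j y z * j x w + j x z * j y w + 2 * j x y * j z w).

Lemma model_form_like : curvature_like model_form.
Proof.
have sr a x y z : s z (a *: x + y) = a * s z x + s z y by rewrite !(sC z) sl.
have jr a x y z : j z (a *: x + y) = a * j z x + j z y.
  by rewrite !(jC z) jl; ring.
split=> [a x x' y z w|a x y z z' w|x y z w|x y z w|x y z w]; rewrite /model_form.
- by rewrite !hl !sl !jl; field.
- by rewrite !hl !sr !jr !jl; field.
- by rewrite (jC y x); field.
- by rewrite (jC w z); field.
- by rewrite (sC z x) (sC z y) (sC y x) (jC z x) (jC z y) (jC y x); field.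
Qed.

End ModelTensor.

Section PointwiseOsserman.
Context {R : realType} {m s : nat} {M : manifold R m} (F : gff_data M s).
Context (n : nat) (a1 : 'I_s) (D : connection M).
Hypothesis hF : lorentzian_S_manifold F n a1.
Hypothesis hm : m = (2 * n + s)%N.
Hypothesis hD : levi_civita (met F) D.
Variable p : M.
Local Notation T := 'rV[R]_m.
Local Notation g := (metf (met F) p).
Local Notation phi := (Defs.phi F p).
Local Notation xi a := (Defs.xi F a p).
Local Notation Rm := (curvature_at D p).
Local Notation im := (im_phi F p).
Local Notation r := (curvature_form F D p).
Local Notation hs := (horizontal_form F p).
Local Notation h1 := (reeb_form F p).
Implicit Types (x y z w u : T) (a : 'I_s).

Let gE := metE hF p.
Let gC := metC hF p.
Let gl := met_linear F p.

Lemma reeb_form_linear c x y : h1 (c *: x + y) = c * h1 x + h1 y.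
Proof. exact: gl. Qed.

Lemma horizontal_form_linear c x y z : hs (c *: x + y) z = c * hs x z + hs y z.
Proof. by rewrite /horizontal_form linearP gl. Qed.

Lemma eta_tildeE x : eta_tilde F p x = h1 x.
Proof.
rewrite /eta_tilde /reeb_form /xi_tilde (sform_sumr gl gC); apply: eq_bigr => a _.
by rewrite (met_xi hF hm).
Qed.

Lemma phi2_phi2 x y : g (phi2 F p x) (phi2 F p y) = hs x y.
Proof.
rewrite /phi2 (phi_skew hF hm) (phi3 hF hm) gE opprK; reflexivity.
Qed.

Section HermitianStructure.
Variable J : 'End(subvs_of im).
Hypothesis hJ : almost_hermitian J.

Definition fundamental_form x y : R := g (Jphi2 J x) y.
Local Notation j := fundamental_form.

Lemma fundamental_form_linear c x y z : j (c *: x + y) z = c * j x z + j y z.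
Proof.
rewrite /fundamental_form -gl; congr (g _ z).
by rewrite /Jphi2 /phi2 !linearP.
Qed.

Lemma Jphi2_im x : Jphi2 J x \in im. Proof. exact: subvsP. Qed.

Lemma phi2_im x : phi2 F p x \in im. Proof. exact: memv_img (memvf _). Qed.

Lemma im_phi2_form v y : v \in im -> g v (phi2 F p y) = - g v y.
Proof.
move=> vim; rewrite gC /phi2 (phi2_horizontal hF hm) (horizontal_formC hF).
by rewrite (im_horizontal hF hm).
Qed.

Let J_skew (a b : subvs_of im) : g (vsval (J a)) (vsval b) = - g (vsval a) (vsval (J b)).
Proof.
have [JJ Jiso] := hJ; have := Jiso (J a) b; rewrite JJ => E.
have -> : g (vsval (J a)) (vsval b) = g (vsval (- a)) (vsval (J b)) by exact: esym.
by rewrite linearN gE.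
Qed.

Lemma fundamental_formE x y :
  j x y = - g (vsval (J (vsproj im (phi2 F p x)))) (vsval (vsproj im (phi2 F p y))).
Proof.
rewrite vsprojK ?phi2_im// im_phi2_form ?opprK//; exact: subvsP.
Qed.

Lemma fundamental_form_skew x y : j x y = - j y x.
Proof. by rewrite !fundamental_formE J_skew gC. Qed.

Lemma curvature_rhsE c2 k x y z w :
  g (tensorT F p x y z - tensorS F p x y z - c2 *: tensorR0 F p x y z -
     (k / 3) *: tensorRJ J x y z) w = model_form h1 hs j c2 k x y z w.
Proof.
have met' (u v : T) : (met F p u v : R) = g u v by [].
have xit v : g (xi_tilde F p) v = h1 v by rewrite gC.
have p2 u v : g (phi2 F p u) v = - hs u v by exact: (phi2_horizontal hF hm).
have jj u v : g (Jphi2 J u) v = j u v by [].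
have jphi u v : g (Jphi2 J u) (phi2 F p v) = - j u v by rewrite im_phi2_form// Jphi2_im.
have phij u v : g (phi2 F p u) (Jphi2 J v) = j u v.
  by rewrite gC jphi fundamental_form_skew opprK.
rewrite /tensorT /tensorS /tensorR0 /tensorRJ !eta_tildeE !met' !phi2_phi2 !jphi !phij.
rewrite -/(hs y z) -/(hs x z) !gE !xit !p2 !jj /model_form; by field.
Qed.

Section Formula.
Variables c1 c2 : R.
Hypothesis c12 : c1 != c2.
Hypothesis RmE : forall x y z, Rm x y z =
  tensorT F p x y z - tensorS F p x y z - c2 *: tensorR0 F p x y z -
  ((c1 - c2) / 3) *: tensorRJ J x y z.

Variables (x u : T).
Hypothesis xim : x \in im.
Hypothesis x1 : g x x = 1.
Hypothesis uE : u = xi a1 + x.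

(** For z equal to the second argument x, the second term of R^J contributes once and the last one
    twice the same product, which cancels the denominator 3. *)
Lemma jacobi_of_formula y : y \in spaceV F a1 p u ->
  Rm y x x + y = c2 *: y + ((c1 - c2) * j x y) *: Jphi2 J x.
Proof.
move=> /(spaceVP uE) [xy yim]; have jxx : j x x = 0.
  by have := fundamental_form_skew x x; lra.
apply: (sform_inj gl (met_nondegenerate hF (p := p))) => w.
rewrite (sformDl gl (Rm y x x)) RmE curvature_rhsE /model_form !gE -/(j x w).
rewrite (im_reeb hF hm xim) (im_reeb hF hm yim) !(im_horizontal hF hm _ xim) jxx.
rewrite !(im_horizontal hF hm _ yim) (gC y x) xy x1 (fundamental_form_skew y x).
by field.
Qed.

Lemma dim_jacobi_phi_of_formula c :
  \dim (passmx.leigenspace (jacobi_phi F D a1 p u) c) =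
    if c == c1 then 1%N else if c == c2 then (2 * n - 2)%N else 0%N.
Proof.
have jxx : j x x = 0 by have := fundamental_form_skew x x; lra.
have eV : Jphi2 J x \in spaceV F a1 p u.
  by apply/(spaceVP uE); split; [rewrite gC|exact: Jphi2_im].
have jxe : j x (Jphi2 J x) = 1.
  have [_ Jiso] := hJ; rewrite -x1 -(im_horizontal hF hm _ xim) -phi2_phi2.
  rewrite -[in RHS](vsprojK (phi2_im x)); exact: Jiso.
have dV : (\dim {: subvs_of (spaceV F a1 p u)}).-1 = (2 * n - 2)%N.
  rewrite dimvf -[dim _]/(\dim (spaceV F a1 p u)) (dim_spaceV hF xim x1 uE).
  by rewrite subn2.
rewrite -dV; pose l (y : subvs_of (spaceV F a1 p u)) := j x (vsval y).
apply: (@dim_leigenspace_rank_one _ _ _ l (vsproj _ (Jphi2 J x)) c1 c2) => //.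
- move=> a y z; rewrite /l /fundamental_form linearP.
  by rewrite (sformDr gl gC) (sformZr gl gC).
- by rewrite /l vsprojK.
- move=> y; apply: val_inj; rewrite /= (jacobi_phiE hF hm hD xim x1 uE).
  by rewrite vsprojK// jacobi_of_formula// subvsP.
Qed.

End Formula.
End HermitianStructure.

(* For u = xi_1 + x, the spectrum of the Jacobi operator on u^perp / u is that of
   its restriction to V together with a part on span(xi_2, .., xi_s) which does
   not depend on u. *)
Lemma dim_jacobi_bar_phi x u x' u' c :
  x \in im -> g x x = 1 -> u = xi a1 + x ->
  x' \in im -> g x' x' = 1 -> u' = xi a1 + x' ->
  \dim (passmx.leigenspace (jacobi_bar F D p u) c) =
    \dim (passmx.leigenspace (jacobi_bar F D p u') c) <->
  \dim (passmx.leigenspace (jacobi_phi F D a1 p u) c) =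
    \dim (passmx.leigenspace (jacobi_phi F D a1 p u') c).
Proof.
move=> xim x1 uE x'im x'1 u'E.
rewrite (dim_jacobi_bar hF hm hD xim x1 uE) (dim_jacobi_bar hF hm hD x'im x'1 u'E).
rewrite (dim_jacobi_phi hF hm hD xim x1 uE) (dim_jacobi_phi hF hm hD x'im x'1 u'E).
have -> : (\sum_(a | a != a1) <[xi a]> :&:
    passmx.leigenspace (jacobi_shift F a1 D p u) c = \sum_(a | a != a1) <[xi a]> :&:
    passmx.leigenspace (jacobi_shift F a1 D p u') c)%VS.
  apply/vspaceP => w; rewrite !memv_cap !mem_leigenspace.
  case: (boolP (w \in _)) => //= wX.
  by rewrite (jacobi_shift_X hF hm hD xim x1 uE wX) (jacobi_shift_X hF hm hD x'im x'1 u'E wX).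
by split=> [/addIn|->].
Qed.

Section Osserman.
Variables c1 c2 : R.
Hypothesis c12 : c1 != c2.
Hypothesis n0 : (0 < n)%N.
Hypothesis d1 : forall x, x \in im -> g x x = 1 ->
  \dim (passmx.leigenspace (jacobi_phi F D a1 p (xi a1 + x)) c1) = 1%N.
Hypothesis d2 : forall x, x \in im -> g x x = 1 ->
  \dim (passmx.leigenspace (jacobi_phi F D a1 p (xi a1 + x)) c2) = (2 * n - 2)%N.

Let rl := curvature_form_like hF hD p.

Lemma jacobi_rank_one x : x \in im -> g x x = 1 ->
  exists e, [/\ e \in im, g e e = 1, g x e = 0 & forall y, y \in im -> g x y = 0 ->
    Rm y x x + y = c2 *: y + ((c1 - c2) * g y e) *: e].
Proof.
move=> xim x1; set u := xi a1 + x; have uE : u = xi a1 + x by [].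
pose bV (y z : subvs_of (spaceV F a1 p u)) : R := g (vsval y) (vsval z).
have dV : \dim {: subvs_of (spaceV F a1 p u)} = (2 * n).-1.
  by rewrite dimvf -[dim _]/(\dim (spaceV F a1 p u)) (dim_spaceV hF xim x1 uE).
have := @two_eigenvalues R (subvs_of (spaceV F a1 p u)) bV
  (jacobi_phi F D a1 p u) c1 c2; rewrite dV.
case.
- by move=> a y z w; rewrite /bV linearP gl.
- by move=> y z; exact: gC.
- move=> y; have [_ yim] := spaceVP uE _ (subvsP y).
  by have [] := im_positive hF hm yim.
- move=> y y0; have [_ yim] := spaceVP uE _ (subvsP y).
  by have [_ /(_ y0) y00] := im_positive hF hm yim; apply: val_inj.
- move=> y z; rewrite /bV !(jacobi_phiE hF hm hD xim x1 uE).
  move: (vsval y) (vsval z) => v w.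
  have K : r v x x w = r w x x v.
    by rewrite (cl_pair rl) (cl_skew12 rl) (cl_skew34 rl) opprK.
  have E1 := sformDl gl (Rm v x x) v w; have E2 := sformDr gl gC (Rm w x x) w v.
  apply: (etrans E1); apply: (etrans _ (esym E2)); congr (_ + _).
  exact: etrans K (gC _ _).
- exact: c12.
- exact: d1.
- by rewrite d2// subn2.
- by rewrite -subn1 subn_gt0 (leq_trans _ (leq_pmulr 2 n0)).
move=> e e1 eE; have [xe eim] := spaceVP uE _ (subvsP e).
exists (vsval e); split=> // y yim xy.
have yV : y \in spaceV F a1 p u by apply/(spaceVP uE).
have := congr1 vsval (eE (vsproj _ y)); rewrite (jacobi_phiE hF hm hD xim x1 uE).
rewrite vsprojK// => ->.
by rewrite linearD !linearZ /= /bV vsprojK.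
Qed.

(** The rank-one form on V extends to Im(phi) by splitting off the component of y along x, on which
    r(., x, x, .) vanishes; the summand y of the operator on V turns c2 into c2 - 1. *)
Lemma curvature_rank_one x : x \in im -> g x x = 1 ->
  exists e, [/\ e \in im, g e e = 1 & forall y z, y \in im ->
    r y x x z = (c2 - 1) * (g y z - g x y * g x z) + (c1 - c2) * g y e * g e z].
Proof.
move=> xim x1; have [e [eim e1 xe eE]] := jacobi_rank_one xim x1.
exists e; split=> // y z yim; pose y' := y - g x y *: x.
have y'im : y' \in im by rewrite rpredB ?rpredZ.
have xy' : g x y' = 0 by rewrite /y' !gE x1; lra.
have yE : y = g x y *: x + y' by rewrite addrC subrK.
have rxx : r x x x z = 0 by have := cl_skew12 rl x x x z; lra.
rewrite {1}yE (cl_linear1 rl) rxx mulr0 add0r.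
have -> : r y' x x z = g (Rm y' x x + y') z - g y' z.
  by rewrite (sformDl gl (Rm y' x x)) addrK.
by rewrite (eE _ y'im xy') /y' !gE xe; ring.
Qed.

(** Subtracting c2 - 1 times the constant-curvature tensor and dividing by c1 - c2, which is
    nonzero, leaves a curvature tensor with rank-one Jacobi operators. *)
Lemma hermitian_of_osserman x0 : x0 \in im -> g x0 x0 = 1 ->
  exists2 J : 'End(subvs_of im), almost_hermitian J &
    forall x y z : subvs_of im, r (vsval y) (vsval x) (vsval x) (vsval z) =
      (c2 - 1) * (g (vsval x) (vsval x) * g (vsval y) (vsval z) -
        g (vsval x) (vsval y) * g (vsval x) (vsval z)) +
      (c1 - c2) * g (vsval y) (vsval (J x)) * g (vsval z) (vsval (J x)).
Proof.
move=> x0im x01; have k0 : c1 - c2 != 0 by rewrite subr_eq0.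
pose b (x y : subvs_of im) : R := g (vsval x) (vsval y).
have bl (a : R) (x y z : subvs_of im) : b (a *: x + y) z = a * b x z + b y z.
  by rewrite /b linearP gl.
have bC (x y : subvs_of im) : b x y = b y x by exact: gC.
have pos (x : subvs_of im) := im_positive hF hm (subvsP x).
have vl (a : R) (x y : subvs_of im) : vsval (a *: x + y) = a *: vsval x + vsval y.
  by rewrite linearP.
have rl' : curvature_like (fun x y z w : subvs_of im => r (vsval x) (vsval y) (vsval z) (vsval w)).
  split=> [a x x' y z w|a x y z z' w|x y z w|x y z w|x y z w].
  - by rewrite vl (cl_linear1 rl).
  - by rewrite vl (cl_linear3 rl).
  - exact: (cl_skew12 rl).
  - exact: (cl_skew34 rl).
  - exact: (cl_bianchi rl).
have r'l := curvature_like_scale (c1 - c2)^-1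
  (curvature_like_sub rl' (curvature_like_scale (c2 - 1) (curvature_like_form bl bC))).
have [||||J [Jl JJ Jiso Jr]] := @hermitian_of_rank_one R (subvs_of im) b _ bl bC _ _ r'l _
  (vsproj im x0) _.
- by move=> x; have [] := pos x.
- by move=> x xx; have [_ /(_ xx) x00] := pos x; apply: val_inj.
- move=> x x1; have [e [eim e1 eE]] := curvature_rank_one (subvsP x) x1.
  exists (vsproj im e); first by rewrite /b vsprojK.
  move=> y z; rewrite (eE _ _ (subvsP y)) /b vsprojK// -!/(b _ _) x1 (bC y x).
  rewrite (gC e); move: (b y z) (b x y) (b x z) (g (vsval y) e) (g (vsval z) e) => t1 t2 t3 t4 t5.
  by field.
- by rewrite /b vsprojK.
pose JM := GRing.isLinear.Build R (subvs_of im) (subvs_of im) *:%R J Jl.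
pose JL : {linear subvs_of im -> subvs_of im} := HB.pack J JM.
have JE (x : subvs_of im) : linfun JL x = J x by rewrite lfunE.
exists (linfun JL).
  by split=> [x|x y]; rewrite !JE//; exact: Jiso.
move=> x y z; rewrite JE -/(b y (J x)) -/(b z (J x)) -mulrA -(Jr x y z).
by rewrite mulrA divff// mul1r /b (gC (vsval y) (vsval x)) addrC subrK.
Qed.

(** The difference d of the two sides is a curvature tensor that vanishes whenever some argument is
    characteristic. It is thus determined on Im(phi), where its sectional values are zero by the
    hypothesis on J. *)
Lemma formula_of_hermitian (J : 'End(subvs_of im)) : almost_hermitian J ->
  (forall x y z : subvs_of im, r (vsval y) (vsval x) (vsval x) (vsval z) =
      (c2 - 1) * (g (vsval x) (vsval x) * g (vsval y) (vsval z) -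
        g (vsval x) (vsval y) * g (vsval x) (vsval z)) +
      (c1 - c2) * g (vsval y) (vsval (J x)) * g (vsval z) (vsval (J x))) ->
  forall x y z, Rm x y z =
    tensorT F p x y z - tensorS F p x y z - c2 *: tensorR0 F p x y z -
    ((c1 - c2) / 3) *: tensorRJ J x y z.
Proof.
move=> hJ rJ x y z; pose j := fundamental_form J.
apply: (sform_inj gl (met_nondegenerate hF (p := p))) => w.
rewrite curvature_rhsE// -/(r x y z w) -/j.
have jC u v : j u v = - j v u by exact: fundamental_form_skew.
pose q := model_form h1 hs j c2 (c1 - c2).
have ql : curvature_like q.
  apply: model_form_like; [exact: reeb_form_linear|exact: horizontal_form_linear| | |exact: jC].
    exact: horizontal_formC hF _.
  exact: fundamental_form_linear.
pose d x y z w := r x y z w - q x y z w.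
have dl : curvature_like d by exact: curvature_like_sub rl ql.
have jxi v a : j v (xi a) = 0.
  by rewrite /j /fundamental_form; apply/(imP hF hm); exact: Jphi2_im.
have dxi v v' a w' : d v v' (xi a) w' = 0.
  rewrite /d (curvature_form_xi hF hm hD) /q /model_form (reeb_xi hF hm).
  rewrite !(horizontal_formC hF _ _ (xi a)) !(horizontal_xi hF hm) (jC (xi a)) !jxi.
  move: (esign _ _) (h1 v) (h1 v') (hs v w') (hs v' w') (j v v') (j v w') (j v' w') => *.
  by field.
(* The orthogonal projection onto Im(phi). *)
pose P v := - phi (phi v).
have PE v : v = P v + \sum_a (esign a1 a * g v (xi a)) *: xi a.
  by rewrite /P (phi2_met hF hm) opprD opprK addrNK.
have P_im v : P v \in im by rewrite memvN; exact: memv_img (memvf _).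
have d3 u1 u2 v w' : d u1 u2 v w' = d u1 u2 (P v) w'.
  rewrite {1}(PE v) -[P v]scale1r (cl_linear3 dl) mul1r scale1r.
  rewrite [X in _ + X](_ : _ = 0) ?addr0//.
  have d0 : d u1 u2 0 w' = 0.
    by have := cl_linear3 dl 1 u1 u2 0 0 w'; rewrite scaler0 addr0; lra.
  elim/big_rec: _ => [//|a v' _ v'0].
  by rewrite (cl_linear3 dl) dxi v'0 mulr0 addr0.
(* The skew and pair symmetries bring each slot in turn into the third one, where [d3] applies. *)
have dP u1 u2 v w' : d u1 u2 v w' = d (P u1) (P u2) (P v) (P w').
  rewrite d3 (cl_skew34 dl) d3 -(cl_skew34 dl) (cl_pair dl).
  by rewrite d3 (cl_skew34 dl) d3 -(cl_skew34 dl) (cl_pair dl).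
apply/eqP; rewrite -subr_eq0 -/(q x y z w) -/(d x y z w); apply/eqP.
apply: (sectional_zero dl) => v v'; rewrite dP; move: (P v) (P v') (P_im v) (P_im v').
move=> a b aim bim; rewrite /d /q /model_form.
have := rJ (vsproj im a) (vsproj im b) (vsproj im b); rewrite !vsprojK// => ->.
rewrite !(im_reeb hF hm aim) !(im_reeb hF hm bim) !(im_horizontal hF hm _ aim).
rewrite !(im_horizontal hF hm _ bim) (jC b a).
have jaa : j a a = 0 by have := jC a a; lra.
have jab : g b (vsval (J (vsproj im a))) = - j a b.
  rewrite /j /fundamental_form /Jphi2 /phi2 (im_phi2 hF hm aim) !linearN /= gE opprK gC //.
rewrite jaa jab (gC b a).
move: (g a a) (g b b) (g a b) (j a b) => *; by field.
Qed.

End Osserman.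
End PointwiseOsserman.

(** * The equivalence *)

Lemma exists_unit_vector (R : realType) (m s n : nat) (M : manifold R m)
    (F : gff_data M s) (a1 : 'I_s) (p : M) : lorentzian_S_manifold F n a1 ->
  m = (2 * n + s)%N -> (0 < n)%N ->
  exists2 x, x \in im_phi F p & metf (met F) p x x = 1.
Proof.
move=> hF hm n0; have gl := met_linear F p; have gC := metC hF p.
have := gff_phi_rank (lS_gff hF) p; rewrite -/(im_phi F p).
have [->|im0 _] := eqVneq (im_phi F p) 0%VS.
  by rewrite dimv0 => /esym/eqP; rewrite muln_eq0 /= -[n == 0%N]negbK -lt0n n0.
set x := vpick (im_phi F p); have xim : x \in im_phi F p by exact: memv_pick.
have [x_ge0 x_eq0] := im_positive hF hm xim.
have xx : 0 < metf (met F) p x x.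
  by rewrite lt_def x_ge0 andbT; apply/eqP => /x_eq0 /eqP; rewrite vpick0 (negPf im0).
pose t := Num.sqrt (metf (met F) p x x).
have tt : t * t = metf (met F) p x x by rewrite -expr2 sqr_sqrtr// ltW.
have t0 : t != 0 by rewrite gt_eqF// sqrtr_gt0.
exists (t^-1 *: x); first exact: rpredZ.
by rewrite (sformZl gl) (sformZr gl gC) -tt; field.
Qed.

(* MathComp-Analysis *)
Theorem theorem4p4 (R : realType) (n s : nat) (hn : (1 < n)%N) (hs : (0 < s)%N)
    (M : manifold R (2 * n + s)) (F : gff_data M s)
    (hF : lorentzian_S_manifold F n (Ordinal hs))
    (D : connection M) (hD : levi_civita (met F) D) (p : M) :
  (phi_null_osserman F D (Ordinal hs) p /\
   forall u, null_congruence F (Ordinal hs) p u ->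
     exists c1 c2 : R,
       [/\ c1 <> c2,
           forall c : R, passmx.leigenvalue (jacobi_phi F D (Ordinal hs) p u) c <->
                         c = c1 \/ c = c2,
           \dim (passmx.leigenspace (jacobi_phi F D (Ordinal hs) p u) c1) = 1%N &
           \dim (passmx.leigenspace (jacobi_phi F D (Ordinal hs) p u) c2) =
             (2 * n - 2)%N])
  <->
  (exists (J : 'End(subvs_of (im_phi F p))) (c1 c2 : R),
     [/\ almost_hermitian J, c1 <> c2 &
         forall x y z : 'rV[R]_(2 * n + s),
           curvature_at D p x y z =
             tensorT F p x y z - tensorS F p x y z
             - c2 *: tensorR0 F p x y z
             - ((c1 - c2) / 3) *: tensorRJ J x y z]).
Proof.
have hm : (2 * n + s = 2 * n + s)%N by [].
have n0 : (0 < n)%N by exact: ltnW.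
split=> [[oss eig]|[J [c1 [c2 [hJ /eqP c12 RmE]]]]].
  have [x0 x0im x01] := exists_unit_vector p hF hm n0.
  have nc x : x \in im_phi F p -> metf (met F) p x x = 1 ->
    null_congruence F (Ordinal hs) p (xi F (Ordinal hs) p + x) by move=> ? ?; exists x.
  (* The eigenvalues are read off at one null vector; [dE] carries their multiplicities to all
     others. *)
  have [c1 [c2 [/eqP c12 _ d1 d2]]] := eig _ (nc _ x0im x01).
  have dE x c : x \in im_phi F p -> metf (met F) p x x = 1 ->
      \dim (passmx.leigenspace (jacobi_phi F D (Ordinal hs) p (xi F (Ordinal hs) p + x)) c) =
      \dim (passmx.leigenspace (jacobi_phi F D (Ordinal hs) p (xi F (Ordinal hs) p + x0)) c).
    move=> xim x1.
    apply: (dim_jacobi_bar_phi hF hm hD c xim x1 erefl x0im x01 erefl).1.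
    exact: oss (nc _ xim x1) (nc _ x0im x01) c.
  have d1' x (xim : x \in im_phi F p) (x1 : metf (met F) p x x = 1) := etrans (dE x c1 xim x1) d1.
  have d2' x (xim : x \in im_phi F p) (x1 : metf (met F) p x x = 1) := etrans (dE x c2 xim x1) d2.
  have [J hJ rJ] := hermitian_of_osserman hF hm hD c12 n0 d1' d2' x0im x01.
  exists J, c1, c2; split=> //; first exact/eqP.
  exact: (formula_of_hermitian hF hm hD hJ rJ).
have dE u c : null_congruence F (Ordinal hs) p u ->
    \dim (passmx.leigenspace (jacobi_phi F D (Ordinal hs) p u) c) =
    if c == c1 then 1%N else if c == c2 then (2 * n - 2)%N else 0%N.
  move=> [x [xim x1] uE].
  exact: (dim_jacobi_phi_of_formula hF hm hD hJ c12 RmE xim x1 (esym uE)).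
split=> [u v hu hv c|u hu].
  case: (hu) => x [xim x1] uE; case: (hv) => y [yim y1] vE.
  apply: (dim_jacobi_bar_phi hF hm hD c xim x1 (esym uE) yim y1 (esym vE)).2.
  by rewrite !dE.
exists c1, c2; split; first exact/eqP.
- move=> c; rewrite /passmx.leigenvalue -dimv_eq0 dE//.
  have [->|cc1] := eqVneq c c1; first by split=> // _; left.
  have [->|cc2] := eqVneq c c2.
    split=> [_|_]; first by right.
    (* Here n > 1 makes 2n - 2 positive, so that c2 really is an eigenvalue. *)
    by rewrite -lt0n subn_gt0 -[X in (X < _)%N]muln1 ltn_pmul2l.
  by split=> // -[] /eqP; [rewrite (negPf cc1)|rewrite (negPf cc2)].
- by rewrite dE// eqxx.
- by rewrite dE// eqxx eq_sym (negPf c12).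
Qed.
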